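(* Let $X$ be a complex manifold which carries a locally conformally Kähler (l.c.K.) metric, let $P\in X$ be any point, and let $\widehat{X}$ be the blow-up of $X$ at $P$. Then the complex manifold $\widehat{X}$ also carries an l.c.K. metric.
   Context: Locally conformally Kähler metrics. Let $(X,J)$ be a complex manifold. A hermitian metric $g$ on $X$ is called locally conformally Kähler (l.c.K.) if there exists an open cover $\{U_\alpha\}_{\alpha\in A}$ of $X$ such that for each $\alpha\in A$ there is a smooth function $f_\alpha: U_\alpha\to\mathbb{R}$ such that the metric $g_\alpha=e^{-f_\alpha}g|_{U_\alpha}$ is Kähler on $U_\alpha$. Equivalently, with $\omega(Y,Z)=g(Y,JZ)$ the Kähler form of $g$, there exists a closed $1$-form $\theta$ on $X$ (the Lee form) such that $d\omega=\theta\wedge\omega$. In this definition globally conformally Kähler metrics (the case of exact $\theta$) are not excluded. Blow-up at a point. Let $X$ be a complex manifold of dimension $n$ and $P\in X$. Choose holomorphic coordinates $(x_1,\dots,x_n)$ on an open neighborhood $U$ of $P$ with $x_1(P)=\dots=x_n(P)=0$, and let $[y_1:\dots:y_n]$ be homogeneous coordinates on $\mathbb{P}^{n-1}(\mathbb{C})$. Let $\widehat{U}\subset U\times\mathbb{P}^{n-1}(\mathbb{C})$ be the closed complex submanifold defined by the equations $x_iy_j=x_jy_i$ for $1\le i<j\le n$, and let $c:\widehat{U}\to U$ be the restriction of the first projection. Then $E=c^{-1}(\{P\})$ is biholomorphic to $\mathbb{P}^{n-1}(\mathbb{C})$, and $c$ restricts to a biholomorphism $\widehat{U}\setminus E\to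 U\setminus\{P\}$. The blow-up $\widehat{X}$ of $X$ at $P$ is the complex manifold obtained by gluing $\widehat{U}$ to $X\setminus\{P\}$ along $\widehat{U}\setminus E\cong U\setminus\{P\}$ by means of $c$. *)

(* Defs.v *)
From HB Require Import structures.
From mathcomp Require Import all_boot all_order all_algebra complex.
From mathcomp Require Import all_classical all_reals all_analysis.
Set Implicit Arguments.
Unset Strict Implicit.
Unset Printing Implicit Defensive.
Import Order.TTheory GRing.Theory Num.Theory.
Import numFieldNormedType.Exports.
Local Open Scope classical_set_scope.
Local Open Scope ring_scope.

HB.instance Definition _ (R : rcfType) :=
  PseudoPointedMetric.copy R[i] (R[i])^o.
HB.instance Definition _ (R : rcfType) := NormedModule.copy R[i] (R[i])^o.

(* [cmap] and [cinv] are total functions; their values off [cdom] and off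
   [cmap @` cdom] are junk and are never used. *)
Record chart (R : realType) (n : nat) (X : topologicalType) := Chart {
  cdom : set X;
  cmap : X -> 'rV[R[i]]_n;
  cinv : 'rV[R[i]]_n -> X }.

Definition cimg (R : realType) (n : nat) (X : topologicalType)
  (phi : chart R n X) (U : set X) : set 'rV[R[i]]_n :=
  cmap phi @` (cdom phi `&` U).

Record is_chart (R : realType) (n : nat) (X : topologicalType)
  (phi : chart R n X) : Prop := IsChart {
  chart_open_dom : open (cdom phi);
  chart_open_img : open (cimg phi setT);
  chart_cancel : forall p, cdom phi p -> cinv phi (cmap phi p) = p;
  chart_cont : forall p, cdom phi p -> {for p, continuous (cmap phi)};
  chart_cont_inv :
    forall p, cdom phi p -> {for cmap phi p, continuous (cinv phi)} }.

Definition transition (R : realType) (n : nat) (X : topologicalType)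
  (phi psi : chart R n X) : 'rV[R[i]]_n -> 'rV[R[i]]_n :=
  cmap psi \o cinv phi.

(* Differentiability is over the field R[i], i.e. complex differentiability. *)
Definition holo_transition (R : realType) (n : nat) (X : topologicalType)
  (phi psi : chart R n X) : Prop :=
  forall p, cdom phi p -> cdom psi p ->
    differentiable (transition phi psi) (cmap phi p).

(* Atlases need not be maximal. *)
Record complex_manifold (R : realType) (n : nat) (X : topologicalType)
  (A : set (chart R n X)) : Prop := ComplexManifold {
  cm_hausdorff : hausdorff_space X;
  cm_second_countable : @second_countable X;
  cm_chart : forall phi, A phi -> is_chart phi;
  cm_cover : forall p, exists2 phi, A phi & cdom phi p;
  cm_compat : forall phi psi, A phi -> A psi -> holo_transition phi psi }.

Definition holo_coordinates (R : realType) (n : nat) (X : topologicalType)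
  (A : set (chart R n X)) (phi : chart R n X) : Prop :=
  is_chart phi /\
  forall psi, A psi -> holo_transition phi psi /\ holo_transition psi phi.

Definition holo_at (R : realType) (m n : nat) (X Y : topologicalType)
  (A : set (chart R m X)) (B : set (chart R n Y)) (f : X -> Y) (p : X) : Prop :=
  {for p, continuous f} /\
  forall phi psi, A phi -> B psi -> cdom phi p -> cdom psi (f p) ->
    differentiable (cmap psi \o f \o cinv phi) (cmap phi p).

(* [S] is an open subset or a closed complex submanifold of [X], regarded as a
   complex manifold: holomorphic maps out of [S] are those which extend, locally
   around each point of [S], to holomorphic maps on open subsets of [X], and
   holomorphic maps into [S] are those which are holomorphic into [X].  The
   definition says that [f] is a biholomorphism of [S] onto an open subset of
   [Y]. *)
Record open_holo_embedding (R : realType) (m n : nat) (X Y : topologicalType)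
  (A : set (chart R m X)) (B : set (chart R n Y)) (S : set X) (f : S -> Y)
  : Prop := OpenHoloEmbedding {
  ohe_inj : injective f;
  ohe_open : open (range f);
  ohe_holo : forall s : S, exists (O : set X) (F : X -> Y),
    [/\ open O, O (set_val s), forall p, O p -> holo_at A B F p &
        forall t : S, O (set_val t) -> F (set_val t) = f t];
  ohe_holo_inv : forall s : S, exists (O : set Y) (G : Y -> X),
    [/\ open O, O (f s), forall q, O q -> holo_at B A G q &
        forall t : S, O (f t) -> G (f t) = set_val t] }.

Definition prod_chart (R : realType) (m n : nat) (X Y : topologicalType)
  (phi : chart R m X) (psi : chart R n Y) : chart R (m + n) (X * Y)%type :=
  @Chart R (m + n) (X * Y)%type
    (cdom phi `*` cdom psi)
    (fun p => row_mx (cmap phi p.1) (cmap psi p.2))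
    (fun z => (cinv phi (lsubmx z), cinv psi (rsubmx z))).

Definition prod_atlas (R : realType) (m n : nat) (X Y : topologicalType)
  (A : set (chart R m X)) (B : set (chart R n Y))
  : set (chart R (m + n) (X * Y)%type) :=
  [set prod_chart phi psi | phi in A & psi in B].

Section ProjectiveSpace.
Variables (R : realType) (n : nat).

Definition nonzero_vec : Type := set_type [set v : 'rV[R[i]]_n | v != 0].
HB.instance Definition _ := Topological.on nonzero_vec.

Definition vec_of (v : nonzero_vec) : 'rV[R[i]]_n := set_val v.

(* Equality of row spaces, i.e. proportionality. *)
Definition proj_rel (v w : nonzero_vec) : bool := (vec_of v == vec_of w)%MS.

Lemma proj_rel_refl : reflexive proj_rel.
Proof. by move=> v; rewrite /proj_rel !submx_refl. Qed.

Lemma proj_rel_sym : symmetric proj_rel.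
Proof. by move=> v w; rewrite /proj_rel andbC. Qed.

Lemma proj_rel_trans : transitive proj_rel.
Proof.
move=> w v u /andP[vw wv] /andP[wu uw]; rewrite /proj_rel.
by rewrite (submx_trans vw wu) (submx_trans uw wv).
Qed.

Canonical proj_equiv := EquivRel proj_rel
  proj_rel_refl proj_rel_sym proj_rel_trans.

Definition projspace : topologicalType :=
  quotient_topology {eq_quot proj_equiv}%qT.

Definition line_of (v : nonzero_vec) : projspace :=
  (\pi_({eq_quot proj_equiv}) v)%qT.

(* Homogeneous coordinates of a point, for a chosen representative. *)
Definition hcoord (l : projspace) : 'rV[R[i]]_n :=
  vec_of (repr (l : {eq_quot proj_equiv}%qT)).

Lemma hcoord_line_of (v : nonzero_vec) :
  exists2 c : R[i], c != 0 & hcoord (line_of v) = c *: vec_of v.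
Proof.
have /andP[/sub_rVP[c hc] _] : proj_rel (repr (line_of v : {eq_quot _}%qT)) v.
  by apply/eqmodP; rewrite reprK.
exists c => //; apply/eqP => c0.
have : vec_of (repr (line_of v : {eq_quot _}%qT)) != 0.
  exact: (set_valP (repr (line_of v : {eq_quot _}%qT))).
by rewrite hc c0 scale0r eqxx.
Qed.

Definition insert1 (k : 'I_n) (z : 'rV[R[i]]_n.-1) : 'rV[R[i]]_n :=
  \row_j (if unlift k j is Some i then z 0 i else 1).

Lemma insert1_neq0 (k : 'I_n) (z : 'rV[R[i]]_n.-1) :
  insert1 k z \in [set v : 'rV[R[i]]_n | v != 0].
Proof.
apply/mem_set; apply/eqP => /rowP /(_ k); rewrite !mxE unlift_none => /eqP.
by rewrite oner_eq0.
Qed.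

(* [y] |-> (y_j / y_k)_(j != k) on y_k != 0. *)
Definition affine_chart (k : 'I_n) : chart R n.-1 projspace :=
  @Chart R n.-1 projspace
    [set l | hcoord l 0 k != 0]
    (fun l => col' k ((hcoord l 0 k)^-1 *: hcoord l))
    (fun z => line_of (exist _ (insert1 k z) (insert1_neq0 k z))).

Definition proj_atlas : set (chart R n.-1 projspace) := range affine_chart.

End ProjectiveSpace.

(* The submanifold x_i y_j = x_j y_i of U x P^(n-1), where U = [cdom phi]. *)
Definition blowup_local (R : realType) (n : nat) (X : topologicalType)
  (phi : chart R n X) : set (X * projspace R n)%type :=
  [set u | cdom phi u.1 /\ forall i j : 'I_n, (i < j)%N ->
    cmap phi u.1 0 i * hcoord u.2 0 j = cmap phi u.1 0 j * hcoord u.2 0 i].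

(* [Y] is the blow-up of [X] at [P]: the gluing of [blowup_local phi] and of
   [X] minus [P] along the first projection.  A gluing is given by the open
   embeddings [a] and [b] of the two pieces, whose images cover [Y] and which
   identify a point u with a point q exactly when c(u) = q (so that u lies off
   the exceptional divisor, as q <> P). *)
Definition is_blowup (R : realType) (n : nat) (X Y : topologicalType)
  (A : set (chart R n X)) (P : X) (B : set (chart R n Y)) : Prop :=
  exists phi : chart R n X,
    [/\ holo_coordinates A phi, cdom phi P & cmap phi P = 0] /\
    exists (a : blowup_local phi -> Y) (b : ~` [set P] -> Y),
      [/\ open_holo_embedding (prod_atlas A (@proj_atlas R n)) B a,
          open_holo_embedding A B b,
          range a `|` range b = setT &
          forall u q, a u = b q <-> (set_val u).1 = set_val q].

(* Derivative along the real line through x with direction v. *)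
Definition rderivable (R : realType) (n : nat) (f : 'rV[R[i]]_n -> R)
  (v x : 'rV[R[i]]_n) : Prop :=
  derivable (fun t : R => f (x + t%:C%C *: v)) 0 1.

Definition rderive (R : realType) (n : nat) (f : 'rV[R[i]]_n -> R)
  (v x : 'rV[R[i]]_n) : R :=
  derive1 (fun t : R => f (x + t%:C%C *: v)) 0.

(* f is of class C^k on the open set U of C^n = R^(2n). *)
Fixpoint Ck_on (R : realType) (n k : nat) (U : set 'rV[R[i]]_n)
  (f : 'rV[R[i]]_n -> R) : Prop :=
  if k is k'.+1 then
    forall v, (forall x, U x -> rderivable f v x) /\ Ck_on k' U (rderive f v)
  else forall x, U x -> {for x, continuous f}.

Definition smooth_on (R : realType) (n : nat) (U : set 'rV[R[i]]_n)
  (f : 'rV[R[i]]_n -> R) : Prop := forall k, Ck_on k U f.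

Definition smooth_function_on (R : realType) (n : nat) (X : topologicalType)
  (A : set (chart R n X)) (U : set X) (f : X -> R) : Prop :=
  forall phi, A phi -> smooth_on (cimg phi U) (f \o cinv phi).

(* [g phi p v w] is the value at p of a real covariant 2-tensor on the two
   tangent vectors whose coordinates in the chart phi are v and w. *)
Definition tensor2 (R : realType) (n : nat) (X : topologicalType) :=
  chart R n X -> X -> 'rV[R[i]]_n -> 'rV[R[i]]_n -> R.

(* In a holomorphic chart, J is the multiplication by 'i. *)
Record hermitian_metric_on (R : realType) (n : nat) (X : topologicalType)
  (A : set (chart R n X)) (U : set X) (g : tensor2 R n X) : Prop :=
  HermitianMetricOn {
  hm_linear : forall phi p, A phi -> cdom phi p -> U p ->
    forall (a : R) (u v w : 'rV[R[i]]_n),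
      g phi p (a%:C%C *: u + v) w = a * g phi p u w + g phi p v w;
  hm_sym : forall phi p, A phi -> cdom phi p -> U p ->
    forall v w, g phi p v w = g phi p w v;
  hm_pos : forall phi p, A phi -> cdom phi p -> U p ->
    forall v, v != 0 -> 0 < g phi p v v;
  hm_J : forall phi p, A phi -> cdom phi p -> U p ->
    forall v w, g phi p ('i%C *: v) ('i%C *: w) = g phi p v w;
  hm_tensor : forall phi psi p, A phi -> A psi ->
    cdom phi p -> cdom psi p -> U p ->
    forall v w, g phi p v w =
      g psi p ('d (transition phi psi) (cmap phi p) v)
              ('d (transition phi psi) (cmap phi p) w);
  hm_smooth : forall phi, A phi -> forall v w,
    smooth_on (cimg phi U) (fun x => g phi (cinv phi x) v w) }.

Definition kahler_form (R : realType) (n : nat) (X : topologicalType)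
  (g : tensor2 R n X) : tensor2 R n X :=
  fun phi p v w => g phi p v ('i%C *: w).

(* d omega = 0, evaluated in coordinates on constant vector fields u, v, w. *)
Definition closed_2form_on (R : realType) (n : nat) (X : topologicalType)
  (A : set (chart R n X)) (U : set X) (omega : tensor2 R n X) : Prop :=
  forall phi, A phi -> forall x, cimg phi U x -> forall u v w,
    rderive (fun y => omega phi (cinv phi y) v w) u x +
    rderive (fun y => omega phi (cinv phi y) w u) v x +
    rderive (fun y => omega phi (cinv phi y) u v) w x = 0.

Definition kahler_metric_on (R : realType) (n : nat) (X : topologicalType)
  (A : set (chart R n X)) (U : set X) (g : tensor2 R n X) : Prop :=
  hermitian_metric_on A U g /\ closed_2form_on A U (kahler_form g).

Definition conformal (R : realType) (n : nat) (X : topologicalType)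
  (f : X -> R) (g : tensor2 R n X) : tensor2 R n X :=
  fun phi p v w => expR (- f p) * g phi p v w.

Definition lck_metric (R : realType) (n : nat) (X : topologicalType)
  (A : set (chart R n X)) (g : tensor2 R n X) : Prop :=
  hermitian_metric_on A setT g /\
  exists (I : Type) (U : I -> set X) (f : I -> X -> R),
    [/\ forall i, open (U i),
        \bigcup_i U i = setT,
        forall i, smooth_function_on A (U i) (f i) &
        forall i, kahler_metric_on A (U i) (conformal (f i) g)].

Definition has_lck_metric (R : realType) (n : nat) (X : topologicalType)
  (A : set (chart R n X)) : Prop :=
  exists g : tensor2 R n X, lck_metric A g.

(* Main.v *)
(* Let pi be the blow-down map, and let g be l.c.K. with exp(-f) g Kahler near P. The pull-back of g
   is l.c.K. off the exceptional divisor E, on which it degenerates in the directions tangent to E.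
   To repair this, one adds e exp(f o pi) k, where e > 0 is small and k is a closed tensor supported
   near E that restricts to E as the Fubini-Study metric. Off E, in holomorphic coordinates x at P,
   k has the potential u(|x|^2) with u' = rho(t) / t, where rho is a cutoff function equal to 1 near
   0; the only negative contribution to k comes from rho' and is bounded by M |dx|^2, hence dominated
   by the pull-back of g. The new metric is conformal to a Kahler metric by the factor exp(- f o pi)
   near E, and it is the pull-back of g elsewhere.

   Since differentiability is complex differentiability at each point, the smoothness of holomorphic
   maps of several variables has to be established: a Goursat lemma for P dx + Q dy, applied to an
   averaged quotient of a holomorphic function, gives the Cauchy estimate for the derivative, whence
   Taylor estimates and the existence and symmetry of the second differential. *)
From HB Require Import structures.
Require Import Defs.
From mathcomp Require Import all_boot all_order all_algebra complex.
From mathcomp Require Import ring lra.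
From mathcomp Require Import all_classical all_reals all_analysis.
Set Implicit Arguments.
Unset Strict Implicit.
Unset Printing Implicit Defensive.
Import Order.TTheory GRing.Theory Num.Theory.
Import numFieldNormedType.Exports.
Local Open Scope classical_set_scope.
Local Open Scope ring_scope.
Local Notation Re := complex.Re.
Local Notation Im := complex.Im.

(** * Real coordinates and differentials *)

(** The tensor with potential u(|x|^2) involves u only through u', so the cutoff is put on u'
    itself: the tensor then vanishes identically where rho = 0 and extends by zero. For u' = 1/t the
    potential is log |x|^2, whose tensor ignores rescalings of x and directions along x. It is
    therefore the same for x as for the normalised homogeneous coordinates, and these continue it
    across E. In general the tensor is rho/t^2 times a Gram form, nonnegative by Cauchy-Schwarz,
    plus rho'/t times |<v, x>|^2, which is at most |rho'| |v|^2 in absolute value. This bound is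
    uniform up to E, so e depends on three constants only: a lower bound of g near P, an upper bound
    of exp f near P, and the supremum of |rho'|. The factor exp(f o pi) preserves closedness: after
    the conformal change the correction is a constant multiple of k. The coordinates at P need not
    belong to the atlas, while a metric is constrained in atlas charts only; hence g is always read
    in an atlas chart and carried to x by a transition map. *)

Section RealCoordinates.
Variable R : realType.
Local Notation C := R[i].

(* [n1] and [N1] are l^1 norms with values in [R]: the library norms of [R[i]] and of
   ['rV[R[i]]_n] take their values in [R[i]]. *)
Definition n1 (z : C) : R := `|Re z| + `|Im z|.

Definition rc n (c : 'I_n * bool) (z : 'rV[C]_n) : R :=
  if c.2 then Re (z 0 c.1) else Im (z 0 c.1).

Definition rb n (c : 'I_n * bool) : 'rV[C]_n :=
  (if c.2 then 1 else 'i%C) *: delta_mx 0 c.1.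

Definition N1 n (z : 'rV[C]_n) : R := \sum_c `|rc c z|.

Lemma ReD (a b : C) : Re (a + b) = Re a + Re b. Proof. by case: a b => ? ? []. Qed.
Lemma ImD (a b : C) : Im (a + b) = Im a + Im b. Proof. by case: a b => ? ? []. Qed.
Lemma ReN (a : C) : Re (- a) = - Re a. Proof. by case: a. Qed.
Lemma ImN (a : C) : Im (- a) = - Im a. Proof. by case: a. Qed.
Lemma ReM (a b : C) : Re (a * b) = Re a * Re b - Im a * Im b.
Proof. by case: a b => ? ? []. Qed.
Lemma ImM (a b : C) : Im (a * b) = Re a * Im b + Im a * Re b.
Proof. by case: a b => ? ? []. Qed.
Lemma Re_sum I (r : seq I) (P : pred I) (F : I -> C) :
  Re (\sum_(i <- r | P i) F i) = \sum_(i <- r | P i) Re (F i).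
Proof. by elim/big_ind2 : _ => // a b c d <- <-; rewrite ReD. Qed.
Lemma Im_sum I (r : seq I) (P : pred I) (F : I -> C) :
  Im (\sum_(i <- r | P i) F i) = \sum_(i <- r | P i) Im (F i).
Proof. by elim/big_ind2 : _ => // a b c d <- <-; rewrite ImD. Qed.
Definition ReImE := (ReD, ImD, ReN, ImN, ReM, ImM).

Lemma eqC (a b : C) : Re a = Re b -> Im a = Im b -> a = b.
Proof. by case: a b => ? ? [] ? ? /= -> ->. Qed.

Lemma n1_ge0 z : 0 <= n1 z. Proof. by rewrite addr_ge0. Qed.
Lemma n1D a b : n1 (a + b) <= n1 a + n1 b.
Proof.
rewrite /n1 ReD ImD addrACA; apply: lerD; exact: ler_normD.
Qed.
Lemma n1N a : n1 (- a) = n1 a. Proof. by rewrite /n1 ReN ImN !normrN. Qed.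
Lemma n1M a b : n1 (a * b) <= n1 a * n1 b.
Proof.
rewrite /n1 ReM ImM; apply: (@le_trans _ _ (`|Re a| * `|Re b| + `|Im a| * `|Im b| +
  (`|Re a| * `|Im b| + `|Im a| * `|Re b|))); last by lra.
by rewrite -!normrM lerD // (le_trans (ler_normD _ _))// normrN.
Qed.
Lemma n1_eq0 z : n1 z <= 0 -> z = 0.
Proof.
move=> h; have := normr_ge0 (Re z); have := normr_ge0 (Im z); move: h; rewrite /n1.
move=> h h1 h2; apply: eqC => /=; apply/eqP; rewrite -normr_le0; lra.
Qed.

Lemma norm_realc (a : R) : `|a%:C%C : C| = `|a|%:C%C.
Proof. by rewrite normc_def /= expr0n addr0 sqrtr_sqr. Qed.

Lemma le_norm_n1 (z : C) : `|z| <= (n1 z)%:C%C.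
Proof.
rewrite [z]complexE (le_trans (ler_normD _ _))// normrM !norm_realc.
rewrite (_ : `|'i%C| = 1) ?mul1r; last first.
  by rewrite normc_def /= expr0n expr1n add0r sqrtr1.
rewrite -(raddfD (real_complex R)) lecR /n1 /=.
by case: z => a b /=; rewrite !(mul0r, mul1r, subr0, sub0r, addr0, add0r, mulr0, oppr0).
Qed.

Lemma norm_Re (z : C) : `|Re z| <= Re `|z|.
Proof. by rewrite normc_def /= -sqrtr_sqr ler_wsqrtr// lerDl sqr_ge0. Qed.
Lemma norm_Im (z : C) : `|Im z| <= Re `|z|.
Proof. by rewrite normc_def /= -sqrtr_sqr ler_wsqrtr// lerDr sqr_ge0. Qed.

Lemma normCR (z : C) : `|z| = (Re `|z|)%:C%C.
Proof. by rewrite normc_def. Qed.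

Lemma n1_le_norm (z : C) : n1 z <= 2 * Re `|z|.
Proof. by rewrite mulrDl mul1r lerD ?norm_Re ?norm_Im. Qed.

Lemma gt0CR (e : C) : 0 < e -> e = (Re e)%:C%C /\ 0 < Re e.
Proof. by case: e => a b; rewrite ltcE /= => /andP[/eqP -> ->]. Qed.

Lemma ge0CR (e : C) : 0 <= e -> e = (Re e)%:C%C /\ 0 <= Re e.
Proof. by case: e => a b; rewrite lecE /= => /andP[/eqP -> ->]. Qed.

Section vec.
Variable n : nat.
Implicit Types (z w : 'rV[C]_n) (c : 'I_n * bool).

Lemma rcD c z w : rc c (z + w) = rc c z + rc c w.
Proof. by rewrite /rc !mxE; case: c.2; rewrite ?ReD ?ImD. Qed.
Lemma rcN c z : rc c (- z) = - rc c z.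
Proof. by rewrite /rc !mxE; case: c.2; rewrite ?ReN ?ImN. Qed.
Lemma rcZ c (a : R) z : rc c (a%:C%C *: z) = a * rc c z.
Proof. by rewrite /rc !mxE; case: c.2; rewrite ?ReM ?ImM /= mul0r ?subr0 ?addr0. Qed.
Lemma rc0 c : rc c 0 = 0. Proof. by rewrite /rc !mxE; case: c.2. Qed.
Lemma rcB c z w : rc c (z - w) = rc c z - rc c w.
Proof. by rewrite rcD rcN. Qed.
Lemma rc_sum I (r : seq I) (P : pred I) (F : I -> 'rV[C]_n) c :
  rc c (\sum_(i <- r | P i) F i) = \sum_(i <- r | P i) rc c (F i).
Proof. by elim/big_ind2 : _ => // [|a b d e <- <-]; rewrite ?rc0 ?rcD. Qed.

Lemma rc_rb c c' : rc c (rb c') = (c == c')%:R.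
Proof.
case: c c' => i b [j b']; rewrite /rc /rb !mxE xpair_eqE /=.
by case: eqP => _; case: b; case: b' => /=; ring.
Qed.

Lemma rc_inj z w : (forall c, rc c z = rc c w) -> z = w.
Proof.
move=> h; apply/rowP => j; apply: eqC; first exact: (h (j, true)).
exact: (h (j, false)).
Qed.

Lemma rcE z : z = \sum_c (rc c z)%:C%C *: rb c.
Proof.
apply: rc_inj => c; rewrite rc_sum (bigD1 c)//= rcZ rc_rb eqxx mulr1 big1 ?addr0//.
by move=> d dc; rewrite rcZ rc_rb eq_sym (negbTE dc) mulr0.
Qed.

Lemma N1_ge0 z : 0 <= N1 z. Proof. exact: sumr_ge0. Qed.
Lemma N1D z w : N1 (z + w) <= N1 z + N1 w.
Proof.
by rewrite /N1 -big_split ler_sum// => c _; rewrite rcD ler_normD.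
Qed.
Lemma N1N z : N1 (- z) = N1 z.
Proof. by apply: eq_bigr => c _; rewrite rcN normrN. Qed.
Lemma N1B z w : N1 (z - w) <= N1 z + N1 w.
Proof. by rewrite -(N1N w) N1D. Qed.
Lemma N10 : N1 (0 : 'rV[C]_n) = 0.
Proof. by rewrite /N1 big1// => c _; rewrite rc0 normr0. Qed.
Lemma N1BC z w : N1 (z - w) = N1 (w - z).
Proof. by rewrite -N1N opprB. Qed.
Lemma N1Z (a : R) z : N1 (a%:C%C *: z) = `|a| * N1 z.
Proof. by rewrite /N1 mulr_sumr; apply: eq_bigr => c _; rewrite rcZ normrM. Qed.
Lemma rc_le_N1 c z : `|rc c z| <= N1 z.
Proof. by rewrite /N1 (bigD1 c)//= lerDl sumr_ge0. Qed.
Lemma N1_eq0 z : N1 z <= 0 -> z = 0.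
Proof.
move=> h; apply: rc_inj => c; rewrite rc0; apply/eqP; rewrite -normr_le0.
exact: le_trans (rc_le_N1 c z) h.
Qed.
Lemma N1_gt0 z : z != 0 -> 0 < N1 z.
Proof.
by move=> h; rewrite lt_neqAle N1_ge0 andbT eq_sym; apply: contra h => /eqP h; rewrite (@N1_eq0 z)// h.
Qed.

Lemma N1E z : N1 z = \sum_j n1 (z 0 j).
Proof.
rewrite /N1 -(pair_big xpredT xpredT (fun j b => `|rc (j, b) z|)) /=.
by apply: eq_bigr => j _; rewrite big_bool /n1 /rc.
Qed.

Lemma n1_le_N1 z j : n1 (z 0 j) <= N1 z.
Proof.
by rewrite N1E (bigD1 j)//= lerDl sumr_ge0// => k _; exact: n1_ge0.
Qed.

Lemma N1_mulC (a : C) z : N1 (a *: z) <= n1 a * N1 z.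
Proof.
by rewrite !N1E mulr_sumr ler_sum// => j _; rewrite mxE n1M.
Qed.

Lemma norm_le_N1 z : `|z| <= (N1 z)%:C%C.
Proof.
have [->|z0] := eqVneq z 0; first by rewrite normr0 lecR N1_ge0.
have /mx_norm_neq0[[k j] /= h] : mx_norm z != 0 by rewrite -[mx_norm z]/(`|z|) normr_eq0.
rewrite -[leLHS]/(mx_norm z) h.
by rewrite ord1 (le_trans (le_norm_n1 _))// lecR n1_le_N1.
Qed.

Lemma N1_le_norm z : N1 z <= (2 * n%:R) * Re `|z|.
Proof.
rewrite N1E; apply: (@le_trans _ _ (\sum_(j < n) (2 * Re `|z|))); last first.
  by rewrite sumr_const card_ord -[leLHS]mulr_natr mulrAC.
apply: ler_sum => /= j _; rewrite (le_trans (n1_le_norm _))// ler_pM2l//.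
have : `|z 0 j| <= `|z|.
  exact: (@le_bigmax _ _ _ _ (fun ij : 'I_1 * 'I_n => `|z ij.1 ij.2|%:nng) (0, j)).
by rewrite lecE => /andP[].
Qed.

(** The sup norm and [N1] bound each other; from here on the topology of C^n is handled with real
    radii. *)
Lemma nbhs_N1 z (A : set 'rV[C]_n) :
  nbhs z A <-> exists2 d : R, 0 < d & forall w, N1 (w - z) < d -> A w.
Proof.
split.
  move=> /nbhs_ballP[e /= e0 h]; have [eE e0'] := gt0CR e0.
  exists (Re e) => // w hw; apply: h; rewrite -ball_normE /= distrC.
  by rewrite (le_lt_trans (norm_le_N1 _))// eE ltcR.
move=> [d d0 h]; apply/nbhs_ballP.
(* The summand 1 keeps the divisor positive for [n = 0]; the same device recurs with [N1 v + 1],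
   [M + 1] and the like. *)
have K0 : 0 < 2 * n%:R + 1 :> R by rewrite ltr_wpDl// mulr_ge0.
exists ((d / (2 * n%:R + 1))%:C%C) => /=; first by rewrite ltcR divr_gt0.
move=> w; rewrite -ball_normE /= distrC => hw; apply: h.
rewrite (le_lt_trans (N1_le_norm _))//.
have : Re `|w - z| < d / (2 * n%:R + 1) by move: hw; rewrite ltcE => /andP[_ ->].
rewrite ltr_pdivlMr// => hw2; apply: le_lt_trans hw2.
by rewrite mulrC ler_wpM2l//; [case: (ge0CR (normr_ge0 (w - z))) | rewrite lerDl].
Qed.

End vec.

Lemma nbhs_n1 (z : C) (A : set C) :
  nbhs z A <-> exists2 d : R, 0 < d & forall w, n1 (w - z) < d -> A w.
Proof.
split.
  move=> /nbhs_ballP[e /= e0 h]; have [eE e0'] := gt0CR e0.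
  exists (Re e) => // w hw; apply: h; rewrite -ball_normE /= distrC.
  by rewrite (le_lt_trans (le_norm_n1 _))// eE ltcR.
move=> [d d0 h]; apply/nbhs_ballP; exists ((d / 2)%:C%C) => /=; first by rewrite ltcR divr_gt0.
move=> w; rewrite -ball_normE /= distrC => hw; apply: h.
rewrite (le_lt_trans (n1_le_norm _))// mulrC -ltr_pdivlMr//.
by rewrite normCR ltcR in hw.
Qed.

End RealCoordinates.

(** * Differentials in epsilon-delta form *)

Section DifferentialEps.
Variable R : realType.
Local Notation C := R[i].

(** A predicate on bare functions: the second differential is first constructed as a function, a
    limit of quotients, and proved linear afterwards. *)
Definition clin n m (L : 'rV[C]_n -> 'rV[C]_m) :=
  forall (a : C) u v, L (a *: u + v) = a *: L u + L v.

Lemma clin_d n m (f : 'rV[C]_n -> 'rV[C]_m) (x : 'rV[C]_n) : clin ('d f x).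
Proof. by move=> a u v; rewrite linearP. Qed.

Section clin.
Variables (n m : nat) (L : 'rV[C]_n -> 'rV[C]_m).
Hypothesis HL : clin L.

Lemma clin0 : L 0 = 0.
Proof.
by have := HL (-1) 0 0; rewrite scaler0 addr0 scaleN1r addNr.
Qed.
Lemma clinZ a u : L (a *: u) = a *: L u.
Proof. by have := HL a u 0; rewrite !addr0 clin0 addr0. Qed.
Lemma clinD u v : L (u + v) = L u + L v.
Proof. by have := HL 1 u v; rewrite !scale1r. Qed.
Lemma clinN u : L (- u) = - L u.
Proof. by rewrite -scaleN1r clinZ scaleN1r. Qed.
Lemma clinB u v : L (u - v) = L u - L v.
Proof. by rewrite clinD clinN. Qed.
Lemma clin_sum I (r : seq I) (P : pred I) F :
  L (\sum_(i <- r | P i) F i) = \sum_(i <- r | P i) L (F i).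
Proof. by elim/big_rec2 : _ => [|i u v _ <-]; rewrite ?clin0 ?clinD. Qed.

Lemma clin_bound : exists2 K, 0 < K & forall h, N1 (L h) <= K * N1 h.
Proof.
exists (\sum_c N1 (L (rb R c)) + 1); first by rewrite ltr_wpDl// sumr_ge0// => c _; exact: N1_ge0.
move=> h; apply: (@le_trans _ _ ((\sum_c N1 (L (rb R c))) * N1 h)); last first.
  by rewrite ler_wpM2r ?N1_ge0// lerDl.
rewrite {1}[h]rcE clin_sum.
apply: (@le_trans _ _ (\sum_c N1 (L ((rc c h)%:C%C *: rb R c)))).
  by elim/big_rec2 : _ => [|c u v _ le]; rewrite ?N10// (le_trans (N1D _ _))// lerD2l.
rewrite mulr_suml ler_sum// => c _.
by rewrite clinZ N1Z mulrC ler_wpM2l ?N1_ge0// rc_le_N1.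
Qed.
End clin.

Lemma nearN1 n (P : 'rV[C]_n -> Prop) (x : 'rV[C]_n) :
  (\forall y \near x, P y) <-> exists2 d : R, 0 < d & forall w, N1 (w - x) < d -> P w.
Proof. exact: nbhs_N1. Qed.

Lemma diff_eps n m (f : 'rV[C]_n -> 'rV[C]_m) (x : 'rV[C]_n) : differentiable f x ->
  forall e : R, 0 < e -> exists2 d : R, 0 < d & forall h, N1 h < d ->
    N1 (f (x + h) - f x - 'd f x h) <= e * N1 h.
Proof.
move=> df e e0; have K0 : 0 < 2 * m%:R + 1 :> R by rewrite ltr_wpDl// mulr_ge0.
have /diff_locally/eqaddoP := df.
move=> /(_ ((e / (2 * m%:R + 1))%:C%C)); rewrite ltcR divr_gt0// => /(_ isT).
move=> /nearN1[d d0 H]; exists d => // h hd.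
have {H} := H h; rewrite subr0 => /(_ hd) /=.
rewrite !fctE /= [h + x]addrC opprD addrA.
set v := (X in `|X|) => H.
rewrite (le_trans (N1_le_norm _))//.
have : Re `|v| <= e / (2 * m%:R + 1) * N1 h.
  have : `|v| <= (e / (2 * m%:R + 1) * N1 h)%:C%C.
    apply: le_trans H _; rewrite [leRHS]rmorphM ler_wpM2l ?norm_le_N1//.
    by rewrite lecR divr_ge0// ltW.
  by rewrite lecE => /andP[_].
have v0 : 0 <= Re `|v| by case: (ge0CR (normr_ge0 v)).
rewrite mulrAC ler_pdivlMr// => H2; apply: le_trans H2.
by rewrite mulrC ler_wpM2l// lerDl.
Qed.

Lemma diff_littleo (K : numFieldType) (V W : normedModType K) (f : V -> W)
    (df : {linear V -> W}) (x : V) : continuous df ->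
  (forall e : K, 0 < e -> \forall h \near (0 : V), `|f (h + x) - f x - df h| <= e * `|h|) ->
  differentiable f x /\ 'd f x = df :> (_ -> _).
Proof.
move=> cdf H.
have eqf : f \o shift x = cst (f x) + df +o_ (0 : V) id.
  apply/eqaddoP => e /= /H; apply: filterS => h.
  by rewrite !fctE /= opprD addrA.
have dE := diff_unique cdf eqf.
by split => //; apply/diff_locallyP; rewrite dE; split.
Qed.

Lemma diff_epsI n m (f L : 'rV[C]_n -> 'rV[C]_m) (x : 'rV[C]_n) : clin L ->
  (forall e : R, 0 < e -> exists2 d : R, 0 < d & forall h, N1 h < d ->
    N1 (f (x + h) - f x - L h) <= e * N1 h) ->
  differentiable f x /\ 'd f x = L :> (_ -> _).
Proof.
move=> HL H.
(* The value of ['d f x] is obtained from the uniqueness of the differential, which asks for a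
   bundled linear map and its continuity. *)
pose Lm := GRing.isLinear.Build _ _ _ _ L HL.
pose Ll : {linear _ -> _} := HB.pack L Lm.
have cL : continuous Ll.
  have [K K0 HK] := clin_bound HL.
  move=> y A /nbhs_N1[d d0 hA]; apply/nbhs_N1; exists (d / K); first by rewrite divr_gt0.
  move=> w hw; apply: hA; change (N1 (L w - L y) < d); rewrite -clinB// (le_lt_trans (HK _))//.
  by rewrite mulrC -ltr_pdivlMr.
apply: (diff_littleo cL) => e /gt0CR[eE e0]; rewrite eE.
have K0 : 0 < 2 * n%:R + 1 :> R by rewrite ltr_wpDl// mulr_ge0.
have [d d0 Hd] := H _ (divr_gt0 e0 K0).
apply/nearN1; exists d => // h; rewrite subr0 => /Hd.
change (Ll h) with (L h).
rewrite [h + x]addrC; set v := (X in N1 X) => Hv.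
rewrite (le_trans (norm_le_N1 v))//.
apply: (@le_trans _ _ (Re e * Re `|h|)%:C%C); last first.
  by rewrite rmorphM /= -(ge0CR (normr_ge0 h)).1.
rewrite lecR (le_trans Hv)// -mulrA ler_wpM2l ?(ltW e0)// ler_pdivrMl//.
rewrite (le_trans (N1_le_norm h))// ler_wpM2r//; first by case: (ge0CR (normr_ge0 h)).
by rewrite lerDl.
Qed.

Lemma diff_near_eq n m (f g : 'rV[C]_n -> 'rV[C]_m) (x : 'rV[C]_n) :
  (\forall y \near x, f y = g y) -> differentiable f x ->
  differentiable g x /\ 'd g x = 'd f x :> (_ -> _).
Proof.
move=> /nearN1[d d0 fg] df; apply: diff_epsI; first exact: clin_d.
move=> e e0; have [d' d'0 H] := diff_eps df e0.
exists (Num.min d d'); first by rewrite lt_min d0.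
move=> h; rewrite lt_min => /andP[h1 h2].
have := H _ h2; rewrite fg; last by rewrite [x + h]addrC addrK.
by rewrite fg ?subrr ?N10.
Qed.

Lemma is_derive_cvg (K : numFieldType) (V W : normedModType K) (f : V -> W) x v d :
  (fun h => h^-1 *: (f (h *: v + x) - f x)) @ 0^' --> d -> is_derive x v f d.
Proof.
move=> H; apply: DeriveDef; first by apply/cvg_ex; exists d.
exact: cvg_lim.
Qed.

Lemma is_deriveC_I (g : C -> C) z d :
  (forall e : R, 0 < e -> exists2 r : R, 0 < r & forall h, n1 h < r ->
     n1 (g (z + h) - g z - d * h) <= e * n1 h) -> is_derive z 1 g d.
Proof.
move=> H; apply: is_derive_cvg => A /nbhs_n1[e e0 hA].
(* The comparisons of [n1] with the modulus, for [h] and for its inverse, cost a factor 2 each;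
   another factor 2 makes the inequality strict. *)
have [r r0 Hr] := H (e / 8) (divr_gt0 e0 (ltr0Sn _ _)).
apply/nbhs_n1; exists r => // h; rewrite subr0 => hr h0; apply: hA.
rewrite [_%:A]mulr1.
have -> : h^-1 *: (g (h + z) - g z) - d = h^-1 * (g (z + h) - g z - d * h).
  by rewrite /GRing.scale /= [h + z]addrC [RHS]mulrBr; congr (_ - _); rewrite mulrCA mulVf// mulr1.
rewrite (le_lt_trans (n1M _ _))//.
have h1 : 0 < Re `|h|.
  by have [] := gt0CR (_ : 0 < `|h|); rewrite ?normr_gt0.
have h2 : n1 h^-1 <= 2 / Re `|h|.
  by rewrite (le_trans (n1_le_norm _))// normfV {1}normCR -fmorphV.
apply: (@le_lt_trans _ _ (2 / Re `|h| * (e / 8 * (2 * Re `|h|)))).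
  apply: ler_pM; rewrite ?n1_ge0// (le_trans (Hr _ hr))// ler_wpM2l ?n1_le_norm//.
  by rewrite divr_ge0// ltW.
have -> : 2 / Re `|h| * (e / 8 * (2 * Re `|h|)) = e / 2 by field; rewrite gt_eqF.
by rewrite ltr_pdivrMr// ltr_pMr// ltr1n.
Qed.

Lemma is_deriveC_E (g : C -> C) (z d : C) : is_derive z 1 g d ->
  forall e : R, 0 < e -> exists2 r : R, 0 < r & forall h, n1 h < r ->
     n1 (g (z + h) - g z - d * h) <= e * n1 h.
Proof.
move=> [dg dE] e e0; have : (fun h => h^-1 *: (g (h *: 1 + z) - g z)) @ 0^' --> d.
  by rewrite -dE.
move=> /(_ [set w | n1 (w - d) < e]); case.
  by apply/nbhs_n1; exists e.
move=> r /= r0 Hr; have [rE r0'] := gt0CR r0; exists (Re r) => // h hr.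
have [->|h0] := eqVneq h 0.
  by rewrite addr0 subrr mulr0 subrr /n1 !normr0 addr0 mulr0.
have /Hr /(_ h0) /= : ball_ Num.norm 0 r h.
  by rewrite /= sub0r normrN (le_lt_trans (le_norm_n1 _))// rE ltcR.
rewrite [_%:A]mulr1 => H.
have -> : g (z + h) - g z - d * h = h * (h^-1 *: (g (h + z) - g z) - d).
  by rewrite /GRing.scale /= [z + h]addrC mulrBr mulrA mulfV// mul1r [h * d]mulrC.
by rewrite (le_trans (n1M _ _))// mulrC ler_wpM2r ?n1_ge0// ltW.
Qed.

Lemma is_deriveR_I (g : R -> R) (t d : R) :
  (forall e : R, 0 < e -> exists2 r : R, 0 < r & forall h, `|h| < r ->
     `|g (t + h) - g t - d * h| <= e * `|h|) -> is_derive t 1 g d.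
Proof.
move=> H; apply: is_derive_cvg; apply/cvgrPdist_le => e e0.
have [r r0 Hr] := H e e0; exists r => //= h; rewrite /= sub0r normrN => hr h0.
rewrite [_%:A]mulr1 distrC.
have -> : h^-1 *: (g (h + t) - g t) - d = h^-1 * (g (t + h) - g t - d * h).
  by rewrite /GRing.scale /= [h + t]addrC [RHS]mulrBr; congr (_ - _); rewrite mulrCA mulVf// mulr1.
by rewrite normrM normfV ler_pdivrMl ?normr_gt0// [leRHS]mulrC Hr.
Qed.

Lemma is_deriveR_E (g : R -> R) (t d : R) : is_derive t 1 g d ->
  forall e : R, 0 < e -> exists2 r : R, 0 < r & forall h, `|h| < r ->
     `|g (t + h) - g t - d * h| <= e * `|h|.
Proof.
move=> [dg dE] e e0; have : (fun h => h^-1 *: (g (h *: 1 + t) - g t)) @ 0^' --> d.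
  by rewrite -dE.
move=> /cvgrPdist_le /(_ e e0) [r /= r0 Hr]; exists r => // h hr.
have [->|h0] := eqVneq h 0.
  by rewrite addr0 subrr mulr0 subrr !normr0 mulr0.
have /Hr /(_ h0) /= : ball_ Num.norm 0 r h by rewrite /= sub0r normrN.
rewrite [_%:A]mulr1 distrC => H.
have -> : g (t + h) - g t - d * h = h * (h^-1 *: (g (h + t) - g t) - d).
  by rewrite /GRing.scale /= [t + h]addrC mulrBr mulrA mulfV// mul1r [h * d]mulrC.
by rewrite normrM mulrC ler_wpM2r.
Qed.

(** Restriction to a complex line, for the one-variable Cauchy estimate; [is_derive_line] is the
    restriction to a real line, for the mean value theorem. *)
Lemma is_derive_slice n m (f : 'rV[C]_n -> 'rV[C]_m) (x v : 'rV[C]_n) (z : C) j :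
  differentiable f (x + z *: v) ->
  is_derive z 1 (fun z => f (x + z *: v) 0 j) ('d f (x + z *: v) v 0 j).
Proof.
move=> df; apply: is_deriveC_I => e e0.
have v0 : 0 < N1 v + 1 by rewrite ltr_wpDl ?N1_ge0.
have [r r0 Hr] := diff_eps df (divr_gt0 e0 v0).
exists (r / (N1 v + 1)); first exact: divr_gt0.
move=> h; rewrite ltr_pdivlMr// => hr.
have hv : N1 (h *: v) <= n1 h * (N1 v + 1).
  by rewrite (le_trans (N1_mulC _ _))// ler_wpM2l ?n1_ge0// lerDl.
have := Hr _ (le_lt_trans hv hr); rewrite -(addrA x) -scalerDl.
set w := (X in N1 X) => Hw.
apply: (@le_trans _ _ (N1 w)); last first.
  rewrite (le_trans Hw)// (@le_trans _ _ (e / (N1 v + 1) * (n1 h * (N1 v + 1))))//.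
    by rewrite ler_wpM2l// divr_ge0// ltW.
  by rewrite [n1 h * _]mulrC mulrA divfK// gt_eqF.
apply: le_trans (n1_le_N1 w j).
rewrite /w !mxE (clinZ (clin_d _ _)) mxE [h * _]mulrC; exact: lexx.
Qed.

Lemma is_derive_line n m (f : 'rV[C]_n -> 'rV[C]_m) (x v : 'rV[C]_n) (t : R) c :
  differentiable f (x + t%:C%C *: v) ->
  is_derive t 1 (fun t : R => rc c (f (x + t%:C%C *: v))) (rc c ('d f (x + t%:C%C *: v) v)).
Proof.
move=> df; apply: is_deriveR_I => e e0.
have v0 : 0 < N1 v + 1 by rewrite ltr_wpDl ?N1_ge0.
have [r r0 Hr] := diff_eps df (divr_gt0 e0 v0).
exists (r / (N1 v + 1)); first exact: divr_gt0.
move=> h; rewrite ltr_pdivlMr// => hr.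
have hv : N1 (h%:C%C *: v) <= `|h| * (N1 v + 1).
  by rewrite N1Z ler_wpM2l// lerDl.
have := Hr _ (le_lt_trans hv hr); rewrite -(addrA x) -scalerDl -rmorphD.
set w := (X in N1 X) => Hw.
apply: (@le_trans _ _ (N1 w)); last first.
  rewrite (le_trans Hw)// (@le_trans _ _ (e / (N1 v + 1) * (`|h| * (N1 v + 1))))//.
    by rewrite ler_wpM2l// divr_ge0// ltW.
  by rewrite [`|h| * _]mulrC mulrA divfK// gt_eqF.
apply: le_trans (rc_le_N1 c w).
rewrite /w !rcB (clinZ (clin_d _ _)).
rewrite rcZ [h * _]mulrC; exact: lexx.
Qed.

End DifferentialEps.

(** * Holomorphic maps have holomorphic derivatives *)

Section Goursat.
Variable R : realType.

Lemma is_derive_eq1 (f : R -> R) (x d d' : R) : is_derive x 1 f d -> d = d' -> is_derive x 1 f d'.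
Proof. by move=> h <-. Qed.

Lemma is_derive_cont (f : R -> R) (x d : R) : is_derive x 1 f d -> {for x, continuous f}.
Proof. by move=> [h _]; apply/differentiable_continuous/derivable1_diffP. Qed.

Lemma mvt (f df : R -> R) (a b : R) : a <= b ->
  (forall x, a <= x <= b -> is_derive x 1 f (df x)) ->
  exists2 c, a <= c <= b & f b - f a = df c * (b - a).
Proof.
move=> ab H; have [||c] := @MVT_segment R f df a b ab.
- by move=> x /[!in_itv]/= /andP[ax xb]; apply: H; rewrite !ltW.
- apply: continuous_in_subspaceT => x; rewrite inE /= in_itv /= => hx.
  exact: is_derive_cont (H _ hx).
by rewrite in_itv /= => cab e; exists c.
Qed.

Lemma mvt_le (f df : R -> R) (a b M : R) : a <= b ->
  (forall x, a <= x <= b -> is_derive x 1 f (df x)) ->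
  (forall x, a <= x <= b -> `|df x| <= M) -> `|f b - f a| <= M * (b - a).
Proof.
move=> ab H HM; have [c cab ->] := mvt ab H.
by rewrite normrM [X in _ * X]ger0_norm ?subr_ge0// ler_wpM2r ?subr_ge0// HM.
Qed.

Lemma eq_prim (f g df : R -> R) (a b : R) : a <= b ->
  (forall x, a <= x <= b -> is_derive x 1 f (df x)) ->
  (forall x, a <= x <= b -> is_derive x 1 g (df x)) -> f b - f a = g b - g a.
Proof.
move=> ab Hf Hg.
have [|c _] := @mvt (fun x => f x - g x) (fun x => 0) a b ab.
  by move=> x hx; apply: is_derive_eq1 (is_deriveB (Hf _ hx) (Hg _ hx)) _; rewrite subrr.
by rewrite mul0r; lra.
Qed.

Definition cont1 (h : R -> R) (x : R) := forall e : R, 0 < e ->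
  exists2 d : R, 0 < d & forall x', `|x' - x| < d -> `|h x' - h x| <= e.

Lemma prim_exists (h : R -> R) (a b : R) : a <= b ->
  (forall x, a <= x <= b -> cont1 h x) ->
  exists H : R -> R, forall x, a <= x <= b -> is_derive x 1 H (h x).
Proof.
move=> ab ch.
(* The retraction onto [a, b] extends [h] continuously to the whole line, so the integral can start
   at [a - 1] and the endpoints become interior points with two-sided derivatives. *)
pose cl x := Num.max a (Num.min b x).
have clab x : a <= cl x <= b.
  by rewrite /cl le_max lexx /= ge_max ab ge_min lexx.
have cl_id x : a <= x <= b -> cl x = x.
  by move=> /andP[h1 h2]; rewrite /cl min_r// max_r.
have cl_lip x y : `|cl x - cl y| <= `|x - y|.
  have ba : b - a >= 0 by rewrite subr_ge0.
  rewrite /cl /Num.max /Num.min; do ! case: ifPn; rewrite -?leNgt => *;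
  rewrite ler_norml; apply/andP; split; have := ler_norm (x - y); have := ler_norm (y - x);
  rewrite (distrC y); lra.
have hc x : {for x, continuous (h \o cl)}.
  apply/cvgrPdist_le => e e0; have [d d0 Hd] := ch _ (clab x) e e0.
  exists d => //= y /= hy; rewrite distrC; apply: Hd.
  by rewrite (le_lt_trans (cl_lip _ _))// distrC.
exists (fun x => \int[lebesgue_measure]_(t in [set` `[a - 1, x]]) ((h \o cl) t))%R.
move=> x hx; have [ax xb] := andP hx.
have fi : lebesgue_measure.-integrable `[a - 1, b + 1] (EFin \o (h \o cl)).
  apply: continuous_compact_integrable; first exact: segment_compact.
  by apply: continuous_subspaceT => y; exact: hc.
have xb1 : x < b + 1 by lra.
have ax1 : a - 1 < x by lra.
have [H1 H2] := continuous_FTC1_closed xb1 fi ax1 (hc x).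
apply: DeriveDef => //; rewrite -derive1E H2 /=.
by rewrite cl_id.
Qed.

Variables P Q : R -> R -> R.

(** [P] and [Q] are differentiable at the point, and the same [q] serves as the y-derivative of [P]
    and the x-derivative of [Q]: the form [P dx + Q dy] is closed at this point, without continuity
    of its derivatives. *)
Definition lin2 x y := exists p q s : R, forall e : R, 0 < e ->
  exists2 d : R, 0 < d & forall x' y', `|x' - x| < d -> `|y' - y| < d ->
   `|P x' y' - P x y - p * (x' - x) - q * (y' - y)| <= e * (`|x' - x| + `|y' - y|) /\
   `|Q x' y' - Q x y - q * (x' - x) - s * (y' - y)| <= e * (`|x' - x| + `|y' - y|).

(** Integrals along the sides appear as differences of primitives. Opposite sides are paired before
    the mean value theorem is applied, and the first-order terms [q * (c - c') * (b - a)] and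
    [q * (b - a) * (c' - c)] cancel; only the error terms of [lin2] remain. *)
Lemma lin2_local x y : lin2 x y -> forall e : R, 0 < e -> exists2 d : R, 0 < d &
  forall a b c c' (H H' G G' : R -> R), a <= x <= b -> c <= y <= c' ->
   b - a < d -> c' - c < d ->
   (forall t, a <= t <= b -> is_derive t 1 H (P t c)) ->
   (forall t, a <= t <= b -> is_derive t 1 H' (P t c')) ->
   (forall t, c <= t <= c' -> is_derive t 1 G (Q a t)) ->
   (forall t, c <= t <= c' -> is_derive t 1 G' (Q b t)) ->
   `|(H b - H a) - (H' b - H' a) + (G' c' - G' c) - (G c' - G c)| <=
     e * ((b - a) + (c' - c)) ^+ 2.
Proof.
move=> [p [q [s Hpq]]] e e0; have [d d0 Hd] := Hpq (e / 2) (divr_gt0 e0 (ltr0Sn _ _)).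
exists d => // a b c c' H H' G G' /andP[ax xb] /andP[cy yc] hab hcc dH dH' dG dG'.
have ab : a <= b by exact: le_trans xb.
have cc : c <= c' by exact: le_trans yc.
have near_x t : a <= t <= b -> `|t - x| <= b - a.
  by move=> /andP[? ?]; rewrite ler_norml; apply/andP; split; lra.
have near_y t : c <= t <= c' -> `|t - y| <= c' - c.
  by move=> /andP[? ?]; rewrite ler_norml; apply/andP; split; lra.
have aI : a <= a <= b by rewrite lexx.
have bI : a <= b <= b by rewrite lexx ab.
have cI : c <= c <= c' by rewrite lexx.
have cI' : c <= c' <= c' by rewrite lexx cc.
set S := (b - a) + (c' - c).
have Hpt t u : a <= t <= b -> c <= u <= c' ->
   `|P t u - P x y - p * (t - x) - q * (u - y)| <= e / 2 * S /\
   `|Q t u - Q x y - q * (t - x) - s * (u - y)| <= e / 2 * S.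
  move=> ht hu; have [h1 h2] := Hd t u (le_lt_trans (near_x _ ht) hab) (le_lt_trans (near_y _ hu) hcc).
  by split; [apply: le_trans h1 _|apply: le_trans h2 _]; rewrite ler_wpM2l ?divr_ge0 ?(ltW e0)// lerD ?near_x ?near_y.
have [t /Hpt ht Et] := mvt ab (fun t ht => is_deriveB (dH t ht) (dH' t ht)).
have [u hu0 Eu] := mvt cc (fun t ht => is_deriveB (dG' t ht) (dG t ht)).
have hu t' ht' := Hpt t' u ht' hu0.
have [[h1 _] [h2 _]] := (ht c cI, ht c' cI').
have [[_ h3] [_ h4]] := (hu a aI, hu b bI).
rewrite /= in Et Eu.
have -> : H b - H a - (H' b - H' a) + (G' c' - G' c) - (G c' - G c) =
  (P t c - P t c' - q * (c - c')) * (b - a) + (Q b u - Q a u - q * (b - a)) * (c' - c).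
  by move: Et Eu; rewrite !fctE; lra.
have k1 : `|P t c - P t c' - q * (c - c')| <= e * S.
  by clear -h1 h2; move: h1 h2; rewrite !ler_norml => /andP[? ?] /andP[? ?]; apply/andP; split; lra.
have k2 : `|Q b u - Q a u - q * (b - a)| <= e * S.
  by clear -h3 h4; move: h3 h4; rewrite !ler_norml => /andP[? ?] /andP[? ?]; apply/andP; split; lra.
rewrite (le_trans (ler_normD _ _))// !normrM [`|b - a|]ger0_norm ?subr_ge0// [`|c' - c|]ger0_norm ?subr_ge0//.
rewrite expr2 mulrA [leRHS]mulrDr lerD// ler_wpM2r ?subr_ge0//.
Qed.

Lemma ler_norm4 (a b c d : R) : `|a + b + c + d| <= `|a| + `|b| + `|c| + `|d|.
Proof. by do 2 (rewrite (le_trans (ler_normD _ _))// lerD2r); exact: ler_normD. Qed.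

Lemma exp2_small (S d : R) : 0 < d -> exists k, S / 2 ^+ k < d.
Proof.
move=> d0; pose k := Num.bound (`|S| / d); exists k.
rewrite ltr_pdivrMr ?exprn_gt0//.
have h : `|S| / d < k%:R by rewrite archi_boundP ?divr_ge0// ltW.
rewrite (le_lt_trans (ler_norm S))// mulrC -ltr_pdivrMr// (lt_le_trans h)//.
by rewrite -natrX ler_nat ltnW// ltn_expl.
Qed.

Section rectangle.
Variables (a0 b0 c0 d0 : R) (H G : R -> R -> R).
Hypotheses (ab0 : a0 <= b0) (cd0 : c0 <= d0).
Hypothesis PQ : forall x y, a0 <= x <= b0 -> c0 <= y <= d0 -> lin2 x y.
Hypothesis dH : forall x y, a0 <= x <= b0 -> c0 <= y <= d0 -> is_derive x 1 (H y) (P x y).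
Hypothesis dG : forall x y, a0 <= x <= b0 -> c0 <= y <= d0 -> is_derive y 1 (G x) (Q x y).

(* The integral of [P dx + Q dy] along the boundary of a rectangle. *)
Let circ a b c d := (H c b - H c a) - (H d b - H d a) + (G b d - G b c) - (G a d - G a c).

Let w k : R := (b0 - a0) / 2 ^+ k.
Let h k : R := (d0 - c0) / 2 ^+ k.

Let eta : R := `|circ a0 b0 c0 d0|.

Let good k (p : R * R) := [/\ a0 <= p.1, p.1 + w k <= b0, c0 <= p.2, p.2 + h k <= d0 &
  eta / 4 ^+ k <= `|circ p.1 (p.1 + w k) p.2 (p.2 + h k)|].

Let wS k : w k = w k.+1 + w k.+1.
Proof. by rewrite /w exprS; field; rewrite expf_neq0. Qed.
Let hS k : h k = h k.+1 + h k.+1.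
Proof. by rewrite /h exprS; field; rewrite expf_neq0. Qed.
Let w_ge0 k : 0 <= w k. Proof. by rewrite divr_ge0 ?subr_ge0 ?exprn_ge0. Qed.
Let h_ge0 k : 0 <= h k. Proof. by rewrite divr_ge0 ?subr_ge0 ?exprn_ge0. Qed.

(** The circulation is additive over the four quarters, so one of them carries at least a fourth of
    it. *)
Let step k p : good k p -> exists p', good k.+1 p' /\
  (p.1 <= p'.1 /\ p'.1 + w k.+1 <= p.1 + w k) /\ (p.2 <= p'.2 /\ p'.2 + h k.+1 <= p.2 + h k).
Proof.
case: p => a c [/= h1 h2 h3 h4 h5].
have W := w_ge0 k.+1; have Hh := h_ge0 k.+1; have ew := wS k; have eh := hS k.
have e4 : eta / 4 ^+ k = 4 * (eta / 4 ^+ k.+1).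
  by rewrite [in RHS]exprS; field; rewrite expf_neq0.
clear PQ dH dG.
have [k1|k1] := leP (eta / 4 ^+ k.+1) `|circ a (a + w k.+1) c (c + h k.+1)|.
  by exists (a, c); split; [split|split] => //=; lra.
have [k2|k2] := leP (eta / 4 ^+ k.+1) `|circ (a + w k.+1) (a + w k.+1 + w k.+1) c (c + h k.+1)|.
  by exists (a + w k.+1, c); split; [split|split] => //=; lra.
have [k3|k3] := leP (eta / 4 ^+ k.+1) `|circ a (a + w k.+1) (c + h k.+1) (c + h k.+1 + h k.+1)|.
  by exists (a, c + h k.+1); split; [split|split] => //=; lra.
exists (a + w k.+1, c + h k.+1); split; [split|split] => //=; try lra.
rewrite leNgt; apply/negP => k4; move: h5; rewrite leNgt => /negP; apply.
rewrite e4 ew eh !addrA.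
have -> : circ a (a + w k.+1 + w k.+1) c (c + h k.+1 + h k.+1) = circ a (a + w k.+1) c (c + h k.+1) + circ (a + w k.+1) (a + w k.+1 + w k.+1) c (c + h k.+1) +
  circ a (a + w k.+1) (c + h k.+1) (c + h k.+1 + h k.+1) + circ (a + w k.+1) (a + w k.+1 + w k.+1) (c + h k.+1) (c + h k.+1 + h k.+1).
  by rewrite /circ; lra.
by apply: le_lt_trans (ler_norm4 _ _ _ _) _; lra.
Qed.

Lemma goursat : circ a0 b0 c0 d0 = 0.
Proof.
apply/eqP; rewrite -normr_le0 -/eta leNgt; apply/negP => eta0.
have [f [f0 Hf]] : exists f : nat -> R * R, good 0 (f 0) /\ forall k, good k (f k) -> good k.+1 (f k.+1) /\
  ((f k).1 <= (f k.+1).1 /\ (f k.+1).1 + w k.+1 <= (f k).1 + w k) /\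
  ((f k).2 <= (f k.+1).2 /\ (f k.+1).2 + h k.+1 <= (f k).2 + h k).
  have /choice[s Hs] : forall kp : nat * (R * R), exists p' : R * R,
      good kp.1 kp.2 -> good kp.1.+1 p' /\
      (kp.2.1 <= p'.1 /\ p'.1 + w kp.1.+1 <= kp.2.1 + w kp.1) /\
      (kp.2.2 <= p'.2 /\ p'.2 + h kp.1.+1 <= kp.2.2 + h kp.1).
    case=> k p /=; have [g|ng] := pselect (good k p); last by exists p.
    by have [p' Hp'] := step g; exists p'.
  pose F := fix F k := if k is k'.+1 then s (k', F k') else (a0, c0).
  exists F; split; last by move=> k /(Hs (k, F k)).
  split => //=; rewrite ?expr0 ?divr1 ?subrK //=.
  - by rewrite /w expr0 divr1; lra.
  - by rewrite /h expr0 divr1; lra.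
  - by rewrite /w /h !expr0 !divr1 ![_ + (_ - _)]addrC !subrK.
have g k : good k (f k) by elim: k => // k /Hf[].
pose mono (u l : nat -> R) := forall k, u k <= u k.+1 /\ u k.+1 + l k.+1 <= u k + l k.
(* Nested intervals: the supremum of the left ends lies in all of them. *)
have limit (u l : nat -> R) : (forall k, 0 <= l k) -> mono u l -> exists x, forall k, u k <= x <= u k + l k.
  move=> l0 m.
  have m1 j k : u k <= u (j + k)%N by elim: j => // j IH; rewrite (le_trans IH)// addSn (m _).1.
  have m2 j k : u (j + k)%N + l (j + k)%N <= u k + l k.
    by elim: j => // j IH; apply: le_trans IH; rewrite addSn (m _).2.
  have ub j k : u j <= u k + l k.
    have [/subnK <-|/ltnW /subnK jk] := leqP k j.
      by apply: le_trans (m2 (j - k)%N k); rewrite lerDl.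
    by apply: (@le_trans _ _ (u k)); [rewrite -[in leRHS]jk m1|rewrite lerDl].
  exists (sup (range u)) => k; apply/andP; split.
    by apply: ub_le_sup; [exists (u 0%N + l 0%N) => _ [j _ <-]|exists k].
  by apply: ge_sup; [exists (u 0%N), 0%N|move=> _ [j _ <-]].
have [x Hx] := limit (fun k => (f k).1) w w_ge0 (fun k => (Hf k (g k)).2.1).
have [y Hy] := limit (fun k => (f k).2) h h_ge0 (fun k => (Hf k (g k)).2.2).
have lxy : lin2 x y.
  have [h1 h2 h3 h4 _] := g 0%N; apply: PQ.
    by have /andP[k1 k2] := Hx 0%N; rewrite (le_trans h1 k1) (le_trans k2 h2).
  by have /andP[k1 k2] := Hy 0%N; rewrite (le_trans h3 k1) (le_trans k2 h4).
set S := (b0 - a0) + (d0 - c0).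
have S0 : 0 <= S by rewrite addr_ge0 ?subr_ge0.
have S1 : 0 < S ^+ 2 + 1 by rewrite ltr_wpDl// sqr_ge0.
(* With this tolerance the circulation around the k-th rectangle is at most
   [eta / 2 / (S ^+ 2 + 1) * S ^+ 2 / 4 ^+ k], which is less than the [eta / 4 ^+ k] guaranteed by
   [good]. *)
have [d dgt0 Hd] := lin2_local lxy (divr_gt0 (divr_gt0 eta0 (ltr0Sn _ 1)) S1).
have [k Hk] := exp2_small S dgt0.
have Swh : w k + h k = S / 2 ^+ k by rewrite -mulrDl.
have [g1 g2 g3 g4 g5] := g k.
have W := w_ge0 k; have Hh := h_ge0 k.
have inx t : (f k).1 <= t <= (f k).1 + w k -> a0 <= t <= b0 by lra.
have iny t : (f k).2 <= t <= (f k).2 + h k -> c0 <= t <= d0 by lra.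
have := Hd (f k).1 ((f k).1 + w k) (f k).2 ((f k).2 + h k) (H (f k).2) (H ((f k).2 + h k))
  (G (f k).1) (G ((f k).1 + w k)) (Hx k) (Hy k).
have -> : (f k).1 + w k - (f k).1 = w k by rewrite addrC addKr.
have -> : (f k).2 + h k - (f k).2 = h k by rewrite addrC addKr.
rewrite Swh => F; move: g5; apply/negP; rewrite -ltNge.
apply: (le_lt_trans (F _ _ _ _ _ _)).
- by apply: le_lt_trans Hk; rewrite -Swh lerDl.
- by apply: le_lt_trans Hk; rewrite -Swh lerDr.
- by move=> t /inx ht; apply: dH => //; apply: iny; rewrite lexx lerDl.
- by move=> t /inx ht; apply: dH => //; apply: iny; rewrite lexx lerDl Hh.
- by move=> t /iny ht; apply: dG => //; apply: inx; rewrite lexx lerDl.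
- by move=> t /iny ht; apply: dG => //; apply: inx; rewrite lexx lerDl W.
rewrite expr_div_n -exprM mulnC exprM (_ : 2 ^+ 2 = 4 :> R); last by rewrite -natrX.
rewrite mulrA ltr_pM2r ?invr_gt0 ?exprn_gt0// mulrAC ltr_pdivrMr//.
have S2 : 0 <= S ^+ 2 by exact: sqr_ge0.
rewrite -subr_gt0 (_ : _ - _ = eta / 2 * (S ^+ 2 + 2)); last by field.
by rewrite mulr_gt0 ?divr_gt0// ltr_wpDl.
Qed.

End rectangle.

End Goursat.

(** * The Cauchy estimate in one variable *)

Section CauchyEstimate.
Variable R : realType.
Local Notation C := R[i].

Lemma n1i (w : C) : n1 ('i%C * w) = n1 w.
Proof. by rewrite /n1 ReM ImM /= !mul0r !mul1r sub0r add0r normrN addrC. Qed.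

Lemma n1B (a b : C) : n1 (a - b) <= n1 a + n1 b.
Proof. by rewrite -(n1N b) n1D. Qed.

Lemma ReV (x y : R) : Re ((x +i* y)%C^-1) = x / (x ^+ 2 + y ^+ 2).
Proof. by []. Qed.
Lemma ImV (x y : R) : Im ((x +i* y)%C^-1) = - y / (x ^+ 2 + y ^+ 2).
Proof. by rewrite /= mulNr. Qed.

Lemma lin2_cont1 (P Q : R -> R -> R) x y : lin2 P Q x y -> cont1 (P ^~ y) x /\ cont1 (Q x) y.
Proof.
move=> [p [q [s H]]]; split.
  move=> e e0; have [d d0 Hd] := H 1 ltr01.
  have p0 : 0 < `|p| + 1 by rewrite ltr_wpDl.
  exists (Num.min d (e / (`|p| + 1))); first by rewrite lt_min d0 divr_gt0.
  move=> x'; rewrite lt_min => /andP[h1 h2].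
  have [] := Hd x' y h1; first by rewrite subrr normr0.
  rewrite subrr normr0 !mulr0 !subr0 addr0 mul1r => h3 _.
  rewrite ltr_pdivlMr// in h2; rewrite (le_trans _ (ltW h2))// mulrDr mulr1.
  rewrite -[P x' y - _](subrK (p * (x' - x))) (le_trans (ler_normD _ _))//.
  by rewrite addrC lerD// normrM mulrC.
move=> e e0; have [d d0 Hd] := H 1 ltr01.
have p0 : 0 < `|s| + 1 by rewrite ltr_wpDl.
exists (Num.min d (e / (`|s| + 1))); first by rewrite lt_min d0 divr_gt0.
move=> y'; rewrite lt_min => /andP[h1 h2].
have [] := Hd x y' _ h1; first by rewrite subrr normr0.
rewrite subrr normr0 !mulr0 !subr0 add0r mul1r => _ h3.
rewrite ltr_pdivlMr// in h2; rewrite (le_trans _ (ltW h2))// mulrDr mulr1.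
rewrite -[Q x y' - _](subrK (s * (y' - y))) (le_trans (ler_normD _ _))//.
by rewrite addrC lerD// normrM mulrC.
Qed.

(** The form is the imaginary part of [F dz]; by the Cauchy-Riemann equations the common coefficient
    is [Re d]. *)
Lemma lin2_holo (F : C -> C) (x y : R) : differentiable F (x +i* y)%C ->
  lin2 (fun x y => Im (F (x +i* y)%C)) (fun x y => Re (F (x +i* y)%C)) x y.
Proof.
move=> /derivable1_diffP/derivableP/is_deriveC_E; set d := 'D_1 F _ => H.
exists (Im d), (Re d), (- Im d) => e e0; have [r r0 Hr] := H e e0.
exists (r / 2); first exact: divr_gt0.
move=> x' y' hx hy; have hxy : n1 ((x' - x) +i* (y' - y))%C < r by rewrite /n1 /=; lra.
have := Hr _ hxy; rewrite {2}/n1 /=.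
have -> : (x +i* y)%C + ((x' - x) +i* (y' - y))%C = (x' +i* y')%C.
  by apply: eqC => /=; ring.
set W := F _ - F _ - _ => HW.
have hR := normr_ge0 (Re W); have hI := normr_ge0 (Im W).
rewrite /n1 in HW; split.
  rewrite [X in `|X|](_ : _ = Im W); first by lra.
  by rewrite /W !ReImE /=; ring.
rewrite [X in `|X|](_ : _ = Re W); first by lra.
by rewrite /W !ReImE /=; ring.
Qed.

Lemma diff_compC (f h : C -> C) (z : C) : differentiable h z -> differentiable f (h z) ->
  differentiable (fun z => f (h z)) z.
Proof. exact: differentiable_comp. Qed.

Section est.
Variables (g : C -> C) (M : R) (d : C).
Hypothesis dg : forall z, `|Re z| <= 1 -> `|Im z| <= 1 -> differentiable g z.
Hypothesis gM : forall z, `|Re z| <= 1 -> `|Im z| <= 1 -> n1 (g z) <= M.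
Hypothesis dg0 : is_derive (0 : C) 1 g d.

(* Averaging over the rotations by the powers of i makes [F dz] invariant under
   z |-> i z, so that the boundary of the square is covered by the images of the
   sides of the pinwheel rectangle [r, 1] x [-r, 1]. *)
Let N z := g z - 'i%C * g ('i%C * z) - g (- z) + 'i%C * g (- ('i%C * z)).
Let F z := N z * (z^-1 * z^-1).
Let A x y := Re (F (x +i* y)%C).
Let B x y := Im (F (x +i* y)%C).

Let ii : 'i%C * 'i%C = -1 :> C.
Proof. by apply: eqC => /=; ring. Qed.

Let FI z : F ('i%C * z) = - 'i%C * F z.
Proof.
rewrite /F /N mulrA ii mulN1r opprK invfM.
have -> : 'i%C^-1 = - 'i%C :> C.
  by apply: (@mulfI _ 'i%C); rewrite ?mulfV ?mulrN ?ii ?opprK// -normr_eq0 normc_def /=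
   expr0n expr1n add0r sqrtr1 oner_eq0.
have i2 : 'i%C ^+ 2 = -1 :> C by rewrite expr2 ii.
set a := g z; set b := g _; set c := g _; set e := g _; ring: i2.
Qed.

Let symA x y : A (- y) x = B x y.
Proof.
rewrite /A /B; have -> : (- y +i* x)%C = 'i%C * (x +i* y)%C by apply: eqC => /=; ring.
by rewrite FI !ReImE /=; ring.
Qed.

Let symB x y : B (- y) x = - A x y.
Proof.
rewrite /A /B; have -> : (- y +i* x)%C = 'i%C * (x +i* y)%C by apply: eqC => /=; ring.
by rewrite FI !ReImE /=; ring.
Qed.

Let dF z : `|Re z| <= 1 -> `|Im z| <= 1 -> z != 0 -> differentiable F z.
Proof.
move=> h1 h2 z0; have hi : differentiable (fun z : C => 'i%C * z) z by [].
have hri : `|Re ('i%C * z)| <= 1 by rewrite ReM /= mul0r mul1r sub0r normrN.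
have hii : `|Im ('i%C * z)| <= 1 by rewrite ImM /= mul0r mul1r add0r.
have hN : differentiable (fun z : C => - z) z by [].
have hiN : differentiable (fun z : C => - ('i%C * z)) z by apply: differentiableN.
have c1 : differentiable (fun z => g ('i%C * z)) z by exact: (diff_compC hi (dg hri hii)).
have c2 : differentiable (fun z => g (- z)) z.
  by apply: (diff_compC hN); apply: dg; rewrite ?ReN ?ImN normrN.
have c3 : differentiable (fun z => g (- ('i%C * z))) z.
  by apply: (diff_compC hiN); apply: dg; rewrite ?ReN ?ImN normrN.
have c0 := dg h1 h2.
have dV : differentiable (fun z : C => z^-1) z by apply: differentiableV.
have cc : differentiable (fun z : C => 'i%C : C) z by exact: differentiable_cst.
exact: (differentiableM (differentiableD (differentiableB (differentiableB c0
  (differentiableM cc c1)) c2) (differentiableM cc c3)) (differentiableM dV dV)).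
Qed.

Let linF x y : `|x| <= 1 -> `|y| <= 1 -> x != 0 -> lin2 B A x y.
Proof.
move=> h1 h2 h3; apply: lin2_holo; apply: dF => //=.
by apply: contra h3 => /eqP[->].
Qed.

(** Goursat on the pinwheel rectangle. A rotation carries its top side to a piece of the line x = 1
    and its bottom side to a piece of the line x = r, where [B] becomes [A] up to sign. What is left
    compares one side of the unit square with one side of the square of half-width r. *)
Let flux (r : R) : 0 < r < 1 -> exists G1 Gr : R -> R, [/\
  forall y : R, -1 <= y <= 1 -> is_derive y 1 G1 (A 1 y),
  forall y : R, -1 <= y <= 1 -> is_derive y 1 Gr (A r y) &
  G1 1 - G1 (-1) = Gr r - Gr (- r)].
Proof.
move=> /andP[r0 r1].
have le1 (x : R) : -1 <= x <= 1 -> `|x| <= 1 by rewrite ler_norml.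
have rr (x : R) : r <= x <= 1 -> `|x| <= 1 /\ x != 0.
  by move=> /andP[h1 h2]; split; [rewrite ler_norml; lra | rewrite gt_eqF//; lra].
have /choice[G HG] : forall x : R, exists Gx : R -> R, r <= x <= 1 -> forall y : R, -1 <= y <= 1 -> is_derive y 1 Gx (A x y).
  move=> x; have [hx|hx] := pselect (r <= x <= 1); last by exists id.
  have [h1 h2] := rr _ hx.
  have [||Gx HGx] := @prim_exists R (A x) (-1) 1; first by lra.
    by move=> y hy; case: (lin2_cont1 (linF h1 (le1 _ hy) h2)).
  by exists Gx => _.
have /choice[H HH] : forall y : R, exists Hy : R -> R, -1 <= y <= 1 -> forall x : R, r <= x <= 1 -> is_derive x 1 Hy (B x y).
  move=> y; have [hy|hy] := pselect (-1 <= y <= 1); last by exists id.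
  have [||Hy HHy] := @prim_exists R (B ^~ y) r 1; first by lra.
    by move=> x hx; have [h1 h2] := rr _ hx; case: (lin2_cont1 (linF h1 (le1 _ hy) h2)).
  by exists Hy => _.
have rI : r <= r <= 1 by rewrite lexx ltW.
have oI : r <= (1 : R) <= 1 by apply/andP; split; [exact: ltW|exact: lexx].
have rJ : -1 <= - r <= 1 by lra.
have oJ : -1 <= (1 : R) <= 1 by apply/andP; split; [lra|exact: lexx].
exists (G 1), (G r); split; [exact: HG|exact: HG|].
have yy (y : R) : - r <= y <= 1 -> -1 <= y <= 1 by lra.
have E : H (- r) 1 - H (- r) r - (H 1 1 - H 1 r) + (G 1 1 - G 1 (- r)) - (G r 1 - G r (- r)) = 0.
  apply: (@goursat R B A r 1 (- r) 1 H G); [lra|lra| | |].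
  - by move=> x y hx hy; have [h1 h2] := rr _ hx; apply: linF => //; exact/le1/yy.
  - by move=> x y hx hy; apply: HH => //; exact: yy.
  - by move=> x y hx hy; apply: HG => //; exact: yy.
have T : H 1 1 - H 1 r = G 1 (- 1) - G 1 (- r).
  apply: (@eq_prim R (H 1) (fun x => G 1 (- x)) (fun x => B x 1) r 1); first lra.
    by move=> x hx; exact: HH.
  move=> x hx; have hx' : -1 <= - x <= 1 by lra.
  apply: is_derive_eq1 (is_derive1_comp (HG _ oI _ hx') (is_deriveNid x 1)) _.
  by rewrite mulrN1 -(symB 1 (- x)) opprK.
have Bt : H (- r) 1 - H (- r) r = G r 1 - G r r.
  apply: (@eq_prim R (H (- r)) (G r) (fun x => B x (- r)) r 1); first lra.
    by move=> x hx; exact: HH.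
  move=> x hx; apply: is_derive_eq1 (HG _ rI x _) _; first lra.
  by rewrite -symA opprK.
by lra.
Qed.

Let M0 : 0 <= M.
Proof. by rewrite (le_trans (n1_ge0 (g 0)))// gM/= ?normr0. Qed.

(** The constant is 4, for the four values of [g] in [N], times the square of the bound 2 for
    [n1 z^-1]. *)
Let A1_le (y : R) : -1 <= y <= 1 -> `|A 1 y| <= 16 * M.
Proof.
move=> hy; have y1 : `|y| <= 1 by rewrite ler_norml.
set z := (1 +i* y)%C; have hz : `|Re z| <= 1 by rewrite /= normr1.
have nV : n1 z^-1 <= 2.
  rewrite /n1 ReV ImV expr1n mulNr normrN !normf_div normr1 -mulrDl.
  have y2 := sqr_ge0 y; rewrite (_ : `|1 + y ^+ 2| = 1 + y ^+ 2); last by rewrite ger0_norm//; lra.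
  rewrite ler_pdivrMr; lra.
have nN : n1 (N z) <= 4 * M.
  have h1 : n1 (g z) <= M by exact: gM.
  have h2 : n1 (g ('i%C * z)) <= M by apply: gM; rewrite ?ReM ?ImM /= ?mul0r ?mul1r ?sub0r ?add0r ?normrN ?normr1.
  have h3 : n1 (g (- z)) <= M by apply: gM; rewrite ?ReN ?ImN normrN.
  have h4 : n1 (g (- ('i%C * z))) <= M.
    by apply: gM; rewrite ?ReN ?ImN normrN ?ReM ?ImM /= ?mul0r ?mul1r ?sub0r ?add0r ?normrN ?normr1.
  rewrite /N (le_trans (n1D _ _))// n1i (le_trans (lerD (n1B _ _) (lexx _)))//.
  rewrite (le_trans (lerD (lerD (n1B _ _) (lexx _)) (lexx _)))// n1i; lra.
have := n1M (N z) (z^-1 * z^-1); have := n1M z^-1 z^-1.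
have v0 := n1_ge0 z^-1; have n0 := n1_ge0 (N z).
rewrite -/(F z) => h1 h2; apply: (@le_trans _ _ (n1 (F z))).
  by rewrite /n1 lerDl.
apply: (le_trans h2); have h3 : n1 z^-1 * n1 z^-1 <= 2 * 2 by apply: ler_pM.
have : n1 (z^-1 * z^-1) <= 4 by lra.
move=> h4; have := ler_pM n0 (n1_ge0 _) nN h4; have -> // : 4 * M * 4 = 16 * M by ring.
Qed.

(** In the average the values at 0 cancel, and each of the four rotations contributes [d * z]. *)
Let N_lin (e : R) : 0 < e -> exists2 r : R, 0 < r & forall z, n1 z < r -> n1 (N z - 4 * d * z) <= e * n1 z.
Proof.
move=> e0; have [r r0 Hr] := is_deriveC_E dg0 (divr_gt0 e0 (ltr0Sn R 3)).
exists r => // z hz; have [h1 h2] := (Hr _ hz, Hr ('i%C * z)).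
have h3 := Hr (- z); have h4 := Hr (- ('i%C * z)).
rewrite !add0r in h1 h2 h3 h4.
have {}h2 := h2 (eq_ind_r (fun t => t < r) hz (n1i z)).
have {}h3 := h3 (eq_ind_r (fun t => t < r) hz (n1N z)).
have {}h4 := h4 (eq_ind_r (fun t => t < r) hz (etrans (n1N _) (n1i z))).
rewrite !n1N !n1i in h2 h3 h4.
set E1 := (X in n1 X) in h1; set E2 := (X in n1 X) in h2; set E3 := (X in n1 X) in h3; set E4 := (X in n1 X) in h4.
have -> : N z - 4 * d * z = E1 - 'i%C * E2 - E3 + 'i%C * E4.
  rewrite /N /E1 /E2 /E3 /E4; have i2 : 'i%C ^+ 2 = -1 :> C by rewrite expr2 ii.
  set a := g z; set b := g _; set c := g _; set f := g _; set k := g 0; ring: i2.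
rewrite (le_trans (n1D _ _))// n1i (le_trans (lerD (n1B _ _) (lexx _)))//.
rewrite (le_trans (lerD (lerD (n1B _ _) (lexx _)) (lexx _)))// n1i; lra.
Qed.

(** By [flux] the integral of [A] over the side x = 1, at most [32 * M], equals the one over the
    side x = r; as r tends to 0, the latter is at least [4 * Re d] up to a small error. *)
Lemma cauchy_re : Re d <= 8 * M.
Proof.
apply/ler_addgt0Pr => e e0.
have [rho rho0 Hrho] := N_lin (divr_gt0 e0 (ltr0Sn R 3)).
have [r [r0 rrho rhalf]] : exists r : R, [/\ 0 < r, r <= rho / 4 & r <= 1 / 2].
  by exists (Num.min (rho / 4) (1 / 2)); rewrite lt_min !divr_gt0// !ge_min !lexx orbT.
have r1 : 0 < r < 1 by lra.
have [G1 [Gr [dG1 dGr EG]]] := flux r1.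
have L : `|G1 1 - G1 (- 1)| <= 32 * M.
  apply: le_trans (mvt_le _ dG1 A1_le) _; first lra.
  by rewrite opprK; lra.
have [||t ht Et] := @mvt R (fun y => Gr y - Gr (- y)) (fun y => A r y + A r (- y)) 0 r; first exact: ltW.
  move=> y hy; have hy1 : -1 <= y <= 1 by lra.
  have hy2 : -1 <= - y <= 1 by lra.
  apply: is_derive_eq1 (is_deriveB (dGr _ hy1) (is_derive1_comp (dGr _ hy2) (is_deriveNid y 1))) _.
  by rewrite mulrN1 opprK.
rewrite oppr0 subrr !subr0 addr0 in Et.
have q0 : 0 < r ^+ 2 + t ^+ 2 by rewrite ltr_pwDl ?exprn_gt0// sqr_ge0.
(* [F z = 4 d / z + E / z^2] with [E = o(z)], and the imaginary part of [d]
   cancels between the two conjugate points. *)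
have key (s : R) : `|s| <= r -> s ^+ 2 = t ^+ 2 -> `|A r s - 4 * (Re d * r + Im d * s) / (r ^+ 2 + t ^+ 2)| <= 2 * e / r.
  move=> hs hst; set z := (r +i* s)%C.
  have hz : n1 z <= 2 * r by rewrite /n1 /= (ger0_norm (ltW r0)); lra.
  have hV : n1 z^-1 <= 2 / r.
    rewrite /n1 ReV ImV hst mulNr normrN !normf_div -mulrDl [`|r|]ger0_norm ?(ltW r0)//.
    rewrite [`|_ + _ ^+ 2|]ger0_norm ?(ltW q0)// ler_pdivrMr// mulrAC ler_pdivlMr//.
    have s2 := sqr_ge0 t; have : `|s| * r <= r * r by rewrite ler_wpM2r// ltW.
    by rewrite !expr2 in s2 *; lra.
  have z0 : z != 0 by rewrite eq_complex /= gt_eqF.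
  have -> : A r s - 4 * (Re d * r + Im d * s) / (r ^+ 2 + t ^+ 2) =
      Re ((N z - 4 * d * z) * (z^-1 * z^-1)).
    rewrite mulrBl ReD ReN -/(F z) -/(A r s); congr (_ - _).
    rewrite [4 * d * z * _]mulrA mulfK// ReM ReV ImV hst !ReImE /=.
    by field; rewrite gt_eqF.
  apply: (@le_trans _ _ (n1 ((N z - 4 * d * z) * (z^-1 * z^-1)))); first by rewrite /n1 lerDl.
  have zrho : n1 z < rho by lra.
  have h1 := Hrho _ zrho.
  have v0 := n1_ge0 z^-1.
  rewrite (le_trans (n1M _ _))//.
  have h2 : n1 (z^-1 * z^-1) <= (2 / r) * (2 / r) by rewrite (le_trans (n1M _ _))// ler_pM.
  have h3 : e / 4 * n1 z <= e / 4 * (2 * r) by rewrite ler_wpM2l// divr_ge0// ltW.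
  have := ler_pM (n1_ge0 _) (n1_ge0 _) (le_trans h1 h3) h2.
  by have -> : e / 4 * (2 * r) * (2 / r * (2 / r)) = 2 * e / r by field; rewrite gt_eqF.
have [t0 tr] := andP ht.
have k1 := key t; have k2 := key (- t).
rewrite normrN sqrrN in k2.
have {}k1 := k1 (eq_ind_r (fun x => x <= r) tr (ger0_norm t0)) erefl.
have {}k2 := k2 (eq_ind_r (fun x => x <= r) tr (ger0_norm t0)) erefl.
have [d0|d0] := leP (Re d) 0; first by rewrite (le_trans d0)// addr_ge0 ?(ltW e0)// mulr_ge0.
(* Here [t <= r] gives [r ^+ 2 + t ^+ 2 <= 2 * r ^+ 2]. This crude bound at a single mean value
   point stands in for the exact integral, which would be an arctangent. *)
have low : 4 * Re d / r <= 8 * Re d * r / (r ^+ 2 + t ^+ 2).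
  rewrite ler_pdivrMr// mulrAC ler_pdivlMr//.
  have t2 : t * t <= r * r by apply: ler_pM.
  have : Re d * (r ^+ 2 + t ^+ 2) <= Re d * (r * r + r * r) by rewrite ler_pM2l// !expr2; lra.
  by lra.
have sum : 4 * Re d / r - 4 * e / r <= A r t + A r (- t).
  move: k1 k2; rewrite !ler_norml => /andP[k1 _] /andP[k2 _].
  have e1 : 4 * (Re d * r + Im d * t) / (r ^+ 2 + t ^+ 2) + 4 * (Re d * r + Im d * - t) / (r ^+ 2 + t ^+ 2)
     = 8 * Re d * r / (r ^+ 2 + t ^+ 2) by field; rewrite gt_eqF.
  have e2 : 2 * e / r + 2 * e / r = 4 * e / r by field; rewrite gt_eqF.
  by lra.
have sumr : 4 * Re d - 4 * e <= (A r t + A r (- t)) * r.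
  have := ler_wpM2r (ltW r0) sum.
  by have -> : (4 * Re d / r - 4 * e / r) * r = 4 * Re d - 4 * e by field; rewrite gt_eqF.
move: L; rewrite EG Et => /(le_trans (ler_norm _)); lra.
Qed.
End est.

(** The bound on the real part is applied to [g] times 1, -1, i and -i, which leave [n1] unchanged
    and turn [Re d] into plus or minus [Re d] and [Im d]. *)
Lemma cauchy_n1 (g : C -> C) (M : R) (d : C) :
  (forall z, `|Re z| <= 1 -> `|Im z| <= 1 -> differentiable g z) ->
  (forall z, `|Re z| <= 1 -> `|Im z| <= 1 -> n1 (g z) <= M) ->
  is_derive (0 : C) 1 g d -> n1 d <= 16 * M.
Proof.
move=> dg gM dg0.
have H (u : C) : (forall w, n1 (u * w) = n1 w) -> Re (u * d) <= 8 * M.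
  move=> hu; apply: (@cauchy_re (fun z => u * g z)).
  - move=> z h1 h2; have cc : differentiable (fun z : C => u : C) z by exact: differentiable_cst.
    exact: (differentiableM cc (dg z h1 h2)).
  - by move=> z h1 h2; rewrite hu gM.
have h1 := H 1 (fun w => congr1 (@n1 R) (mul1r w)).
have h2 := H (-1) (fun w => etrans (congr1 (@n1 R) (mulN1r w)) (n1N w)).
have h3 := H 'i%C n1i.
have h4 : Re (- 'i%C * d) <= 8 * M by apply: H => w; rewrite mulNr n1N n1i.
rewrite mul1r in h1; rewrite mulN1r ReN in h2; rewrite !ReImE /= in h3 h4.
have : `|Re d| <= 8 * M by rewrite ler_norml; apply/andP; split; lra.
have : `|Im d| <= 8 * M by rewrite ler_norml; apply/andP; split; lra.
by rewrite /n1; lra.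
Qed.

End CauchyEstimate.

(** * Estimates in several variables and the second differential *)

Section Holomorphic.
Variable R : realType.
Local Notation C := R[i].

Definition holb n m (f : 'rV[C]_n -> 'rV[C]_m) (x : 'rV[C]_n) (rho M : R) :=
  forall w, N1 w < rho -> differentiable f (x + w) /\ N1 (f (x + w)) <= M.

Lemma holb_sub n m (f : 'rV[C]_n -> 'rV[C]_m) x w rho rho' M :
  N1 w + rho' <= rho -> holb f x rho M -> holb f (x + w) rho' M.
Proof.
move=> h H u hu; rewrite -addrA; apply: H.
by rewrite (le_lt_trans (N1D _ _))//; lra.
Qed.

Lemma N1_sum_le n (z : 'rV[C]_n) (b : R) : (forall c, `|rc c z| <= b) -> N1 z <= (2 * n%:R) * b.
Proof.
move=> h; apply: (@le_trans _ _ (\sum_(c : 'I_n * bool) b)); first exact: ler_sum.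
by rewrite sumr_const card_prod card_ord card_bool -[leLHS]mulr_natl natrM [n%:R * _]mulrC.
Qed.

Definition eps_diff n m (f : 'rV[C]_n -> 'rV[C]_m) (x : 'rV[C]_n) L := clin L /\
  forall e : R, 0 < e -> exists2 d : R, 0 < d & forall h, N1 h < d ->
    N1 (f (x + h) - f x - L h) <= e * N1 h.

Lemma eps_diff_d n m (f : 'rV[C]_n -> 'rV[C]_m) x : differentiable f x -> eps_diff f x ('d f x).
Proof. by move=> df; split; [exact: clin_d|exact: diff_eps]. Qed.

Lemma eps_diffI n m (f L : 'rV[C]_n -> 'rV[C]_m) x : eps_diff f x L ->
  differentiable f x /\ 'd f x = L :> (_ -> _).
Proof. by move=> [h1 h2]; exact: diff_epsI. Qed.

Lemma clin_sub n m (L L' : 'rV[C]_n -> 'rV[C]_m) : clin L -> clin L' -> clin (fun v => L v - L' v).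
Proof. by move=> h h' a u v; rewrite h h' scalerBr opprD addrACA. Qed.

Lemma clin_scale n m (L : 'rV[C]_n -> 'rV[C]_m) (k : C) : clin L -> clin (fun v => k *: L v).
Proof. by move=> h a u v; rewrite h scalerDr !scalerA mulrC. Qed.

Lemma eps_diffB n m (f g L L' : 'rV[C]_n -> 'rV[C]_m) x : eps_diff f x L -> eps_diff g x L' ->
  eps_diff (fun y => f y - g y) x (fun v => L v - L' v).
Proof.
move=> [l H] [l' H']; split; first exact: clin_sub.
move=> e e0; have e2 : 0 < e / 2 by exact: divr_gt0.
have [d1 d10 H1] := H _ e2; have [d2 d20 H2] := H' _ e2.
exists (Num.min d1 d2); first by rewrite lt_min d10.
move=> h; rewrite lt_min => /andP[/H1 k1 /H2 k2].
set A1 := f (x + h) in k1 *; set A2 := f x in k1 *; set A3 := L h in k1 *.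
set A4 := g (x + h) in k2 *; set A5 := g x in k2 *; set A6 := L' h in k2 *.
have -> : A1 - A4 - (A2 - A5) - (A3 - A6) = (A1 - A2 - A3) - (A4 - A5 - A6).
  by apply: rc_inj => c; rewrite !rcB; ring.
by rewrite (le_trans (N1B _ _))//; lra.
Qed.

Lemma eps_diffZ n m (f L : 'rV[C]_n -> 'rV[C]_m) (k : R) x : eps_diff f x L ->
  eps_diff (fun y => k%:C%C *: f y) x (fun v => k%:C%C *: L v).
Proof.
move=> [l H]; split; first exact: clin_scale.
move=> e e0; have k0 : 0 < `|k| + 1 by rewrite ltr_wpDl.
have [d d0 Hd] := H _ (divr_gt0 e0 k0); exists d => // h /Hd.
rewrite -!scalerBr N1Z => h1.
rewrite (le_trans (ler_wpM2l (normr_ge0 k) h1))// mulrA ler_wpM2r ?N1_ge0//.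
by rewrite mulrA ler_pdivrMr// mulrC ler_wpM2l ?(ltW e0)// lerDl.
Qed.

Lemma eps_diff_shift n m (f L : 'rV[C]_n -> 'rV[C]_m) (x w : 'rV[C]_n) : eps_diff f (x + w) L ->
  eps_diff (fun y => f (y + w)) x L.
Proof.
move=> [l H]; split => // e e0; have [d d0 Hd] := H e e0; exists d => // h /Hd.
by rewrite (addrAC x w h).
Qed.

Lemma eps_increment n m (f L L' : 'rV[C]_n -> 'rV[C]_m) (x w : 'rV[C]_n) :
  eps_diff f x L -> eps_diff f (x + w) L' ->
  eps_diff (fun y => f (y + w) - f y) x (fun v => L' v - L v).
Proof. by move=> h1 h2; apply: eps_diffB => //; exact: eps_diff_shift. Qed.

Lemma is_derive_slice_eq n m (f : 'rV[C]_n -> 'rV[C]_m) (x v y : 'rV[C]_n) (z : C) j :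
  x + z *: v = y -> differentiable f y ->
  is_derive z 1 (fun z => f (x + z *: v) 0 j) ('d f y v 0 j).
Proof. by move=> <-; exact: is_derive_slice. Qed.

(* One mean value point for each of the [2 * m] real coordinates. *)
Lemma vec_mvt n m (f : 'rV[C]_n -> 'rV[C]_m) (y w : 'rV[C]_n) (D : 'rV[C]_m) (B : R) :
  (forall t : R, 0 <= t <= 1 -> differentiable f (y + t%:C%C *: w) /\
     N1 ('d f (y + t%:C%C *: w) w - D) <= B) ->
  N1 (f (y + w) - f y - D) <= (2 * m%:R) * B.
Proof.
move=> H; apply: N1_sum_le => c.
have [||t ht E] := @mvt R (fun t => rc c (f (y + t%:C%C *: w)) - t * rc c D)
   (fun t => rc c ('d f (y + t%:C%C *: w) w) - rc c D) 0 1; first exact: ler01.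
  move=> t /H[df _]; apply: is_derive_eq1 (is_deriveB (is_derive_line c df) (is_deriveM (is_derive_id t 1) (is_derive_cst (rc c D) t 1))) _.
  by rewrite scaler0 add0r [X in _ - X]mulr1.
have y1 : y + (1 : R)%:C%C *: w = y + w by rewrite scale1r.
have y0 : y + (0 : R)%:C%C *: w = y by rewrite scale0r addr0.
rewrite y1 y0 mul1r mul0r !subr0 mulr1 in E.
have -> : rc c (f (y + w) - f y - D) = rc c ('d f (y + t%:C%C *: w) w - D).
  by rewrite !rcB -E; ring.
by have [_ hB] := H t ht; apply: le_trans (rc_le_N1 _ _) hB.
Qed.

(** The one-variable estimate on the complex line through [x] in the direction [v]. [K] is chosen
    before [f], because the estimate is applied below to increments and to differences of quotients,
    for which [M] is small. *)
Lemma diff_bound n m : exists2 K : R, 0 < K & forall (f : 'rV[C]_n -> 'rV[C]_m) (x : 'rV[C]_n) (rho M : R),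
  0 < rho -> 0 <= M -> holb f x rho M -> forall L, eps_diff f x L ->
  forall v, N1 (L v) <= K * M / rho * N1 v.
Proof.
exists (64 * m%:R + 1); first by rewrite ltr_wpDl// mulr_ge0.
move=> f x rho M rho0 M0 H L /eps_diffI[_ <-] v.
have [->|v0] := eqVneq v 0; first by rewrite (clin0 (clin_d _ _)) !N10 mulr0.
(* On the unit square [n1 z <= 2], so a multiple of a vector of norm [rho / 4] by [z] stays in the
   ball of radius [rho]. *)
have Nv := N1_gt0 v0; pose s := rho / 4 / N1 v.
have s0 : 0 < s by rewrite !divr_gt0.
have Nsv : N1 (s%:C%C *: v) = rho / 4 by rewrite N1Z ger0_norm ?(ltW s0)// /s divfK// gt_eqF.
have dv : N1 ('d f x (s%:C%C *: v)) <= m%:R * (16 * M).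
  rewrite N1E; apply: (@le_trans _ _ (\sum_(j < m) (16 * M))); last first.
    by rewrite sumr_const card_ord [leRHS]mulr_natl.
  apply: ler_sum => j _; set w := s%:C%C *: v.
  have small (z : C) : `|Re z| <= 1 -> `|Im z| <= 1 -> N1 (z *: w) < rho.
    move=> h1 h2; rewrite (le_lt_trans (N1_mulC _ _))// Nsv.
    have : n1 z <= 2 by rewrite /n1; lra.
    move=> h3; apply: (@le_lt_trans _ _ (2 * (rho / 4))); last by lra.
    by rewrite ler_wpM2r// divr_ge0// ltW.
  have x0 : x + (0 : C) *: w = x by rewrite scale0r addr0.
  have d0 : differentiable f x by rewrite -[x]addr0; case: (H 0); rewrite ?N10.
  apply: cauchy_n1 (is_derive_slice_eq j x0 d0) => z h1 h2.
    have [df _] := H _ (small z h1 h2).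
    by apply/derivable1_diffP; have [] := is_derive_slice j df.
  have [_ hM] := H _ (small z h1 h2).
  exact: le_trans (n1_le_N1 _ _) hM.
have -> : N1 ('d f x v) = s^-1 * N1 ('d f x (s%:C%C *: v)).
  by rewrite (clinZ (clin_d _ _)) N1Z ger0_norm ?(ltW s0)// mulrA mulVf ?mul1r// gt_eqF.
apply: (@le_trans _ _ (s^-1 * (m%:R * (16 * M)))).
  by rewrite ler_wpM2l// invr_ge0 ltW.
have -> : s^-1 * (m%:R * (16 * M)) = (64 * m%:R) * M / rho * N1 v.
  by rewrite /s; field; rewrite !gt_eqF.
rewrite -subr_ge0 (_ : _ - _ = M / rho * N1 v); last by field; rewrite gt_eqF.
by rewrite mulr_ge0 ?N1_ge0// divr_ge0// ltW.
Qed.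

Lemma holb_lip n m : exists2 K : R, 0 < K & forall (f : 'rV[C]_n -> 'rV[C]_m) (x : 'rV[C]_n) (rho M : R),
  0 < rho -> 0 <= M -> holb f x rho M -> forall w : 'rV[C]_n, N1 w < rho / 2 ->
  N1 (f (x + w) - f x) <= K * M / rho * N1 w.
Proof.
have [K K0 HK] := diff_bound n m; exists ((2 * m%:R + 1) * (2 * K)).
  by rewrite !mulr_gt0// ltr_wpDl// mulr_ge0.
move=> f x rho M rho0 M0 H w hw.
have r2 : 0 < rho / 2 by exact: divr_gt0.
have B0 : 0 <= K * M / (rho / 2) * N1 w.
  by rewrite !mulr_ge0 ?invr_ge0 ?N1_ge0// ltW.
have := @vec_mvt n m f x w 0 (K * M / (rho / 2) * N1 w).
rewrite subr0 => F; apply: (le_trans (F _)).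
  move=> t /andP[t0 t1]; rewrite subr0.
  have tw : N1 (t%:C%C *: w) <= N1 w by rewrite N1Z ger0_norm// ler_piMl// N1_ge0.
  split; first by case: (H (t%:C%C *: w)) => //; lra.
  have df : differentiable f (x + t%:C%C *: w) by case: (H (t%:C%C *: w)) => //; lra.
  have hb : holb f (x + t%:C%C *: w) (rho / 2) M by apply: holb_sub H; lra.
  exact: (HK f _ _ _ r2 M0 hb ('d f (x + t%:C%C *: w)) (eps_diff_d df) w).
have -> : (2 * m%:R + 1) * (2 * K) * M / rho * N1 w = (2 * m%:R + 1) * (K * M / (rho / 2) * N1 w).
  by field; rewrite gt_eqF.
by rewrite ler_wpM2r// lerDl.
Qed.

(** The Cauchy estimate for the increment [f (y + w) - f y], which [holb_lip] bounds by a multiple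
    of [N1 w]: the differential is Lipschitz although nothing was assumed about its continuity. *)
Lemma holb_diff_lip n m : exists2 K : R, 0 < K & forall (f : 'rV[C]_n -> 'rV[C]_m) (x : 'rV[C]_n) (rho M : R),
  0 < rho -> 0 <= M -> holb f x rho M -> forall w L L', N1 w < rho / 4 ->
  eps_diff f x L -> eps_diff f (x + w) L' -> forall v,
  N1 (L' v - L v) <= K * M / rho ^+ 2 * N1 w * N1 v.
Proof.
have [K K0 HK] := diff_bound n m; have [K' K'0 HK'] := holb_lip n m.
exists (8 * K * K'); first by rewrite !mulr_gt0.
move=> f x rho M rho0 M0 H w L L' hw hL hL' v.
have r4 : 0 < rho / 4 by exact: divr_gt0.
have r2 : 0 < rho / 2 by exact: divr_gt0.
pose M' := K' * M / (rho / 2) * N1 w.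
have M'0 : 0 <= M' by rewrite !mulr_ge0 ?invr_ge0 ?N1_ge0// ltW.
have H' : holb (fun y => f (y + w) - f y) x (rho / 4) M'.
  move=> u hu; split.
    have h1 : differentiable f (x + u) by case: (H u) => //; lra.
    have h2 : differentiable f (x + u + w).
      rewrite -addrA; case: (H (u + w)) => //; rewrite (le_lt_trans (N1D _ _))//; lra.
    by case: (eps_diffI (eps_increment (eps_diff_d h1) (eps_diff_d h2))).
  by apply: HK' => //; [apply: holb_sub H; lra | lra].
apply: (le_trans (HK _ _ _ _ r4 M'0 H' _ (eps_increment hL hL') v)).
rewrite le_eqVlt; apply/orP; left; apply/eqP; rewrite /M'.
by field; rewrite gt_eqF.
Qed.

Lemma holb_taylor n m : exists2 K : R, 0 < K & forall (f : 'rV[C]_n -> 'rV[C]_m) (x : 'rV[C]_n) (rho M : R),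
  0 < rho -> 0 <= M -> holb f x rho M -> forall w L, N1 w < rho / 4 -> eps_diff f x L ->
  N1 (f (x + w) - f x - L w) <= K * M / rho ^+ 2 * N1 w ^+ 2.
Proof.
have [K K0 HK] := holb_diff_lip n m.
exists ((2 * m%:R + 1) * K); first by rewrite mulr_gt0// ltr_wpDl// mulr_ge0.
move=> f x rho M rho0 M0 H w L hw hL.
have B0 : 0 <= K * M / rho ^+ 2 * N1 w * N1 w.
  by rewrite !mulr_ge0 ?invr_ge0 ?N1_ge0 ?exprn_ge0// ltW.
apply: (le_trans (@vec_mvt n m f x w (L w) (K * M / rho ^+ 2 * N1 w * N1 w) _)).
  move=> t /andP[t0 t1].
  have tw : N1 (t%:C%C *: w) <= N1 w by rewrite N1Z ger0_norm// ler_piMl// N1_ge0.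
  have df : differentiable f (x + t%:C%C *: w) by case: (H (t%:C%C *: w)) => //; lra.
  split => //.
  have twr : N1 (t%:C%C *: w) < rho / 4 by lra.
  apply: (le_trans (HK f _ _ _ rho0 M0 H _ L ('d f (x + t%:C%C *: w)) twr hL (eps_diff_d df) w)).
  rewrite ler_wpM2r ?N1_ge0// ler_wpM2l// !mulr_ge0 ?invr_ge0 ?exprn_ge0// ltW//.
rewrite -subr_ge0 (_ : _ - _ = K * M / rho ^+ 2 * N1 w * N1 w)//.
by field; rewrite gt_eqF.
Qed.

(** Each [phi s + K * s] is an upper bound of all the [phi t - K * t], so the supremum of the latter
    is the limit, with the rate built in. *)
Lemma cauchy_at0 (phi : R -> R) (tau K : R) : 0 < tau -> 0 <= K ->
  (forall s t, 0 < s < tau -> 0 < t < tau -> `|phi s - phi t| <= K * (s + t)) ->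
  exists l, forall t, 0 < t < tau -> `|phi t - l| <= K * t.
Proof.
move=> tau0 K0 H; pose A := [set phi t - K * t | t in [set t | 0 < t < tau]].
have h2 : 0 < tau / 2 < tau by lra.
have ub s : 0 < s < tau -> ubound A (phi s + K * s).
  move=> hs _ [t ht <-]; have := H s t hs ht; rewrite ler_norml => /andP[h _]; lra.
exists (sup A) => t ht; rewrite ler_norml; apply/andP; split.
  have : sup A <= phi t + K * t by apply: ge_sup (ub t ht); exists (phi (tau / 2) - K * (tau / 2)), (tau / 2).
  by lra.
have : phi t - K * t <= sup A by apply: ub_le_sup; [exists (phi t + K * t); exact: ub|exists t].
by lra.
Qed.

Lemma small_le0 (a K tau : R) : 0 < tau -> (forall t, 0 < t < tau -> a <= K * t) -> a <= 0.
Proof.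
move=> tau0 H; rewrite leNgt; apply/negP => a0.
have K0 : 0 < `|K| + 1 by rewrite ltr_wpDl.
pose t := Num.min (tau / 2) (a / (2 * (`|K| + 1))).
have t0 : 0 < t by rewrite lt_min !divr_gt0// mulr_gt0.
have ttau : t < tau by rewrite gt_min; apply/orP; left; lra.
have ta : t <= a / (2 * (`|K| + 1)) by rewrite ge_min lexx orbT.
have := H t; rewrite t0 ttau => /(_ isT).
rewrite leNgt => /negP; apply.
apply: (@le_lt_trans _ _ ((`|K| + 1) * (a / (2 * (`|K| + 1))))).
  apply: (@le_trans _ _ ((`|K| + 1) * t)); last by rewrite ler_wpM2l// ltW.
  by rewrite ler_wpM2r ?(ltW t0)// (le_trans (ler_norm K))// lerDl.
have -> : (`|K| + 1) * (a / (2 * (`|K| + 1))) = a / 2 by field; rewrite gt_eqF.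
lra.
Qed.

(* By Taylor, two difference quotients [F t y = (f (y + t v) - f y) / t] and [F s] differ by
   O(s + t), hence so do their differentials by the Cauchy estimate: these converge as
   t -> 0, and their limit is the differential of [Df ^~ v]. *)
Lemma eps_diff_diff n m (f : 'rV[C]_n -> 'rV[C]_m) (Df : 'rV[C]_n -> 'rV[C]_n -> 'rV[C]_m)
    (x v : 'rV[C]_n) (rho M : R) : 0 < rho -> 0 <= M -> holb f x rho M ->
  (forall w, N1 w < rho -> eps_diff f (x + w) (Df (x + w))) ->
  exists2 L, eps_diff (Df ^~ v) x L & exists2 tau : R, 0 < tau & forall u, exists K,
    forall t, 0 < t < tau -> N1 (t^-1%:C%C *: (Df (x + t%:C%C *: v) u - Df x u) - L u) <= K * t.
Proof.
move=> rho0 M0 H HD.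
have [KA KA0 HA] := diff_bound n m; have [KT KT0 HT] := holb_taylor n m.
have nu0 : 0 < N1 v + 1 by rewrite ltr_wpDl ?N1_ge0.
(* The shift by [t v] then has norm below [rho / 8]: it keeps the half ball inside the ball, and it
   is within the range of [holb_taylor] at radius [rho / 2]. *)
pose tau := rho / (8 * (N1 v + 1)).
have tau0 : 0 < tau by rewrite divr_gt0// mulr_gt0.
have r2 : 0 < rho / 2 by exact: divr_gt0.
have tv (t : R) : 0 < t < tau -> N1 (t%:C%C *: v) < rho / 8.
  move=> /andP[t0 tt]; rewrite N1Z gtr0_norm//.
  rewrite /tau ltr_pdivlMr ?mulr_gt0// in tt.
  have : t * N1 v <= t * (N1 v + 1) by rewrite ler_pM2l// lerDl.
  lra.
have D0 : eps_diff f x (Df x) by rewrite -[x]addr0; apply: HD; rewrite N10.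
pose F (t : R) y := t^-1%:C%C *: (f (y + t%:C%C *: v) - f y).
pose DF (t : R) y u := t^-1%:C%C *: (Df (y + t%:C%C *: v) u - Df y u).
have dF t w : 0 < t < tau -> N1 w < rho / 2 -> eps_diff (F t) (x + w) (DF t (x + w)).
  move=> ht hw; apply: eps_diffZ; apply: eps_increment; first by apply: HD; lra.
  rewrite -(addrA x); apply: HD; have := tv t ht; have := N1D w (t%:C%C *: v); lra.
have hb w : N1 w < rho / 2 -> holb f (x + w) (rho / 2) M.
  by move=> hw; apply: holb_sub H; lra.
pose c1 := KT * M / (rho / 2) ^+ 2 * N1 v ^+ 2.
have c10 : 0 <= c1 by rewrite !mulr_ge0 ?invr_ge0 ?exprn_ge0 ?N1_ge0 ?(ltW KT0) ?(ltW r2).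
have F1 (t : R) w : 0 < t < tau -> N1 w < rho / 2 -> N1 (F t (x + w) - Df (x + w) v) <= c1 * t.
  move=> ht hw; have /andP[t0 _] := ht.
  have hDw : eps_diff f (x + w) (Df (x + w)) by apply: HD; lra.
  have ht4 : N1 (t%:C%C *: v) < rho / 2 / 4 by have := tv t ht; lra.
  have := HT f _ _ _ r2 M0 (hb w hw) _ _ ht4 hDw.
  rewrite (clinZ hDw.1); set W := N1 _ => hW.
  have -> : F t (x + w) - Df (x + w) v =
      t^-1%:C%C *: (f (x + w + t%:C%C *: v) - f (x + w) - t%:C%C *: Df (x + w) v).
    rewrite /F [RHS]scalerBr scalerA -rmorphM mulVf ?gt_eqF// scale1r//.
  rewrite N1Z gtr0_norm ?invr_gt0// ler_pdivrMl// (le_trans hW)// N1Z gtr0_norm//.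
  by rewrite /c1 le_eqVlt; apply/orP; left; apply/eqP; ring.
pose c2 := KA * M / (rho / 2) * N1 v + c1 * tau.
have c20 : 0 <= c2.
  apply: addr_ge0; last exact: mulr_ge0 c10 (ltW tau0).
  by rewrite !mulr_ge0 ?invr_ge0 ?N1_ge0 ?(ltW KA0) ?(ltW r2).
have F2 t w : 0 < t < tau -> N1 w < rho / 2 -> N1 (F t (x + w)) <= c2.
  move=> ht hw; have hDw : eps_diff f (x + w) (Df (x + w)) by apply: HD; lra.
  have h1 := HA f _ _ _ r2 M0 (hb w hw) _ hDw v; have h2 := F1 t w ht hw.
  rewrite -[F t _](subrK (Df (x + w) v)) (le_trans (N1D _ _))// addrC lerD//.
  rewrite (le_trans h2)// ler_wpM2l//; by case/andP: ht => _ /ltW.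
pose c4 := KA * c1 / (rho / 2).
have c40 : 0 <= c4 := divr_ge0 (mulr_ge0 (ltW KA0) c10) (ltW r2).
have F5 s t u : 0 < s < tau -> 0 < t < tau -> N1 (DF s x u - DF t x u) <= c4 * (s + t) * N1 u.
  move=> hs ht.
  have b0 : 0 <= c1 * (s + t) by rewrite mulr_ge0//; case/andP: hs; case/andP: ht => *; lra.
  have hst : holb (fun y => F s y - F t y) x (rho / 2) (c1 * (s + t)).
    move=> w hw; split; first by case: (eps_diffI (eps_diffB (dF s w hs hw) (dF t w ht hw))).
    have h1 := F1 s w hs hw; have h2 := F1 t w ht hw.
    rewrite -(subrKA (Df (x + w) v)) (le_trans (N1D _ _))//.
    by rewrite [N1 (Df _ _ - _)]N1BC mulrDr lerD.
  have hd : eps_diff (fun y => F s y - F t y) x (fun u => DF s x u - DF t x u).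
    by apply: eps_diffB; rewrite -[x]addr0; apply: dF; rewrite ?N10.
  apply: (le_trans (HA _ _ _ _ r2 b0 hst _ hd u)).
  by rewrite /c4 le_eqVlt; apply/orP; left; apply/eqP; ring.
have /choice[l Hl] : forall uc : 'rV[C]_n * ('I_m * bool), exists l, forall t, 0 < t < tau ->
    `|rc uc.2 (DF t x uc.1) - l| <= c4 * N1 uc.1 * t.
  move=> [u c]; apply: (cauchy_at0 tau0) => /=; first by rewrite mulr_ge0// N1_ge0.
  move=> s t hs ht; rewrite -rcB (le_trans (rc_le_N1 _ _))// (le_trans (F5 s t u hs ht))//.
  by rewrite mulrAC.
pose L u := \sum_c (l (u, c))%:C%C *: rb R c.
have rcL u c : rc c (L u) = l (u, c).
  rewrite /L rc_sum (bigD1 c)//= rcZ rc_rb eqxx mulr1 big1 ?addr0// => d dc.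
  by rewrite rcZ rc_rb eq_sym (negbTE dc) mulr0.
have FL t u : 0 < t < tau -> N1 (DF t x u - L u) <= (2 * m%:R * (c4 * N1 u)) * t.
  move=> ht; rewrite -mulrA; apply: N1_sum_le => c.
  by rewrite rcB rcL; exact: (Hl (u, c) t ht).
have cDF t : 0 < t < tau -> clin (DF t x).
  by move=> ht; have [] := dF t 0 ht; rewrite ?N10 ?addr0.
(* Linearity passes to the limit: the defect of [L] does not involve [t] and is O(t). *)
have cL : clin L.
  move=> a u w; apply/eqP; rewrite -subr_eq0; apply/eqP/N1_eq0.
  pose b z := 2 * m%:R * (c4 * N1 (z : 'rV[C]_n)).
  apply: (@small_le0 _ (b (a *: u + w) + n1 a * b u + b w) tau tau0) => t ht.
  have h1 := FL t (a *: u + w) ht; have h2 := FL t u ht; have h3 := FL t w ht.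
  have -> : L (a *: u + w) - (a *: L u + L w) =
    - (DF t x (a *: u + w) - L (a *: u + w)) + a *: (DF t x u - L u) + (DF t x w - L w).
    rewrite (cDF t ht) scalerBr; apply: rc_inj => c; rewrite !(rcD, rcN); ring.
  have -> : (b (a *: u + w) + n1 a * b u + b w) * t =
    b (a *: u + w) * t + n1 a * (b u * t) + b w * t by ring.
  rewrite (le_trans (N1D _ _))// lerD// (le_trans (N1D _ _))// lerD//; first by rewrite N1N.
  rewrite (le_trans (N1_mulC _ _))//.
  exact: (ler_wpM2l (n1_ge0 a) h2).
exists L; last first.
  by exists tau => // u; exists (2 * m%:R * (c4 * N1 u)) => t ht; exact: FL.
split => // e e0.
pose c3 := KT * c2 / (rho / 2) ^+ 2.
have c30 : 0 <= c3 := divr_ge0 (mulr_ge0 (ltW KT0) c20) (exprn_ge0 2 (ltW r2)).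
(* The quotients [F t] have the common bound [c2], so their Taylor estimate is uniform in [t];
   letting [t] tend to 0 transfers it to [Df ^~ v]. *)
have quad w : N1 w < rho / 8 -> N1 (Df (x + w) v - Df x v - L w) <= c3 * N1 w ^+ 2.
  move=> hw; rewrite -subr_le0.
  apply: (@small_le0 _ (c1 + c1 + 2 * m%:R * (c4 * N1 w)) tau tau0) => t ht.
  have h1 := F1 t w ht (_ : N1 w < rho / 2).
  have h2 : N1 (F t x - Df x v) <= c1 * t by rewrite -[x]addr0; apply: F1; rewrite ?N10.
  have h3 := FL t w ht.
  have hFt : holb (F t) x (rho / 2) c2.
    by move=> y hy; split; [case: (eps_diffI (dF t y ht hy))|exact: F2].
  have d0 : eps_diff (F t) x (DF t x) by rewrite -[x]addr0; apply: dF; rewrite ?N10.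
  have h4 := HT _ _ _ _ r2 c20 hFt w _ (_ : N1 w < rho / 2 / 4) d0.
  rewrite lerBlDr.
  have -> : Df (x + w) v - Df x v - L w = - (F t (x + w) - Df (x + w) v) + (F t x - Df x v) +
     (DF t x w - L w) + (F t (x + w) - F t x - DF t x w).
    apply: rc_inj => c; rewrite !(rcD, rcN); ring.
  have {}h4 : N1 (F t (x + w) - F t x - DF t x w) <= c3 * N1 w ^+ 2 by apply: h4; lra.
  have {}h1 : N1 (F t (x + w) - Df (x + w) v) <= c1 * t by apply: h1; lra.
  set a1 := F t (x + w) - Df (x + w) v in h1 *; set a2 := F t x - Df x v in h2 *.
  set a3 := DF t x w - L w in h3 *; set a4 := F t (x + w) - F t x - DF t x w in h4 *.
  have k1 := N1D (- a1 + a2 + a3) a4; have k2 := N1D (- a1 + a2) a3; have k3 := N1D (- a1) a2.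
  rewrite N1N in k3; rewrite (le_trans k1)//.
  rewrite lerD// (le_trans k2)// mulrDl lerD// (le_trans k3)// mulrDl lerD//.
have e3 : 0 < c3 + 1 by rewrite ltr_wpDl.
exists (Num.min (rho / 8) (e / (c3 + 1))); first by rewrite lt_min !divr_gt0.
move=> w; rewrite lt_min => /andP[w1 w2]; apply: (le_trans (quad w w1)).
rewrite expr2 mulrA ler_wpM2r ?N1_ge0//.
rewrite ltr_pdivlMr// in w2.
have : c3 * N1 w <= N1 w * (c3 + 1) by rewrite mulrDr mulr1 [c3 * _]mulrC lerDl N1_ge0.
lra.
Qed.

(** Continuity at [x] supplies the local bound for [f]. Symmetry: the quotients of [Df _ u] along
    [v] tend to [L u] by the last clause of [eps_diff_diff], and to the differential of [Df ^~ u] at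
    [v] by differentiability. *)
Lemma diff_diff n m (f : 'rV[C]_n -> 'rV[C]_m) (x : 'rV[C]_n) :
  (\forall y \near x, differentiable f y) -> forall v,
  differentiable (fun y => 'd f y v) x /\
  forall u, 'd (fun y => 'd f y v) x u = 'd (fun y => 'd f y u) x v.
Proof.
move=> /nearN1[r r0 Hr].
have fx : {for x, continuous f}.
  by apply: differentiable_continuous; apply: Hr; rewrite subrr N10.
have : \forall y \near x, N1 (f y - f x) < 1.
  by apply: (fx [set z | N1 (z - f x) < 1]); apply/nbhs_N1; exists 1.
move=> /nearN1[r' r'0 Hr'].
pose rho := Num.min r r'; have rho0 : 0 < rho by rewrite lt_min r0.
have M0 : 0 <= N1 (f x) + 1 by rewrite addr_ge0 ?N1_ge0.
have sub (w : 'rV[C]_n) : N1 w < rho -> N1 (x + w - x) < r /\ N1 (x + w - x) < r'.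
  by rewrite lt_min addrAC subrr add0r => /andP[].
have hb : holb f x rho (N1 (f x) + 1).
  move=> w /sub[h1 h2]; split; first exact: Hr.
  by rewrite -[f (x + w)](subrK (f x)) (le_trans (N1D _ _))// addrC lerD2l ltW// Hr'.
have hD w : N1 w < rho -> eps_diff f (x + w) ('d f (x + w)).
  by move=> /sub[h1 _]; apply: eps_diff_d; exact: Hr.
have dd v := @eps_diff_diff n m f (fun y u => 'd f y u) x v rho _ rho0 M0 hb hD.
move=> v; have [L hL [tau tau0 Htau]] := dd v.
have [h1 E1] := eps_diffI hL; split; first exact: h1.
move=> u; have [L' hL' _] := dd u; have [_ E2] := eps_diffI hL'.
transitivity (L u); first exact: (congr1 (fun g => g u) E1).
transitivity (L' v); last exact: esym (congr1 (fun g => g v) E2).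
apply/eqP; rewrite -subr_eq0; apply/eqP/N1_eq0/ler_addgt0Pr => e e0; rewrite add0r.
have [K HK] := Htau u.
have v0 : 0 < N1 v + 1 by rewrite ltr_wpDl ?N1_ge0.
have [d d0 Hd] := hL'.2 _ (divr_gt0 e0 v0).
rewrite -subr_le0; pose sig := Num.min tau (d / (N1 v + 1)).
have sig0 : 0 < sig by rewrite lt_min tau0 divr_gt0.
apply: (@small_le0 _ K sig sig0) => t /andP[t0]; rewrite lt_min => /andP[t1 t2].
have := HK t; rewrite t0 t1 => /(_ isT) k1.
have tv : N1 (t%:C%C *: v) <= t * (N1 v + 1) by rewrite N1Z gtr0_norm// ler_pM2l// lerDl.
have k2 := Hd (t%:C%C *: v) (le_lt_trans tv _).
rewrite lerBlDr.
set q := t^-1%:C%C *: _ in k1.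
rewrite -(subrKA q) (le_trans (N1D _ _))// lerD//; first by rewrite N1BC.
have -> : q - L' v = t^-1%:C%C *: ('d f (x + t%:C%C *: v) u - 'd f x u - L' (t%:C%C *: v)).
  by rewrite /q [RHS]scalerBr (clinZ hL'.1) scalerA -rmorphM mulVf ?gt_eqF// scale1r.
rewrite N1Z gtr0_norm ?invr_gt0// ler_pdivrMl//.
apply: (le_trans (k2 _)); first by rewrite -ltr_pdivlMr.
apply: (le_trans (ler_wpM2l _ tv)); first by rewrite divr_ge0// ltW.
by rewrite [t * (_ + _)]mulrC mulrA divfK ?gt_eqF// mulrC.
Qed.

End Holomorphic.

(** * Calculus of C^k functions *)

Section SmoothCalculus.
Variable R : realType.
Local Notation C := R[i].

Lemma contR_eps n (f : 'rV[C]_n -> R) (x : 'rV[C]_n) : {for x, continuous f} <->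
  forall e : R, 0 < e -> exists2 d : R, 0 < d & forall y, N1 (y - x) < d -> `|f y - f x| < e.
Proof.
split.
  move=> cf e e0; have : \forall y \near x, `|f y - f x| < e.
    apply: (cf [set z | `|z - f x| < e]); apply/nbhs_ballP; exists e => //= z.
    by rewrite /ball /= distrC.
  by move=> /nearN1.
move=> H A /nbhs_ballP[e /= e0 hA]; have [d d0 Hd] := H e e0.
by apply/nbhs_N1; exists d => // y hy; apply: hA; rewrite /ball /= distrC Hd.
Qed.

Lemma open_N1 n (U : set 'rV[C]_n) x : open U -> U x ->
  exists2 d : R, 0 < d & forall y, N1 (y - x) < d -> U y.
Proof. by move=> oU Ux; apply/nbhs_N1; exact: open_nbhs_nbhs. Qed.

Lemma rderiveP n (f : 'rV[C]_n -> R) v x (d : R) :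
  is_derive (0 : R) 1 (fun t : R => f (x + t%:C%C *: v)) d <-> rderivable f v x /\ rderive f v x = d.
Proof.
split; first by move=> [h1 h2]; rewrite /rderive derive1E.
by move=> [h1 h2]; apply: (DeriveDef h1); rewrite -derive1E.
Qed.

Lemma line_derive n (f : 'rV[C]_n -> R) v x (s d : R) :
  is_derive (0 : R) 1 (fun t : R => f (x + s%:C%C *: v + t%:C%C *: v)) d ->
  is_derive s 1 (fun t : R => f (x + t%:C%C *: v)) d.
Proof.
move=> H; apply: is_deriveR_I => e e0; have [r r0 Hr] := is_deriveR_E H e0.
have x0 : x + s%:C%C *: v + (0 : R)%:C%C *: v = x + s%:C%C *: v by rewrite scale0r addr0.
exists r; first exact: r0.
move=> h hh; move: (Hr h hh).
have E1 : x + s%:C%C *: v + (0 + h)%:C%C *: v = x + (s + h)%:C%C *: v.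
  by rewrite add0r -addrA -scalerDl -rmorphD.
rewrite E1.
by rewrite x0.
Qed.

Lemma line_scale n (f : 'rV[C]_n -> R) v x (a d : R) :
  is_derive (0 : R) 1 (fun t : R => f (x + t%:C%C *: v)) d ->
  is_derive (0 : R) 1 (fun t : R => f (x + t%:C%C *: (a%:C%C *: v))) (a * d).
Proof.
move=> H.
have -> : (fun t : R => f (x + t%:C%C *: (a%:C%C *: v))) =
    (fun t : R => f (x + t%:C%C *: v)) \o (fun t => t * a).
  by apply/funext => t /=; rewrite scalerA -rmorphM.
rewrite mulrC; apply: is_derive1_comp; first by rewrite mul0r.
apply: is_deriveR_I => e e0; exists 1 => // h _.
by rewrite (_ : _ - _ = 0) ?normr0 ?mulr_ge0// ?ltW//; ring.
Qed.

Lemma rderive_near n (f g : 'rV[C]_n -> R) (U : set 'rV[C]_n) v x : open U -> U x ->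
  (forall y, U y -> f y = g y) -> rderivable f v x -> rderivable g v x /\ rderive g v x = rderive f v x.
Proof.
move=> oU Ux fg df; apply/rderiveP.
have /is_deriveR_E H : is_derive (0 : R) 1 (fun t : R => f (x + t%:C%C *: v)) (rderive f v x).
  by apply/rderiveP.
have [d d0 Hd] := open_N1 oU Ux; apply: is_deriveR_I => e e0; have [r r0 Hr] := H e e0.
have v0 : 0 < N1 v + 1 by rewrite ltr_wpDl ?N1_ge0.
exists (Num.min r (d / (N1 v + 1))); first by rewrite lt_min r0 divr_gt0.
move=> h; rewrite lt_min => /andP[h1]; rewrite ltr_pdivlMr// => h2.
rewrite -!fg; first exact: Hr.
  by rewrite scale0r addr0.
apply: Hd; rewrite addrAC subrr !add0r N1Z (le_lt_trans _ h2)//.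
by rewrite ler_wpM2l// lerDl.
Qed.

(* [Ck_on] with the continuity of all the intermediate derivatives built in, so that
   [CK k.+1] implies [CK k]. *)
Fixpoint CK n (k : nat) (U : set 'rV[C]_n) (f : 'rV[C]_n -> R) : Prop :=
  (forall x, U x -> {for x, continuous f}) /\
  if k is k'.+1 then forall v, (forall x, U x -> rderivable f v x) /\ CK k' U (rderive f v)
  else True.

Section CK.
Variables (n : nat) (U : set 'rV[C]_n).
Hypothesis oU : open U.
Implicit Types f g : 'rV[C]_n -> R.

Lemma CK_cont k f : CK k U f -> forall x, U x -> {for x, continuous f}.
Proof. by case: k => [|k] []. Qed.

Lemma CK_S k f : CK k.+1 U f -> forall v x, U x ->
  is_derive (0 : R) 1 (fun t : R => f (x + t%:C%C *: v)) (rderive f v x).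
Proof. by move=> [_ H] v x Ux; apply/rderiveP; split => //; apply: (H v).1. Qed.

Lemma CK_eq k f g : (forall x, U x -> f x = g x) -> CK k U f -> CK k U g.
Proof.
elim: k f g => [|k IH] f g fg [cf Hf].
- split=> // x Ux; have [d d0 Hd] := open_N1 oU Ux.
  have /contR_eps H := cf x Ux; apply/contR_eps => e e0; have [r r0 Hr] := H e e0.
  exists (Num.min d r); first by rewrite lt_min d0.
  move=> y; rewrite lt_min => /andP[y1 y2]; rewrite -!fg//; [exact: Hr|exact: Hd].
split.
  move=> x Ux; have [d d0 Hd] := open_N1 oU Ux.
  have /contR_eps H := cf x Ux; apply/contR_eps => e e0; have [r r0 Hr] := H e e0.
  exists (Num.min d r); first by rewrite lt_min d0.
  move=> y; rewrite lt_min => /andP[y1 y2]; rewrite -!fg//; [exact: Hr|exact: Hd].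
move=> v; have [H1 H2] := Hf v; split.
  by move=> x Ux; case: (rderive_near oU Ux fg (H1 x Ux)).
apply: (IH (rderive f v)) => // x Ux.
by case: (rderive_near oU Ux fg (H1 x Ux)) => _ ->.
Qed.

Lemma CK_intro k f : (forall x, U x -> {for x, continuous f}) ->
  (forall v, exists2 g, CK k U g & forall x, U x ->
     is_derive (0 : R) 1 (fun t : R => f (x + t%:C%C *: v)) (g x)) -> CK k.+1 U f.
Proof.
move=> cf H; split => // v; have [g hg Hg] := H v; split.
  by move=> x /Hg/rderiveP[].
by apply: CK_eq hg => x /Hg/rderiveP[].
Qed.

Lemma CK_lower k f : CK k.+1 U f -> CK k U f.
Proof.
elim: k f => [|k IH] f [cf Hf]; first by split.
by split => // v; have [h1 h2] := Hf v; split => //; exact: IH.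
Qed.

Lemma CK_S1 k f : CK k.+1 U f -> CK 1 U f.
Proof. by elim: k => // k IH /CK_lower. Qed.

Lemma smooth_onP f : smooth_on U f <-> forall k, CK k U f.
Proof.
split.
  move=> sf k; elim: k f sf => [|k IH] f sf; first by split => //; exact: (sf 0%N).
  split; first exact: (sf 0%N).
  move=> v; split; first by case: (sf 1%N v).
  by apply: IH => j; case: (sf j.+1 v).
move=> Hf k; have := Hf k; clear Hf; elim: k f => [|k IH] f [cf Hf] //.
by move=> v; have [h1 h2] := Hf v; split => //; exact: IH.
Qed.

Lemma CK_cst k (a : R) : CK k U (fun=> a).
Proof.
elim: k a => [|k IH] a; first by split => // x _; exact: cst_continuous.
apply: CK_intro; first by move=> x _; exact: cst_continuous.
by move=> v; exists (fun=> 0) => // x _; exact: is_derive_cst.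
Qed.

Lemma CK_add k f g : CK k U f -> CK k U g -> CK k U (fun x => f x + g x).
Proof.
elim: k f g => [|k IH] f g hf hg.
  by split => // x Ux; exact: cvgD (CK_cont hf Ux) (CK_cont hg Ux).
apply: CK_intro.
  by move=> x Ux; exact: cvgD (CK_cont hf Ux) (CK_cont hg Ux).
move=> v; exists (fun x => rderive f v x + rderive g v x).
  by apply: IH; [case: (hf.2 v)|case: (hg.2 v)].
by move=> x Ux; exact: is_deriveD (CK_S hf v Ux) (CK_S hg v Ux).
Qed.

Lemma CK_mul k f g : CK k U f -> CK k U g -> CK k U (fun x => f x * g x).
Proof.
elim: k f g => [|k IH] f g hf hg.
  by split => // x Ux; exact: cvgM (CK_cont hf Ux) (CK_cont hg Ux).
apply: CK_intro.
  by move=> x Ux; exact: cvgM (CK_cont hf Ux) (CK_cont hg Ux).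
move=> v; exists (fun x => f x * rderive g v x + g x * rderive f v x).
  by apply: CK_add; apply: IH; solve [exact: CK_lower | case: (hf.2 v) => // | case: (hg.2 v) => //].
move=> x Ux; have := is_deriveM (CK_S hf v Ux) (CK_S hg v Ux).
by rewrite scale0r addr0.
Qed.

Lemma CK_sum k I (r : seq I) (F : I -> 'rV[C]_n -> R) : (forall i, CK k U (F i)) ->
  CK k U (fun x => \sum_(i <- r) F i x).
Proof.
move=> H; elim: r => [|i r IH].
  by apply: CK_eq (CK_cst k 0) => x _; rewrite big_nil.
by apply: CK_eq (CK_add (H i) IH) => x _; rewrite big_cons.
Qed.

Lemma CK_opp k f : CK k U f -> CK k U (fun x => - f x).
Proof. by move=> h; apply: CK_eq (CK_mul (CK_cst k (-1)) h) => x _; rewrite mulN1r. Qed.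

End CK.

Lemma CK_subset n k (U V : set 'rV[C]_n) f : V `<=` U -> CK k U f -> CK k V f.
Proof.
move=> VU; elim: k f => [|k IH] f [cf Hf]; first by split => // x /VU; exact: cf.
split; first by move=> x /VU; exact: cf.
by move=> v; have [h1 h2] := Hf v; split; [move=> x /VU; exact: h1|exact: IH].
Qed.

Lemma CK_local n k (U : set 'rV[C]_n) f :
  (forall x, U x -> exists2 V : set 'rV[C]_n, V x & CK k V f) -> CK k U f.
Proof.
elim: k f => [|k IH] f H.
  by split => // x /H[V Vx hV]; exact: CK_cont hV x Vx.
split; first by move=> x /H[V Vx hV]; exact: CK_cont hV x Vx.
move=> v; split; first by move=> x /H[V Vx [_ hV]]; exact: (hV v).1.
by apply: IH => x /H[V Vx [_ hV]]; exists V => //; exact: (hV v).2.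
Qed.

Lemma N1_rb n (c : 'I_n * bool) : N1 (rb R c) = 1.
Proof.
rewrite /N1 (bigD1 c)//= rc_rb eqxx normr1 big1 ?addr0// => d dc.
by rewrite rc_rb (negbTE dc) normr0.
Qed.

(** From continuous directional derivatives to a total differential: the increment is split into
    steps along the real coordinate axes, with one mean value point per step. *)
Lemma frechet n (U : set 'rV[C]_n) (f : 'rV[C]_n -> R) (x : 'rV[C]_n) : open U -> CK 1 U f -> U x ->
  forall e : R, 0 < e -> exists2 d : R, 0 < d & forall h, N1 h < d ->
   `|f (x + h) - f x - \sum_c rc c h * rderive f (rb R c) x| <= e * N1 h.
Proof.
move=> oU hf Ux e e0.
have [d0 d00 H0] := open_N1 oU Ux.
have /choice[r Hr] : forall c : 'I_n * bool, exists r : R, 0 < r /\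
   forall y, N1 (y - x) < r -> `|rderive f (rb R c) y - rderive f (rb R c) x| < e.
  move=> c; have [_ hc] := hf.2 (rb R c).
  by have /contR_eps/(_ e e0)[r r0 Hr] := hc.1 x Ux; exists r.
pose d := \big[Num.min/d0]_c r c.
have dd0 : 0 < d by rewrite /d; elim/big_ind: _ => [//|a b ha hb|c _]; [rewrite lt_min ha|case: (Hr c)].
have dle0 : d <= d0 by exact: bigmin_le_id.
have dler c : d <= r c by exact: bigmin_le_cond.
exists d => // h hd.
(* Stated for arbitrary lists of coordinates so that the steps can be added one at a time; the full
   list rebuilds [h] by [rcE]. *)
suff claim (s : seq ('I_n * bool)) : \sum_(c <- s) `|rc c h| < d ->
   `|f (x + \sum_(c <- s) (rc c h)%:C%C *: rb R c) - f x - \sum_(c <- s) rc c h * rderive f (rb R c) x|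
     <= e * \sum_(c <- s) `|rc c h|.
  by have := claim (index_enum _) hd; rewrite -rcE.
elim: s => [|c s IH]; first by rewrite !big_nil addr0 subrr subr0 normr0 mulr0.
rewrite !big_cons => hs; have {IH} := IH (le_lt_trans (ler_wpDl (normr_ge0 _) (lexx _)) hs).
set y := \sum_(j <- s) (rc j h)%:C%C *: _; set S := \sum_(j <- s) `|_|; set T := \sum_(j <- s) _.
have Ny : N1 y <= S.
  rewrite /y /S; elim: (s) => [|j s' IH]; first by rewrite !big_nil N10.
  by rewrite !big_cons (le_trans (N1D _ _))// lerD// N1Z N1_rb mulr1.
set a := rc c h => IH.
have near t : 0 <= t <= 1 -> N1 (x + y + (t * a)%:C%C *: rb R c - x) < d.
  move=> /andP[t0 t1]; rewrite addrAC (addrAC x) subrr add0r (le_lt_trans _ hs)//.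
  rewrite (le_trans (N1D _ _))// addrC lerD// N1Z N1_rb mulr1 normrM ger0_norm//.
  by rewrite ler_piMl.
have [||t ht E] := @mvt R (fun t => f (x + y + t%:C%C *: (a%:C%C *: rb R c)))
   (fun t => a * rderive f (rb R c) (x + y + (t * a)%:C%C *: rb R c)) 0 1; first exact: ler01.
  move=> t ht; apply: line_derive.
  have -> : x + y + t%:C%C *: (a%:C%C *: rb R c) = x + y + (t * a)%:C%C *: rb R c.
    by rewrite scalerA -rmorphM.
  have Uy : U (x + y + (t * a)%:C%C *: rb R c) by apply: H0; exact: lt_le_trans (near t ht) dle0.
  exact: line_scale (CK_S hf (rb R c) Uy).
have z0 : x + y + (0 : R)%:C%C *: (a%:C%C *: rb R c) = x + y by rewrite scale0r addr0.
have z1 : x + y + (1 : R)%:C%C *: (a%:C%C *: rb R c) = x + y + a%:C%C *: rb R c by rewrite scale1r.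
rewrite z0 z1 subr0 mulr1 in E.
have -> : f (x + (a%:C%C *: rb R c + y)) - f x - (a * rderive f (rb R c) x + T) =
  (f (x + y) - f x - T) + a * (rderive f (rb R c) (x + y + (t * a)%:C%C *: rb R c) - rderive f (rb R c) x).
  by rewrite mulrBr -E addrCA addrC addrA; ring.
set D := rderive f (rb R c) _ - _.
have k : `|a * D| <= e * `|a|.
  have kD : `|D| < e := (Hr c).2 _ (lt_le_trans (near t ht) (dler c)).
  by rewrite normrM mulrC; exact: ler_wpM2r (normr_ge0 a) _ _ (ltW kD).
have k' := ler_normD (f (x + y) - f x - T) (a * D).
by apply: (le_trans k'); rewrite (mulrDr e) [leRHS]addrC; exact: lerD IH k.
Qed.

(** Only differentiability at 0 is asked of the curve, so the rule serves for lines as well as for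
    images of lines under a map. *)
Lemma chain_curve n (U : set 'rV[C]_n) (f : 'rV[C]_n -> R) (g : R -> 'rV[C]_n) (dg : 'I_n * bool -> R) :
  open U -> CK 1 U f -> U (g 0) -> (forall c, is_derive (0 : R) 1 (fun t => rc c (g t)) (dg c)) ->
  is_derive (0 : R) 1 (fun t => f (g t)) (\sum_c dg c * rderive f (rb R c) (g 0)).
Proof.
move=> oU hf Ug Hg; apply: is_deriveR_I => e e0.
pose D := \sum_c (`|rderive f (rb R c) (g 0)| + 1); pose K := \sum_c (`|dg c| + 1) + 1.
have D0 : 0 <= D by apply: sumr_ge0 => c _; rewrite addr_ge0.
have K0 : 0 < K by rewrite ltr_wpDl// sumr_ge0// => c _; rewrite addr_ge0.
have e2 : 0 < e / 2 / K by rewrite !divr_gt0.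
have [d d0 Hd] := frechet oU hf Ug e2.
have D1 : 0 < D + 1 by rewrite ltr_wpDl.
pose e1 := Num.min 1 (e / 2 / (D + 1)).
have e10 : 0 < e1 by rewrite lt_min ltr01 !divr_gt0.
have /choice[r Hr] : forall c, exists r : R, 0 < r /\ forall h, `|h| < r ->
    `|rc c (g h) - rc c (g 0) - dg c * h| <= e1 * `|h|.
  move=> c; have [r r0 Hr] := is_deriveR_E (Hg c) e10; exists r; split; first exact: r0.
  by move=> h /Hr; rewrite add0r.
pose rho := \big[Num.min/(d / K)]_c r c.
have rho0 : 0 < rho.
  by rewrite /rho; elim/big_ind: _ => [|a b ha hb|c _]; [exact: divr_gt0|rewrite lt_min ha|case: (Hr c)].
exists rho; first exact: rho0.
move=> h hh; rewrite !add0r; set w := g h - g 0.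
have hc c : `|rc c w - dg c * h| <= e1 * `|h|.
  by rewrite rcB; apply: (Hr c).2; rewrite (lt_le_trans hh)// bigmin_le_cond.
have wK : N1 w <= K * `|h|.
  rewrite /K mulrDl mul1r ler_wpDr// mulr_suml ler_sum// => c _.
  rewrite -[rc c w](subrK (dg c * h)) (le_trans (ler_normD _ _))// addrC mulrDl mul1r.
  rewrite lerD// ?normrM// (le_trans (hc c))// ler_piMl// ge_min lexx//.
have wd : N1 w < d.
  rewrite (le_lt_trans wK)// mulrC -ltr_pdivlMr// (lt_le_trans hh)//; exact: bigmin_le_id.
have := Hd w wd; rewrite {1}/w addrCA subrr addr0.
set S1 := \sum_c _; set S2 := \sum_c _ => h1.
have h2 : `|S1 - S2 * h| <= e1 * `|h| * D.
  rewrite /S1 /S2 mulr_suml -sumrB mulr_sumr (le_trans (ler_norm_sum _ _ _))// ler_sum// => c _.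
  rewrite mulrAC -mulrBl normrM ler_pM// lerDl//.
have h3 : e / 2 / K * N1 w <= e / 2 * `|h|.
  by rewrite -mulrA ler_pM2l ?divr_gt0// ler_pdivrMl.
have h4 : e1 * `|h| * D <= e / 2 * `|h|.
  rewrite mulrAC ler_wpM2r// (@le_trans _ _ (e1 * (D + 1)))//.
    by rewrite ler_wpM2l ?(ltW e10)// lerDl.
  by rewrite -ler_pdivlMr// ge_min lexx orbT.
rewrite -(subrKA S1) (le_trans (ler_normD _ _))//.
lra.
Qed.

(** [rderive] treats each direction separately; its linearity in the direction is a consequence of
    the total differential. *)
Lemma rderiveE n (U : set 'rV[C]_n) (f : 'rV[C]_n -> R) (v x : 'rV[C]_n) : open U -> CK 1 U f -> U x ->
  rderive f v x = \sum_c rc c v * rderive f (rb R c) x.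
Proof.
move=> oU hf Ux; have x0 : x + (0 : R)%:C%C *: v = x by rewrite scale0r addr0.
have Ux0 : U (x + (0 : R)%:C%C *: v) by rewrite x0.
have [|_] := (rderiveP f v x (\sum_c rc c v * rderive f (rb R c) (x + (0 : R)%:C%C *: v))).1.
  apply: (@chain_curve n U f (fun t => x + t%:C%C *: v)) => // c.
  apply: is_deriveR_I => e e0; exists 1 => // h _.
  rewrite !rcD !rcZ (_ : _ - _ = 0) ?normr0 ?mulr_ge0// ?ltW//; ring.
by rewrite x0.
Qed.

Lemma CK_comp n m k (U : set 'rV[C]_n) (V : set 'rV[C]_m) (f : 'rV[C]_m -> R) (g : 'rV[C]_n -> 'rV[C]_m) :
  open U -> open V -> (forall x, U x -> V (g x)) -> CK k V f ->
  (forall j c, CK j U (fun x => rc c (g x))) -> CK k U (fun x => f (g x)).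
Proof.
move=> oU oV UV; elim: k f => [|k IH] f hf hg.
  split => // x Ux; apply/contR_eps => e e0.
  have /contR_eps/(_ e e0)[d d0 Hd] := CK_cont hf (UV _ Ux).
  have m0 : 0 < 2 * m%:R + 1 :> R by rewrite ltr_wpDl// mulr_ge0.
  have /choice[r Hr] : forall c, exists r : R, 0 < r /\ forall y, N1 (y - x) < r ->
      `|rc c (g y) - rc c (g x)| < d / (2 * m%:R + 1).
    move=> c; have /contR_eps/(_ _ (divr_gt0 d0 m0))[r r0 Hr] := CK_cont (hg 0%N c) Ux.
    by exists r.
  exists (\big[Num.min/1]_c r c).
    by elim/big_ind: _ => [//|a b ha hb|c _]; [rewrite lt_min ha|case: (Hr c)].
  move=> y hy; apply: Hd.
  apply: (@le_lt_trans _ _ (2 * m%:R * (d / (2 * m%:R + 1)))).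
    apply: N1_sum_le => c; rewrite rcB ltW//; apply: (Hr c).2.
    by rewrite (lt_le_trans hy)// bigmin_le_cond.
  by rewrite mulrA ltr_pdivrMr// mulrC ltr_pM2l// ltrDl.
apply: CK_intro => //.
  exact: CK_cont (IH f (CK_lower hf) hg).
move=> v; exists (fun x => \sum_c rderive (fun x => rc c (g x)) v x * rderive f (rb R c) (g x)).
  apply: CK_sum => // c; apply: CK_mul => //.
    by case: ((hg k.+1 c).2 v).
  by apply: (IH (rderive f (rb R c))) => //; case: (hf.2 (rb R c)).
move=> x Ux; have x0 : x + (0 : R)%:C%C *: v = x by rewrite scale0r addr0.
have hf1 : CK 1 V f := CK_S1 hf.
have := @chain_curve m V f (fun t : R => g (x + t%:C%C *: v)) (fun c => rderive (fun x => rc c (g x)) v x) oV hf1.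
rewrite x0; apply; first exact: UV.
by move=> c; exact: (CK_S (hg 1%N c) v Ux).
Qed.

(** [F] is the tower of successive derivatives, which a class of functions closed under derivation
    provides directly. *)
Definition smooth1 (D : set R) (phi : R -> R) := exists2 F : nat -> R -> R, F 0%N = phi &
  forall k x, D x -> is_derive x 1 (F k) (F k.+1 x).

Lemma CK_comp1 n k (U : set 'rV[C]_n) (D : set R) (phi : R -> R) (f : 'rV[C]_n -> R) :
  open U -> (forall x, U x -> D (f x)) -> smooth1 D phi -> (forall j, CK j U f) ->
  CK k U (fun x => phi (f x)).
Proof.
move=> oU UD [F <- HF] hf.
suff H : forall j, CK k U (fun x => F j (f x)) by exact: H.
elim: k => [|k IH] j.
  split => // x Ux; have h1 := is_derive_cont (HF j _ (UD _ Ux)).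
  exact: (continuous_comp (CK_cont (hf 0%N) Ux) h1).
apply: CK_intro => //.
  move=> x Ux; have h1 := is_derive_cont (HF j _ (UD _ Ux)).
  exact: (continuous_comp (CK_cont (hf 0%N) Ux) h1).
move=> v; exists (fun x => F j.+1 (f x) * rderive f v x).
  by apply: CK_mul => //; case: ((hf k.+1).2 v).
move=> x Ux; have x0 : x + (0 : R)%:C%C *: v = x by rewrite scale0r addr0.
have h2 := CK_S (hf 1%N) v Ux.
apply: (@is_derive1_comp R (F j) (fun t : R => f (x + t%:C%C *: v))) => //.
by rewrite x0; exact: HF j _ (UD x Ux).
Qed.

Lemma rc_diff_line n m (f : 'rV[C]_n -> 'rV[C]_m) (x v : 'rV[C]_n) c : differentiable f x ->
  is_derive (0 : R) 1 (fun t : R => rc c (f (x + t%:C%C *: v))) (rc c ('d f x v)).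
Proof.
have x0 : x + (0 : R)%:C%C *: v = x by rewrite scale0r addr0.
by move=> df; have := @is_derive_line R n m f x v 0 c; rewrite x0; exact.
Qed.

(** A directional derivative of [f] is a coordinate of ['d f x v], again a holomorphic function of
    [x] by [diff_diff]; this closes the induction on [k]. *)
Lemma CK_holo n m k (U : set 'rV[C]_n) (f : 'rV[C]_n -> 'rV[C]_m) : open U ->
  (forall x, U x -> differentiable f x) -> forall c, CK k U (fun x => rc c (f x)).
Proof.
move=> oU; elim: k f => [|k IH] f df c.
  split => // x Ux; apply/contR_eps => e e0.
  have : \forall y \near x, N1 (f y - f x) < e.
    have fx : {for x, continuous f} by apply: differentiable_continuous; exact: df.
    by apply: (fx [set z | N1 (z - f x) < e]); apply/nbhs_N1; exists e.
  move=> /nearN1[d d0 Hd]; exists d; first exact: d0.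
  by move=> y /Hd; apply: le_lt_trans; rewrite -rcB rc_le_N1.
have cf : forall x, U x -> {for x, continuous (fun x => rc c (f x))} by apply: CK_cont (IH f df c).
apply: CK_intro; [exact: oU|exact: cf|].
move=> v; exists (fun x => rc c ('d f x v)); last by move=> x Ux; exact: rc_diff_line (df x Ux).
apply: (IH (fun x => 'd f x v)) => x Ux.
by apply: (diff_diff _ v).1; exact: filterS df (open_nbhs_nbhs (conj oU Ux)).
Qed.

End SmoothCalculus.

(** * A smooth cutoff function *)

Section Cutoff.
Variable R : realType.

(** The negative powers are included because the derivative of [flat m] is
    [flat m.+2 - m * flat m.+1]: the family is closed under derivation up to linear combinations. *)
Definition flat (m : nat) (t : R) : R := if 0 < t then t ^- m * expR (- t^-1) else 0.

(* A class of functions that contains the profile of a cutoff function and is closed under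
   derivation, so that its members are smooth. *)
Inductive elem : set R -> (R -> R) -> Prop :=
| elem_cst D a : elem D (fun=> a)
| elem_id D : elem D id
| elem_flat D m : elem D (flat m)
| elem_add D f g : elem D f -> elem D g -> elem D (fun x => f x + g x)
| elem_mul D f g : elem D f -> elem D g -> elem D (fun x => f x * g x)
| elem_inv D f : elem D f -> (forall x, D x -> f x != 0) -> elem D (fun x => (f x)^-1)
| elem_comp D E f g : elem E f -> elem D g -> (forall x, D x -> E (g x)) -> elem D (fun x => f (g x)).

(** The inequality [1 + x <= expR x] at [u / m], raised to the power [m]. *)
Lemma pow_expR m (u : R) : 0 <= u -> u ^+ m <= (m%:R) ^+ m * expR u.
Proof.
case: m => [|m] u0; first by rewrite !expr0 mul1r -(expR0 R) ler_expR.
have m0 : 0 < m.+1%:R :> R by rewrite ltr0n.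
have -> : expR u = expR (u / m.+1%:R) ^+ m.+1.
  by rewrite -expRM_natr divfK// gt_eqF.
rewrite -exprMn ler_pXn2r ?nnegrE ?mulr_ge0 ?expR_ge0//.
rewrite mulrC -ler_pdivrMr// (le_trans _ (expR_ge1Dx _))// lerDr ler01//.
Qed.

Lemma flat_ge0 m t : 0 <= flat m t.
Proof.
by rewrite /flat; case: ifP => // t0; rewrite mulr_ge0 ?expR_ge0// invr_ge0 exprn_ge0// ltW.
Qed.

(** [pow_expR] at [t^-1] with exponent [m.+2]: two powers more than [flat m] contains. The remaining
    factor [t ^+ 2] makes the derivative at 0 vanish. *)
Lemma flat_small m t : flat m t <= (m.+2%:R) ^+ m.+2 * t ^+ 2.
Proof.
rewrite /flat; case: ifP => [t0|_]; last exact: mulr_ge0 (exprn_ge0 _ (ler0n _ _)) (sqr_ge0 _).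
have u0 : 0 <= t^-1 by rewrite invr_ge0 ltW.
have := pow_expR m.+2 u0; rewrite expRN => h.
have E0 := expR_gt0 t^-1.
rewrite -(ler_pM2r E0) -mulrA mulVf ?gt_eqF// mulr1.
rewrite -(@ler_pM2r _ (t ^- 2)) ?invr_gt0 ?exprn_gt0//.
have -> : t ^- m / t ^+ 2 = t^-1 ^+ m.+2 by rewrite -exprVn -[t ^- 2]exprVn -exprD addn2.
apply: (le_trans h); rewrite le_eqVlt; apply/orP; left; apply/eqP; field.
by rewrite gt_eqF.
Qed.

Lemma flat_deriv m (t : R) : is_derive t 1 (flat m) (flat m.+2 t - m%:R * flat m.+1 t).
Proof.
have [t0|t0|t0] := ltgtP t 0.
- have -> : flat m.+2 t - m%:R * flat m.+1 t = 0.
    by rewrite /flat ltNge (ltW t0) /= mulr0 subrr.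
  apply: is_deriveR_I => e e0; exists (- t); first by rewrite oppr_gt0.
  move=> h; rewrite ltr_norml opprK => /andP[_ h1].
  rewrite /flat !ltNge (ltW t0) (_ : t + h <= 0); last by lra.
  by rewrite /= mul0r !subr0 normr0 mulr_ge0// ltW.
- have tn : t != 0 by rewrite gt_eqF.
  have dV : is_derive t 1 (fun t : R => t^-1) (- t ^- 2).
    apply: is_derive_eq1 (is_deriveV tn (is_derive_id t 1)) _.
    by rewrite /GRing.scale /= mulr1.
  have dE : is_derive t 1 (fun t : R => expR (- t^-1)) (expR (- t^-1) * t ^- 2).
    apply: is_derive_eq1 (is_derive1_comp (is_derive_expR _) (is_deriveN dV)) _.
    by rewrite opprK.
  have dP : is_derive t 1 (fun t : R => t ^- m) (- m%:R * t ^- m.+1).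
    elim: m => [|k IH].
      have -> : (fun t : R => t ^- 0) = (fun=> 1) by apply/funext => s; rewrite expr0 invr1.
      by apply: is_derive_eq1 (is_derive_cst _ _ _) _; rewrite oppr0 mul0r.
    have -> : (fun t : R => t ^- k.+1) = (fun t => t ^- k * t^-1).
      by apply/funext => s; rewrite exprSr invfM.
    apply: is_derive_eq1 (is_deriveM IH dV) _.
    rewrite /GRing.scale /= -natr1 !exprS; field.
    by rewrite tn expf_neq0.
  have D := is_deriveM dP dE.
  have -> : flat m.+2 t - m%:R * flat m.+1 t =
     t ^- m *: (expR (- t^-1) * t ^- 2) + expR (- t^-1) *: (- m%:R * t ^- m.+1).
    rewrite /flat t0 /GRing.scale /= !exprS; field; rewrite ?expf_neq0//.
  apply: is_deriveR_I => e e0; have [r r0 Hr] := is_deriveR_E D e0.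
  exists (Num.min t r); first by rewrite lt_min t0.
  move=> h; rewrite lt_min ltr_norml => /andP[/andP[h1 h2] h3].
  have := Hr h h3; rewrite /flat t0 (_ : 0 < t + h) //; lra.
- rewrite t0 (_ : flat m.+2 0 - _ = 0); last by rewrite /flat ltxx mulr0 subrr.
  apply: is_deriveR_I => e e0; pose K : R := m.+2%:R ^+ m.+2 + 1.
  have K0 : 0 < K by rewrite ltr_wpDl// exprn_ge0.
  exists (e / K); first exact: divr_gt0.
  move=> h; rewrite ltr_pdivlMr// => hh; rewrite add0r mul0r subr0.
  rewrite [flat m 0]/flat ltxx subr0 ger0_norm ?flat_ge0//.
  apply: (le_trans (flat_small m h)); rewrite -(real_normK (num_real h)) [X in _ * X]expr2 mulrA.
  apply: ler_wpM2r; first exact: normr_ge0.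
  rewrite (le_trans _ (ltW hh))// [leRHS]mulrC; apply: ler_wpM2r; first exact: normr_ge0.
  by rewrite lerDl ler01.
Qed.

Lemma elem_deriv D f : elem D f -> exists2 g, elem D g & forall x, D x -> is_derive x 1 f (g x).
Proof.
elim=> {D f}.
- by move=> D a; exists (fun=> 0); [exact: elem_cst|move=> x _; exact: is_derive_cst].
- by move=> D; exists (fun=> 1); [exact: elem_cst|move=> x _; exact: is_derive_id].
- move=> D m; exists (fun x => flat m.+2 x + (- m%:R) * flat m.+1 x).
    by apply: elem_add; [exact: elem_flat|apply: elem_mul; [exact: elem_cst|exact: elem_flat]].
  by move=> x _; apply: is_derive_eq1 (flat_deriv m x) _; rewrite mulNr.
- move=> D f g hf [f' hf' Hf] hg [g' hg' Hg]; exists (fun x => f' x + g' x); first exact: elem_add.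
  by move=> x Dx; exact: is_deriveD (Hf x Dx) (Hg x Dx).
- move=> D f g hf [f' hf' Hf] hg [g' hg' Hg]; exists (fun x => f x * g' x + g x * f' x).
    by apply: elem_add; apply: elem_mul.
  by move=> x Dx; exact: is_deriveM (Hf x Dx) (Hg x Dx).
- move=> D f hf [f' hf' Hf] f0; exists (fun x => -1 * (f x)^-1 * (f x)^-1 * f' x).
    exact: (elem_mul (elem_mul (elem_mul (elem_cst D (-1)) (elem_inv hf f0)) (elem_inv hf f0)) hf').
  move=> x Dx; apply: is_derive_eq1 (is_deriveV (f0 x Dx) (Hf x Dx)) _.
  by rewrite /GRing.scale /= mulN1r !mulNr -invfM -expr2.
- move=> D E f g hf [f' hf' Hf] hg [g' hg' Hg] DE; exists (fun x => f' (g x) * g' x).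
    by apply: elem_mul => //; exact: elem_comp DE.
  by move=> x Dx; exact: (is_derive1_comp (Hf _ (DE x Dx)) (Hg x Dx)).
Qed.

Lemma elem_smooth1 D f : elem D f -> smooth1 D f.
Proof.
move=> hf.
have /choice[d Hd] : forall f : R -> R, exists g, elem D f -> elem D g /\ forall x, D x -> is_derive x 1 f (g x).
  move=> g; have [h|h] := pselect (elem D g); last by exists g.
  by have [g' h1 h2] := elem_deriv h; exists g'.
exists (fun k => iter k d f) => // k x Dx.
have : elem D (iter k d f) by elim: k => // k IH; exact: (Hd _ IH).1.
by move=> /Hd[_]; exact.
Qed.

Lemma is_derive_unique (f g : R -> R) (x a b : R) (D : set R) : open D -> D x ->
  (forall y, D y -> f y = g y) -> is_derive x 1 f a -> is_derive x 1 g b -> a = b.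
Proof.
move=> oD Dx fg fa gb; have : is_derive x 1 g a; last by move=> [_ <-]; case: gb.
have /nbhs_ballP[d /= d0 Hd] : nbhs x D by exact: open_nbhs_nbhs.
apply: is_deriveR_I => e e0; have [r r0 Hr] := is_deriveR_E fa e0.
exists (Num.min d r); first by rewrite lt_min d0.
move=> h; rewrite lt_min => /andP[h1 h2]; rewrite -!fg; first exact: Hr.
  exact: Dx.
by apply: Hd; rewrite /ball /= opprD addrA subrr sub0r normrN.
Qed.

(** The derivative vanishes off [d0, d1], hence is bounded by compactness. Membership in [elem] is
    returned because the profile rho/t and its derivative are formed inside this class. *)
Lemma cutoff (d0 d1 : R) : 0 < d0 -> d0 < d1 -> exists rho drho : R -> R,
  [/\ elem setT rho, elem setT drho & forall t : R, is_derive t 1 rho (drho t)] /\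
  [/\ forall t : R, 0 <= rho t, forall t : R, t <= d0 -> rho t = 1 & forall t, d1 <= t -> rho t = 0] /\
  [/\ forall t, t < d0 -> drho t = 0, forall t, d1 < t -> drho t = 0 &
   exists M, forall t, `|drho t| <= M].
Proof.
move=> d00 d01.
have fpos t : 0 < t -> 0 < flat 0 t by move=> t0; rewrite /flat t0 expr0 invr1 mul1r expR_gt0.
have fneg t : t <= 0 -> flat 0 t = 0 by move=> t0; rewrite /flat ltNge t0.
(* The usual quotient u / (u + v); the denominator is positive because every [t] lies below [d1] or
   above [d0]. The arguments are written in the shape of the constructors of [elem]. *)
pose u t := flat 0 (d1 + -1 * t); pose v t := flat 0 (t + - d0).
have den0 t : 0 < u t + v t.
  have [h|h] := ltP t d1.
    by apply: ltr_pwDl; [apply: fpos; lra|exact: flat_ge0].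
  by apply: ltr_wpDl; [exact: flat_ge0|apply: fpos; lra].
have eu : elem setT u.
  apply: (@elem_comp setT setT) => //; first exact: elem_flat.
  by apply: elem_add; [exact: elem_cst|apply: elem_mul; [exact: elem_cst|exact: elem_id]].
have ev : elem setT v.
  apply: (@elem_comp setT setT) => //; first exact: elem_flat.
  by apply: elem_add; [exact: elem_id|exact: elem_cst].
pose rho t := u t * (u t + v t)^-1.
have er : elem setT rho.
  apply: elem_mul => //; apply: elem_inv; first exact: elem_add.
  by move=> t _; rewrite gt_eqF.
have [drho edr Hdr] := elem_deriv er.
have r1 t : t <= d0 -> rho t = 1.
  move=> h; have v0 : v t = 0 by apply: fneg; lra.
  by rewrite /rho v0 addr0 mulfV//; have := den0 t; rewrite v0 addr0 => h'; rewrite gt_eqF.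
have r0 t : d1 <= t -> rho t = 0.
  by move=> h; rewrite /rho (_ : u t = 0) ?mul0r//; apply: fneg; lra.
have k0 t : t < d0 -> drho t = 0.
  move=> h; apply: (@is_derive_unique rho (fun=> 1) t _ _ [set t | t < d0]) => //.
  - by move=> y /= /ltW; exact: r1.
  - exact: Hdr.
have k1 t : d1 < t -> drho t = 0.
  move=> h; apply: (@is_derive_unique rho (fun=> 0) t _ _ [set t | d1 < t]) => //.
  - by move=> y /= /ltW; exact: r0.
  - exact: Hdr.
exists rho, drho; split; [split => // t; exact: Hdr|split].
  split => // t; rewrite mulr_ge0 ?flat_ge0// invr_ge0 ltW//.
split => //.
have [ddr _ Hddr] := elem_deriv edr.
have cd : {within `[d0, d1], continuous (fun t => `|drho t|)}.
  apply: continuous_subspaceT => x; apply: continuous_comp; last exact: norm_continuous.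
  exact: is_derive_cont (Hddr x I).
have [c _ Hc] := EVT_max (ltW d01) cd.
exists `|drho c| => t.
have [h|h] := ltP t d0; first by rewrite k0// normr0.
have [h'|h'] := ltP d1 t; first by rewrite k1// normr0.
by apply: Hc; rewrite in_itv /= h h'.
Qed.

End Cutoff.

(** * Hermitian tensors on open subsets of C^n *)

Section Models.
Variable R : realType.
Local Notation C := R[i].

Lemma sum_pair_bool n (F : 'I_n * bool -> R) : \sum_c F c = \sum_j (F (j, true) + F (j, false)).
Proof.
transitivity (\sum_(p : 'I_n * bool) F (p.1, p.2)); first by apply: eq_bigr => -[].
rewrite -(pair_big xpredT xpredT (fun j b => F (j, b))) /=.
by apply: eq_bigr => j _; rewrite big_bool.
Qed.

Definition rdot n (v w : 'rV[C]_n) : R := \sum_c rc c v * rc c w.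
Definition hd n (v w : 'rV[C]_n) : C := \sum_j v 0 j * (w 0 j)^*%C.

Lemma conjcM (a b : C) : (a * b)^*%C = a^*%C * b^*%C. Proof. by rewrite rmorphM. Qed.
Lemma conjcD (a b : C) : (a + b)^*%C = a^*%C + b^*%C. Proof. by rewrite rmorphD. Qed.

Section dot.
Variable n : nat.
Implicit Types u v w z : 'rV[C]_n.
Local Notation J := (fun v : 'rV[C]_n => 'i%C *: v).

Lemma rcJ (j : 'I_n) (b : bool) v : rc (j, b) (J v) = if b then - rc (j, false) v else rc (j, true) v.
Proof. by case: b; rewrite /rc /= !mxE !ReImE /=; ring. Qed.

Lemma rdotC v w : rdot v w = rdot w v.
Proof. by apply: eq_bigr => c _; rewrite mulrC. Qed.
Lemma rdotDl u v w : rdot (u + v) w = rdot u w + rdot v w.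
Proof. by rewrite -big_split; apply: eq_bigr => c _; rewrite rcD mulrDl. Qed.
Lemma rdotZl (a : R) v w : rdot (a%:C%C *: v) w = a * rdot v w.
Proof. by rewrite mulr_sumr; apply: eq_bigr => c _; rewrite rcZ mulrA. Qed.
Lemma rdotDr u v w : rdot w (u + v) = rdot w u + rdot w v.
Proof. by rewrite rdotC rdotDl !(rdotC w). Qed.
Lemma rdotZr (a : R) v w : rdot w (a%:C%C *: v) = a * rdot w v.
Proof. by rewrite rdotC rdotZl rdotC. Qed.
Lemma rdotJJ v w : rdot (J v) (J w) = rdot v w.
Proof.
by rewrite /rdot !sum_pair_bool; apply: eq_bigr => j _; rewrite !rcJ; ring.
Qed.
Lemma rdotJl v w : rdot (J v) w = - rdot v (J w).
Proof.
rewrite /rdot !sum_pair_bool -sumrN; apply: eq_bigr => j _; rewrite !rcJ; ring.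
Qed.
Lemma rdotJv v : rdot v (J v) = 0.
Proof. by have := rdotJl v v; rewrite rdotC; lra. Qed.

Lemma Re_hd v w : Re (hd v w) = rdot v w.
Proof.
rewrite /hd Re_sum /rdot sum_pair_bool; apply: eq_bigr => j _.
by rewrite ReM /rc /=; case: (w 0 j) => a b /=; ring.
Qed.
Lemma Im_hd v w : Im (hd v w) = rdot v (J w).
Proof.
rewrite /hd Im_sum /rdot sum_pair_bool; apply: eq_bigr => j _.
by rewrite !rcJ ImM /rc /=; case: (w 0 j) => a b /=; ring.
Qed.
Lemma hdD u v w : hd (u + v) w = hd u w + hd v w.
Proof. by rewrite -big_split; apply: eq_bigr => j _; rewrite mxE mulrDl. Qed.
Lemma hdZ (a : C) v w : hd (a *: v) w = a * hd v w.
Proof. by rewrite mulr_sumr; apply: eq_bigr => j _; rewrite mxE mulrA. Qed.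
Lemma hdDr u v w : hd w (u + v) = hd w u + hd w v.
Proof. by rewrite -big_split; apply: eq_bigr => j _; rewrite mxE conjcD mulrDr. Qed.
Lemma hdZr (a : C) v w : hd w (a *: v) = a^*%C * hd w v.
Proof. by rewrite mulr_sumr; apply: eq_bigr => j _; rewrite mxE conjcM mulrCA. Qed.
Lemma hdJ v w : (hd v w)^*%C = hd w v.
Proof.
rewrite /hd rmorph_sum; apply: eq_bigr => j _.
by rewrite rmorphM /= conjcK mulrC.
Qed.

Definition nq z := rdot z z.
Lemma hd_nq z : hd z z = (nq z)%:C%C.
Proof. by apply: eqC => /=; [rewrite Re_hd | rewrite Im_hd rdotJv]. Qed.
Lemma nq_ge0 z : 0 <= nq z.
Proof. by apply: sumr_ge0 => c _; rewrite -expr2 sqr_ge0. Qed.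
Lemma nq_rc z c : rc c z ^+ 2 <= nq z.
Proof.
rewrite /nq /rdot (bigD1 c)//= -expr2 lerDl sumr_ge0// => d _.
by rewrite -expr2 sqr_ge0.
Qed.
Lemma nq_eq0 z : nq z <= 0 -> z = 0.
Proof.
move=> h; apply: rc_inj => c; rewrite rc0; apply/eqP; rewrite -sqrf_eq0.
by rewrite eq_le sqr_ge0 andbT (le_trans (nq_rc z c)).
Qed.
Lemma nq_gt0 z : z != 0 -> 0 < nq z.
Proof.
move=> z0; rewrite lt_neqAle nq_ge0 andbT eq_sym; apply: contra z0 => /eqP h.
by rewrite (@nq_eq0 z)// h.
Qed.
Lemma nq0 : nq 0 = 0.
Proof. by rewrite /nq /rdot big1// => c _; rewrite rc0 mul0r. Qed.

(* The Gram form of the projection orthogonal to the complex line of [z]. *)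
Definition gram z v w : R := Re (hd v w * hd z z - hd v z * hd z w).

(** Multiples of [z] lie in the kernel and the form has degree 4 in the modulus of [l]; divided by
    |z|^4 it descends to the projective space. *)
Lemma gram_scale (l mu nu : C) z v w :
  gram (l *: z) (l *: v + mu *: z) (l *: w + nu *: z) = (Re (l * l^*%C)) ^+ 2 * gram z v w.
Proof.
have lE : l * l^*%C = (Re (l * l^*%C))%:C%C.
  by apply: eqC => //=; case: l => a b /=; ring.
rewrite /gram !(hdDr, hdD, hdZ, hdZr).
set X := (X in Re X = _).
have -> : X = (l * l^*%C) ^+ 2 * (hd v w * hd z z - hd v z * hd z w) by rewrite /X; ring.
by rewrite lE -rmorphXn /= ReM /= mul0r subr0.
Qed.

Lemma gram_psd z v : nq z * gram z v v = nq ((nq z)%:C%C *: v - hd v z *: z).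
Proof.
rewrite /nq -[RHS]Re_hd -/(nq z) -scaleNr !(hdDr, hdD, hdZ, hdZr) /gram.
have -> : (nq z)%:C^*%C = (nq z)%:C%C by rewrite conjc_real.
have -> : (- hd v z)^*%C = - hd z v by rewrite rmorphN /= hdJ.
rewrite !hd_nq; set X := (X in _ = Re X).
have -> : X = (nq z)%:C%C * ((nq v)%:C%C * (nq z)%:C%C - hd v z * hd z v) by rewrite /X; ring.
by rewrite ReM /= mul0r subr0.
Qed.

(* For [be = al'], the Kahler tensor with potential a function of |z|^2 whose derivative is [al]. *)
Definition KT (al be : R -> R) z v w : R :=
  al (nq z) * rdot v w + be (nq z) * (rdot v z * rdot w z + rdot v (J z) * rdot w (J z)).

Lemma gramE z v w : gram z v w =
  nq z * rdot v w - (rdot v z * rdot w z + rdot v (J z) * rdot w (J z)).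
Proof.
rewrite /gram hd_nq ReD ReN !ReM !Re_hd !Im_hd /= mulr0 subr0 mulrC; congr (_ - _).
by rewrite (rdotC z w) (rdotC z (J w)) rdotJl; ring.
Qed.

(** For [al = rho / t] and [be] its derivative, [a] is rho and [b] is rho': the cutoff multiplies a
    semi-definite form, and only its derivative enters with an arbitrary sign. *)
Lemma KT_gram (al be : R -> R) z v w (a b : R) : nq z != 0 ->
  al (nq z) = a / nq z -> be (nq z) = b / nq z - a / nq z ^+ 2 ->
  KT al be z v w = a / nq z ^+ 2 * gram z v w +
    b / nq z * (rdot v z * rdot w z + rdot v (J z) * rdot w (J z)).
Proof.
move=> q0 ha hb; rewrite /KT ha hb gramE.
by field.
Qed.

Lemma hd_le z v : rdot v z ^+ 2 + rdot v (J z) ^+ 2 <= nq v * nq z.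
Proof.
have [->|z0] := eqVneq z 0.
  have -> : J (0 : 'rV[C]_n) = 0 by rewrite scaler0.
  have -> : rdot v 0 = 0 by rewrite /rdot big1// => c _; rewrite rc0 mulr0.
  by rewrite nq0 mulr0 expr0n addr0.
have q0 := nq_gt0 z0; have := gram_psd z v; rewrite gramE -!expr2 => h.
have := nq_ge0 ((nq z)%:C%C *: v - hd v z *: z); rewrite -h pmulr_rge0// subr_ge0.
by rewrite mulrC.
Qed.

End dot.

(** The coordinate form of a smooth J-invariant symmetric tensor. The correction k has no definite
    sign, so positivity is left to the final sum. *)
Record model N (V : set 'rV[C]_N) (T : 'rV[C]_N -> 'rV[C]_N -> 'rV[C]_N -> R) : Prop := Model {
  ml_lin : forall z, V z -> forall (a : R) u v w, T z (a%:C%C *: u + v) w = a * T z u w + T z v w;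
  ml_sym : forall z, V z -> forall v w, T z v w = T z w v;
  ml_J : forall z, V z -> forall v w, T z ('i%C *: v) ('i%C *: w) = T z v w;
  ml_smooth : forall k v w, CK k V (fun z => T z v w) }.

Definition closedT N (V : set 'rV[C]_N) (T : 'rV[C]_N -> 'rV[C]_N -> 'rV[C]_N -> R) :=
  forall z, V z -> forall u v w,
    rderive (fun y => T y v ('i%C *: w)) u z + rderive (fun y => T y w ('i%C *: u)) v z +
    rderive (fun y => T y u ('i%C *: v)) w z = 0.

Definition pull n N (m : 'rV[C]_n -> 'rV[C]_N) (T : 'rV[C]_N -> 'rV[C]_N -> 'rV[C]_N -> R) x v w :=
  T (m x) ('d m x v) ('d m x w).

Definition bilin N (B : 'rV[C]_N -> 'rV[C]_N -> R) :=
  (forall (a : R) u v w, B (a%:C%C *: u + v) w = a * B u w + B v w) /\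
  (forall (a : R) u v w, B u (a%:C%C *: v + w) = a * B u v + B u w).

Section bil.
Variables (N : nat) (B : 'rV[C]_N -> 'rV[C]_N -> R).
Hypothesis HB : bilin B.

Lemma bil0l w : B 0 w = 0.
Proof. by have := HB.1 (-1) 0 0 w; rewrite scaler0 addr0 mulN1r addNr. Qed.
Lemma bil0r w : B w 0 = 0.
Proof. by have := HB.2 (-1) w 0 0; rewrite scaler0 addr0 mulN1r addNr. Qed.
Lemma bilDl u v w : B (u + v) w = B u w + B v w.
Proof. by have := HB.1 1 u v w; rewrite scale1r mul1r. Qed.
Lemma bilDr u v w : B w (u + v) = B w u + B w v.
Proof. by have := HB.2 1 w u v; rewrite scale1r mul1r. Qed.
Lemma bilZl (a : R) u w : B (a%:C%C *: u) w = a * B u w.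
Proof. by have := HB.1 a u 0 w; rewrite addr0 bil0l addr0. Qed.
Lemma bilZr (a : R) u w : B w (a%:C%C *: u) = a * B w u.
Proof. by have := HB.2 a w u 0; rewrite addr0 bil0r addr0. Qed.
Lemma bil_suml I (r : seq I) F w : B (\sum_(i <- r) F i) w = \sum_(i <- r) B (F i) w.
Proof. by elim: r => [|i r IH]; rewrite ?big_nil ?bil0l// !big_cons bilDl IH. Qed.
Lemma bil_sumr I (r : seq I) F w : B w (\sum_(i <- r) F i) = \sum_(i <- r) B w (F i).
Proof. by elim: r => [|i r IH]; rewrite ?big_nil ?bil0r// !big_cons bilDr IH. Qed.
Lemma bilE v w : B v w = \sum_c \sum_d rc c v * rc d w * B (rb R c) (rb R d).
Proof.
rewrite {1}[v]rcE {1}[w]rcE bil_suml; apply: eq_bigr => c _.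
rewrite bilZl bil_sumr mulr_sumr; apply: eq_bigr => d _.
by rewrite bilZr mulrA.
Qed.
End bil.

Lemma model_bilin N (V : set 'rV[C]_N) T z : model V T -> V z -> bilin (T z).
Proof.
move=> h Vz; split; first exact: ml_lin h _ Vz.
by move=> a u v w; rewrite (ml_sym h Vz) (ml_lin h Vz) !(ml_sym h Vz _ u).
Qed.

Lemma is_derive_bigsum I (r : seq I) (F : I -> R -> R) (d : I -> R) (x : R) :
  (forall i, is_derive x 1 (F i) (d i)) ->
  is_derive x 1 (fun t => \sum_(i <- r) F i t) (\sum_(i <- r) d i).
Proof.
move=> H; elim: r => [|i r IH].
  rewrite big_nil (_ : (fun t => _) = fun=> 0); first exact: is_derive_cst.
  by apply/funext => t; rewrite big_nil.
rewrite big_cons (_ : (fun t => _) = fun t => F i t + \sum_(j <- r) F j t).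
  exact: is_deriveD (H i) IH.
by apply/funext => t; rewrite big_cons.
Qed.

Lemma is_derive_mul3 (f g h : R -> R) (x a b c f' g' h' : R) : f x = a -> g x = b -> h x = c ->
  is_derive x 1 f f' -> is_derive x 1 g g' -> is_derive x 1 h h' ->
  is_derive x 1 (fun t => f t * g t * h t) (a * b * h' + (f' * b + a * g') * c).
Proof.
move=> <- <- <- hf hg hh; apply: is_derive_eq1 (is_deriveM (is_deriveM hf hg) hh) _.
by rewrite !fctE /GRing.scale /=; ring.
Qed.

Lemma dbl_sum (I : finType) (a b p q : I -> R) (B D : I -> I -> R) :
  \sum_c \sum_d (a c * b d * D c d + (p c * b d + a c * q d) * B c d) =
  \sum_c \sum_d a c * b d * D c d + \sum_c \sum_d p c * b d * B c d +
  \sum_c \sum_d a c * q d * B c d.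
Proof.
rewrite -!big_split /=; apply: eq_bigr => c _; rewrite -!big_split /=; apply: eq_bigr => d _; ring.
Qed.

Section pullback.
Variables (n N : nat) (U : set 'rV[C]_n) (V : set 'rV[C]_N) (m : 'rV[C]_n -> 'rV[C]_N).
Hypotheses (oU : open U) (oV : open V).
Hypothesis dm : forall x, U x -> differentiable m x.
Hypothesis mV : forall x, U x -> V (m x).

Let ddm v x : U x -> differentiable (fun x => 'd m x v) x.
Proof.
move=> Ux; apply: (diff_diff _ v).1; exact: filterS dm (open_nbhs_nbhs (conj oU Ux)).
Qed.

(** Expansion in the real basis reduces smoothness to the coefficients of [B], composed with [m],
    and to the coordinates of [X] and [Y]. *)
Lemma CK_bil k (B : 'rV[C]_N -> 'rV[C]_N -> 'rV[C]_N -> R) (X Y : 'rV[C]_n -> 'rV[C]_N) :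
  (forall z, V z -> bilin (B z)) -> (forall k v w, CK k V (fun z => B z v w)) ->
  (forall x, U x -> differentiable X x) -> (forall x, U x -> differentiable Y x) ->
  CK k U (fun x => B (m x) (X x) (Y x)).
Proof.
move=> hB sB dX dY.
apply: (@CK_eq _ _ _ oU k (fun x => \sum_c \sum_d rc c (X x) * rc d (Y x) * B (m x) (rb R c) (rb R d))).
  by move=> x Ux; rewrite -bilE//; apply: hB; exact: mV.
apply: CK_sum => // c; apply: CK_sum => // d; apply: CK_mul => //; first apply: CK_mul => //.
- exact: CK_holo.
- exact: CK_holo.
- apply: (CK_comp oU oV mV (sB k _ _)) => j e; exact: CK_holo.
Qed.

Lemma pull_model T : model V T -> model U (pull m T).
Proof.
move=> h; split.
- move=> x Ux a u v w; rewrite /pull.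
  by rewrite (clinD (clin_d m x)) (clinZ (clin_d m x)) (ml_lin h)//; exact: mV.
- by move=> x Ux v w; rewrite /pull (ml_sym h)//; exact: mV.
- by move=> x Ux v w; rewrite /pull !(clinZ (clin_d m x)) (ml_J h)//; exact: mV.
- move=> k v w; apply: (CK_bil k (B := T) (X := fun x => 'd m x v) (Y := fun x => 'd m x w)).
  + by move=> z Vz; exact: model_bilin h Vz.
  + exact: ml_smooth h.
  + by move=> x Ux; exact: ddm.
  + by move=> x Ux; exact: ddm.
Qed.

Lemma rderive_bil (B : 'rV[C]_N -> 'rV[C]_N -> 'rV[C]_N -> R) (X Y : 'rV[C]_n -> 'rV[C]_N) x u :
  (forall z, V z -> bilin (B z)) -> (forall k v w, CK k V (fun z => B z v w)) ->
  U x -> differentiable X x -> differentiable Y x ->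
  rderive (fun x => B (m x) (X x) (Y x)) u x =
    rderive (fun z => B z (X x) (Y x)) ('d m x u) (m x) +
    B (m x) ('d X x u) (Y x) + B (m x) (X x) ('d Y x u).
Proof.
move=> hB sB Ux dX dY; have Vx := mV Ux.
have x0 : x + (0 : R)%:C%C *: u = x by rewrite scale0r addr0.
pose D c d := rderive (fun z => B z (rb R c) (rb R d)) ('d m x u) (m x).
have E1 : rderive (fun z => B z (X x) (Y x)) ('d m x u) (m x) =
    \sum_c \sum_d rc c (X x) * rc d (Y x) * D c d.
  pose f1 z := \sum_c \sum_d rc c (X x) * rc d (Y x) * B z (rb R c) (rb R d).
  have : is_derive (0 : R) 1 (fun t : R => f1 (m x + t%:C%C *: 'd m x u))
      (\sum_c \sum_d rc c (X x) * rc d (Y x) * D c d).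
    apply: is_derive_bigsum => c; apply: is_derive_bigsum => d.
    apply: is_derive_eq1 (is_deriveM (is_derive_cst _ _ _) (CK_S (sB 1%N (rb R c) (rb R d)) _ Vx)) _.
    by rewrite scaler0 addr0.
  move=> /(rderiveP f1 _ _ _).1[h1 <-].
  by have [_ ->] := @rderive_near _ _ f1 (fun z => B z (X x) (Y x)) V _ _ oV Vx
    (fun z Vz => esym (bilE (hB _ Vz) (X x) (Y x))) h1.
pose f2 y := \sum_c \sum_d rc c (X y) * rc d (Y y) * B (m y) (rb R c) (rb R d).
have : is_derive (0 : R) 1 (fun t : R => f2 (x + t%:C%C *: u)) (\sum_c \sum_d (rc c (X x) * rc d (Y x) * D c d +
     (rc c ('d X x u) * rc d (Y x) + rc c (X x) * rc d ('d Y x u)) * B (m x) (rb R c) (rb R d))).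
  apply: is_derive_bigsum => c; apply: is_derive_bigsum => d.
  have dB : is_derive (0 : R) 1 (fun t : R => B (m (x + t%:C%C *: u)) (rb R c) (rb R d)) (D c d).
    have := @chain_curve _ N V (fun z => B z (rb R c) (rb R d)) (fun t : R => m (x + t%:C%C *: u))
      (fun e => rc e ('d m x u)) oV (sB 1%N _ _).
    rewrite x0 -(rderiveE _ oV (sB 1%N _ _) Vx); apply => // e.
    exact: rc_diff_line (dm Ux).
  by apply: (is_derive_mul3 _ _ _ (rc_diff_line u c dX) (rc_diff_line u d dY) dB); rewrite x0.
move=> /(rderiveP f2 _ _ _).1[h1 h2].
have [_ ->] := @rderive_near _ _ f2 (fun x => B (m x) (X x) (Y x)) U _ _ oU Ux
  (fun y Uy => esym (bilE (hB _ (mV Uy)) (X y) (Y y))) h1.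
rewrite h2 E1 (bilE (hB _ Vx) ('d X x u)) (bilE (hB _ Vx) (X x)).
exact: (dbl_sum (fun c => rc c (X x)) (fun d => rc d (Y x)) (fun c => rc c ('d X x u))
  (fun d => rc d ('d Y x u)) (fun c d => B (m x) (rb R c) (rb R d)) D).
Qed.

Lemma cyc_cancel (V' : Type) (B : V' -> V' -> R) (p q r pq pq' qr qr' rp rp' : V') (a b c : R) :
  (forall x y, B x y = - B y x) -> pq = pq' -> qr = qr' -> rp = rp' -> a + b + c = 0 ->
  (a + B pq r + B q rp') + (b + B qr p + B r pq') + (c + B rp q + B p qr') = 0.
Proof.
move=> anti -> -> -> abc.
by rewrite (anti q) (anti r) (anti p); lra.
Qed.

(** By the product rule [rderive_bil], each derivative gives one term with the derivative of [T] and
    two with second derivatives of [m]. The latter cancel in pairs in the cyclic sum, since [Om] is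
    antisymmetric and the second differential is symmetric. *)
Lemma pull_closed T : model V T -> closedT V T -> closedT U (pull m T).
Proof.
move=> h cT x Ux u v w; have Vx := mV Ux.
pose Om z a b := T z a ('i%C *: b).
have hOm z : V z -> bilin (Om z).
  move=> Vz; have [h1 h2] := model_bilin h Vz; split; first by move=> a p q r; rewrite /Om h1.
  by move=> a p q r; rewrite /Om scalerDr !scalerA mulrC -scalerA h2.
have sOm k a b : CK k V (fun z => Om z a b) by exact: ml_smooth h k _ _.
have anti z a b : V z -> Om z a b = - Om z b a.
  move=> Vz; rewrite /Om (ml_sym h Vz) -(ml_J h Vz) scalerA -expr2 sqr_i.
  have := bilZl (model_bilin h Vz) (-1) b ('i%C *: a).
  rewrite (_ : (-1)%:C%C = -1 :> C); last by apply: eqC => //=; rewrite oppr0.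
  by move=> ->; rewrite mulN1r.
have E a b c : rderive (fun y => pull m T y b ('i%C *: c)) a x =
    rderive (fun z => Om z ('d m x b) ('d m x c)) ('d m x a) (m x) +
    Om (m x) ('d (fun y => 'd m y b) x a) ('d m x c) + Om (m x) ('d m x b) ('d (fun y => 'd m y c) x a).
  rewrite -(@rderive_bil Om (fun y => 'd m y b) (fun y => 'd m y c))//; [|exact: ddm|exact: ddm].
  congr (rderive _ _ _); apply/funext => y; rewrite /pull /Om.
  by rewrite (clinZ (clin_d m y)).
have sy a b : 'd (fun y => 'd m y a) x b = 'd (fun y => 'd m y b) x a.
  by apply: (diff_diff _ a).2; exact: filterS dm (open_nbhs_nbhs (conj oU Ux)).
rewrite (E u v w) (E v w u) (E w u v).
exact: (@cyc_cancel _ (Om (m x)) _ _ _ _ _ _ _ _ _ _ _ _ (fun a b => anti (m x) a b Vx) (sy v u) (sy w v) (sy u w) (cT _ Vx _ _ _)).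
Qed.

End pullback.

End Models.

(** * Kähler tensors with a radial potential *)

Section KTmodel.
Variable R : realType.
Local Notation C := R[i].
Variables (n : nat) (V : set 'rV[C]_n).
Hypothesis oV : open V.
Local Notation J := (fun v : 'rV[C]_n => 'i%C *: v).

Lemma CK_rc k c : CK k V (fun z : 'rV[C]_n => rc c z).
Proof. by apply: (CK_holo k oV (f := fun z => z)) => x _; exact: ex_diff. Qed.

Lemma CK_rdot k (v : 'rV[C]_n) : CK k V (rdot v).
Proof. by apply: CK_sum => // c; apply: CK_mul => //; [exact: CK_cst|exact: CK_rc]. Qed.

Lemma CK_rdotJ k (v : 'rV[C]_n) : CK k V (fun z => rdot v (J z)).
Proof.
apply: (CK_eq oV (f := fun z => - rdot (J v) z)); last by apply: CK_opp => //; exact: CK_rdot.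
by move=> x _; rewrite rdotJl opprK.
Qed.

Lemma CK_nq k : CK k V (@nq R n).
Proof. by apply: CK_sum => // c; apply: CK_mul => //; exact: CK_rc. Qed.

Lemma KT_model (D : set R) (al be : R -> R) : (forall z, V z -> D (nq z)) ->
  smooth1 D al -> smooth1 D be -> model V (KT al be).
Proof.
move=> VD sal sbe; split.
- move=> z _ a u v w; rewrite /KT !(rdotDl, rdotZl); ring.
- by move=> z _ v w; rewrite /KT (rdotC v w); ring.
- move=> z _ v w; rewrite /KT rdotJJ !rdotJJ !(rdotJl _ z); ring.
- move=> k v w; have cq j := CK_nq j.
  apply: CK_add => //; first by apply: CK_mul => //; [exact: CK_comp1 VD sal cq|exact: CK_cst].
  apply: CK_mul => //; first exact: CK_comp1 VD sbe cq.
  by apply: CK_add => //; apply: CK_mul => //; first [exact: CK_rdot|exact: CK_rdotJ].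
Qed.

Lemma is_derive_rdot (v z u : 'rV[C]_n) :
  is_derive (0 : R) 1 (fun t : R => rdot v (z + t%:C%C *: u)) (rdot v u).
Proof.
have -> : (fun t : R => rdot v (z + t%:C%C *: u)) = (fun t => rdot v z + t * rdot v u).
  by apply/funext => t; rewrite rdotDr rdotZr.
apply: is_derive_eq1 (is_deriveD (is_derive_cst _ _ _) (is_deriveM (is_derive_id _ _) (is_derive_cst _ _ _))) _.
by rewrite scaler0 !add0r /GRing.scale /= mulr1.
Qed.

Lemma is_derive_quad (a b c : R) : is_derive (0 : R) 1 (fun t : R => a + (t * b + t * t * c)) b.
Proof.
have t1 := @is_derive_id R R (0 : R) (1 : R).
apply: is_derive_eq1 (is_deriveD (is_derive_cst _ _ _) (is_deriveD (is_deriveM t1 (is_derive_cst _ _ _))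
  (is_deriveM (is_deriveM t1 t1) (is_derive_cst _ _ _)))) _.
by rewrite !fctE /GRing.scale /=; ring.
Qed.

Lemma is_derive_nq (z u : 'rV[C]_n) :
  is_derive (0 : R) 1 (fun t : R => nq (z + t%:C%C *: u)) (2 * rdot u z).
Proof.
have -> : (fun t : R => nq (z + t%:C%C *: u)) = (fun t => nq z + (t * (2 * rdot u z) + t * t * nq u)).
  apply/funext => t; rewrite /nq !(rdotDl, rdotDr, rdotZl, rdotZr) (rdotC z u); ring.
exact: is_derive_quad.
Qed.

Lemma is_derive_KT (A B p q r s : R -> R) (c b p0 q0 r0 s0 A' B' p' q' r' s' : R) :
  B 0 = b -> p 0 = p0 -> q 0 = q0 -> r 0 = r0 -> s 0 = s0 ->
  is_derive (0 : R) 1 A A' -> is_derive (0 : R) 1 B B' -> is_derive (0 : R) 1 p p' ->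
  is_derive (0 : R) 1 q q' -> is_derive (0 : R) 1 r r' -> is_derive (0 : R) 1 s s' ->
  is_derive (0 : R) 1 (fun t => A t * c + B t * (p t * q t - r t * s t))
    (A' * c + (B' * (p0 * q0 - r0 * s0) + b * (p' * q0 + p0 * q' - r' * s0 - r0 * s'))).
Proof.
move=> <- <- <- <- <- dA dB dp dq dr ds.
apply: is_derive_eq1 (is_deriveD (is_deriveM dA (is_derive_cst _ _ _))
    (is_deriveM dB (is_deriveB (is_deriveM dp dq) (is_deriveM dr ds)))) _.
by rewrite !fctE /GRing.scale /=; ring.
Qed.

(** In the cyclic sum the terms in [ga] and those in [be] cancel separately, by the antisymmetry of
    [rdot a (J b)]. *)
Lemma KT_closed (D : set R) (al be ga : R -> R) : (forall z, V z -> D (nq z)) ->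
  (forall t, D t -> is_derive t 1 al (be t)) -> (forall t, D t -> is_derive t 1 be (ga t)) ->
  closedT V (KT al be).
Proof.
move=> VD dal dbe z Vz.
have E u v w : rderive (fun y => KT al be y v (J w)) u z =
    be (nq z) * (2 * rdot u z) * rdot v (J w) +
    (ga (nq z) * (2 * rdot u z) * (rdot v (J z) * rdot w z - rdot v z * rdot w (J z)) +
     be (nq z) * (rdot v (J u) * rdot w z + rdot v (J z) * rdot w u
                 - rdot v u * rdot w (J z) - rdot v z * rdot w (J u))).
  have dq := is_derive_nq z u.
  have z0 : z + (0 : R)%:C%C *: u = z by rewrite scale0r addr0.
  have dA (a : R -> R) (b : R) : is_derive (nq z) 1 a b -> is_derive (0 : R) 1 (fun t : R => a (nq (z + t%:C%C *: u))) (2 * rdot u z * b).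
    move=> h; apply: is_derive_eq1 (@is_derive1_comp R a (fun t : R => nq (z + t%:C%C *: u)) 0 _ _ _ dq) (mulrC _ _).
    by rewrite z0.
  have dJ a : is_derive (0 : R) 1 (fun t : R => rdot a (J (z + t%:C%C *: u))) (rdot a (J u)).
    have -> : (fun t : R => rdot a (J (z + t%:C%C *: u))) = (fun t : R => rdot a (J z + t%:C%C *: J u)).
      by apply/funext => t; rewrite scalerDr !scalerA (mulrC 'i%C).
    exact: is_derive_rdot.
  have -> : (fun y => KT al be y v (J w)) = (fun y => al (nq y) * rdot v (J w) +
     be (nq y) * (rdot v (J y) * rdot w y - rdot v y * rdot w (J y))).
    apply/funext => y; rewrite /KT rdotJJ (rdotJl w y); ring.
  pose f y := al (nq y) * rdot v (J w) +
     be (nq y) * (rdot v (J y) * rdot w y - rdot v y * rdot w (J y)).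
  apply: (proj2 (((rderiveP f u z _).1) _)).
  apply: is_derive_eq1 (is_derive_KT _ _ _ _ _ _ (dA _ _ (dal _ (VD _ Vz))) (dA _ _ (dbe _ (VD _ Vz))) (dJ v)
    (is_derive_rdot w z u) (is_derive_rdot v z u) (dJ w)) _; try by rewrite z0.
  by ring.
move=> u v w; rewrite !E.
have an a b : rdot a (J b) = - rdot b (J a) by rewrite -rdotJl rdotC.
rewrite (an v u) (an w u) (an w v) (rdotC v u) (rdotC w u) (rdotC w v); ring.
Qed.

End KTmodel.

(** * Differentials and changes of charts *)

Section Charts.
Variable R : realType.
Local Notation C := R[i].

(** The chain rule for a composition identified only near the point: coordinate formulas fail off
    the chart domains, where charts have arbitrary values. *)
Lemma diff_compV n m p (f : 'rV[C]_n -> 'rV[C]_m) (g : 'rV[C]_m -> 'rV[C]_p)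
    (h : 'rV[C]_n -> 'rV[C]_p) (x : 'rV[C]_n) :
  (\forall y \near x, g (f y) = h y) -> differentiable f x -> differentiable g (f x) ->
  differentiable h x /\ forall v, 'd h x v = 'd g (f x) ('d f x v).
Proof.
move=> fgh df dg.
have dgf : differentiable (g \o f) x := differentiable_comp df dg.
have [h1 h2] := diff_near_eq fgh dgf.
split; first exact: h1.
by move=> v; rewrite h2 diff_comp.
Qed.

Section chart.
Variables (n : nat) (Y : topologicalType) (psi : chart R n Y).
Hypothesis cpsi : is_chart psi.

Lemma cimgP O z : cimg psi O z -> [/\ cdom psi (cinv psi z), O (cinv psi z) & cmap psi (cinv psi z) = z].
Proof. by move=> [p [Dp Op] <-]; rewrite (chart_cancel cpsi Dp). Qed.

Lemma cimg_in (O : set Y) p : cdom psi p -> O p -> cimg psi O (cmap psi p).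
Proof. by move=> Dp Op; exists p. Qed.

Lemma cimg_open O : open O -> open (cimg psi O).
Proof.
move=> oO; rewrite openE => _ [p [Dp Op] <-]; rewrite /interior.
have h1 : nbhs (cmap psi p) (cimg psi setT).
  by apply: open_nbhs_nbhs; split; [exact: chart_open_img cpsi|exact: cimg_in].
have h2 : nbhs (cmap psi p) (cinv psi @^-1` O).
  apply: (chart_cont_inv cpsi Dp); rewrite (chart_cancel cpsi Dp).
  by apply: open_nbhs_nbhs; split.
near=> z; have hz : cimg psi setT z by near: z.
have [D1 _ E1] := cimgP hz; rewrite -E1; apply: cimg_in => //.
by near: z.
Unshelve. all: by end_near. Qed.

Lemma near_cimg (O : set Y) p : open O -> cdom psi p -> O p -> \forall z \near cmap psi p, cimg psi O z.
Proof. by move=> oO Dp Op; apply: open_nbhs_nbhs; split; [exact: cimg_open|exact: cimg_in]. Qed.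

End chart.

Lemma diff_change n N (Y : topologicalType) (psi psi' : chart R n Y) (F : Y -> 'rV[C]_N) y :
  is_chart psi -> is_chart psi' -> holo_transition psi psi' ->
  cdom psi y -> cdom psi' y -> differentiable (F \o cinv psi') (cmap psi' y) ->
  differentiable (F \o cinv psi) (cmap psi y) /\
  forall v, 'd (F \o cinv psi) (cmap psi y) v =
    'd (F \o cinv psi') (cmap psi' y) ('d (transition psi psi') (cmap psi y) v).
Proof.
move=> c1 c2 ht D1 D2 dF.
have E : transition psi psi' (cmap psi y) = cmap psi' y by rewrite /transition /= (chart_cancel c1).
have dt := ht y D1 D2.
have := @diff_compV n n N (transition psi psi') (F \o cinv psi') (F \o cinv psi) (cmap psi y).
rewrite E; apply => //.
apply: filterS (near_cimg c1 (chart_open_dom c2) D1 D2) => z hz.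
have [h1 h2 h3] := cimgP c1 hz.
by rewrite /transition /= (chart_cancel c2 h2).
Qed.

Lemma diff_post n m (X Y : topologicalType) (psi : chart R n Y) (eta eta' : chart R m X)
    (f : Y -> X) y : is_chart psi -> is_chart eta -> is_chart eta' -> holo_transition eta eta' ->
  {for y, continuous f} -> cdom psi y -> cdom eta (f y) -> cdom eta' (f y) ->
  differentiable (cmap eta \o f \o cinv psi) (cmap psi y) ->
  differentiable (cmap eta' \o f \o cinv psi) (cmap psi y) /\
  forall v, 'd (cmap eta' \o f \o cinv psi) (cmap psi y) v =
    'd (transition eta eta') (cmap eta (f y)) ('d (cmap eta \o f \o cinv psi) (cmap psi y) v).
Proof.
move=> c1 c2 c3 ht cf D1 D2 D3 df.
have E : (cmap eta \o f \o cinv psi) (cmap psi y) = cmap eta (f y) by rewrite /= (chart_cancel c1).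
have dt := ht _ D2 D3.
have := @diff_compV n m m (cmap eta \o f \o cinv psi) (transition eta eta') (cmap eta' \o f \o cinv psi) (cmap psi y).
rewrite E; apply => //.
have : nbhs (cmap psi y) (cinv psi @^-1` (f @^-1` (cdom eta))).
  apply: (chart_cont_inv c1 D1); rewrite (chart_cancel c1 D1); apply: cf.
  by apply: open_nbhs_nbhs; split => //; exact: chart_open_dom.
by apply: filterS => z hz; rewrite /transition /= (chart_cancel c2 hz).
Qed.

Lemma hm_model n (X : topologicalType) (A : set (chart R n X)) (U : set X) (g : tensor2 R n X) phi :
  is_chart phi -> hermitian_metric_on A U g -> A phi ->
  model (cimg phi U) (fun z => g phi (cinv phi z)).
Proof.
move=> cphi hg Aphi; split.
- by move=> z /(cimgP cphi)[D1 U1 _] a u v w; exact: hm_linear hg _ _ Aphi D1 U1 a u v w.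
- by move=> z /(cimgP cphi)[D1 U1 _] v w; exact: hm_sym hg _ _ Aphi D1 U1 v w.
- by move=> z /(cimgP cphi)[D1 U1 _] v w; exact: hm_J hg _ _ Aphi D1 U1 v w.
- move=> k v w; exact: ((smooth_onP (cimg phi U) _).1 (hm_smooth hg Aphi v w) k).
Qed.

End Charts.

(** * Affine charts of the projective space *)

Section Proj.
Variable R : realType.
Local Notation C := R[i].

Lemma affine_diff n m (f L : 'rV[C]_n -> 'rV[C]_m) : clin L -> (forall x h, f (x + h) = f x + L h) ->
  forall x, differentiable f x /\ 'd f x = L :> (_ -> _).
Proof.
move=> hL fL x; apply: diff_epsI => // e e0; exists 1 => // h _.
by rewrite fL addrAC addrK subrr N10; exact: mulr_ge0 (ltW e0) (N1_ge0 h).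
Qed.

Section aff.
Variables (n : nat) (k : 'I_n).

(** [hcoord] depends on a choice of representatives and need not be continuous, but whether a
    coordinate vanishes is independent of the choice, so openness is checked on nonzero vectors. *)
Lemma hcoord_open : open [set l : projspace R n | hcoord l 0 k != 0].
Proof.
suff : open [set v : nonzero_vec R n | vec_of v 0 k != 0].
  set S1 := (X in open X) => oS; set S2 := (X in open X).
  suff -> : open S2 = open (\pi_{eq_quot (proj_equiv R n)}%qT @^-1` S2 : set (nonzero_vec R n)).
    suff -> : \pi_{eq_quot (proj_equiv R n)}%qT @^-1` S2 = S1 by [].
    apply/seteqP; split => v; rewrite /S1 /S2 /=;
      have [c c0] := hcoord_line_of v; rewrite /line_of => ->; rewrite mxE mulf_eq0 negb_or c0 //.
  by [].
have cv : continuous (@vec_of R n) by exact: initial_continuous.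
have : open [set v : 'rV[C]_n | v 0 k != 0].
  rewrite openE => v /= v0; apply/nbhs_N1; exists (n1 (v 0 k)).
    by rewrite lt_neqAle n1_ge0 andbT eq_sym; apply: contra v0 => /eqP h; apply/eqP/n1_eq0; rewrite h.
  move=> w; apply: contraTneq => w0; rewrite -leNgt -(n1N (v 0 k)).
  by have := n1_le_N1 (w - v) k; rewrite !mxE w0 add0r.
by move=> h; apply: (open_comp _ h) => v _; exact: cv.
Qed.

Lemma insert1_col' (s : 'rV[C]_n) : s 0 k = 1 -> insert1 k (col' k s) = s.
Proof.
move=> sk; apply/rowP => j; rewrite mxE; case: unliftP => [i ->|->]; last by rewrite sk.
by rewrite mxE.
Qed.

Lemma hcoord_line (s : nonzero_vec R n) (l : projspace R n) (c : C) : c != 0 ->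
  vec_of s = c *: hcoord l -> line_of s = l.
Proof.
move=> c0 sE; rewrite -[RHS](@reprK _ {eq_quot (proj_equiv R n)}%qT l).
apply/eqmodP; rewrite /= /proj_rel sE; apply/andP; split; first exact: scalemx_sub.
by rewrite -[X in (X <= _)%MS](scalerK c0); exact: scalemx_sub.
Qed.

Lemma affine_cancel (l : projspace R n) : hcoord l 0 k != 0 ->
  cinv (affine_chart R k) (cmap (affine_chart R k) l) = l.
Proof.
move=> h0; apply: (@hcoord_line _ _ ((hcoord l 0 k)^-1)); first by rewrite invr_eq0.
transitivity (insert1 k (cmap (affine_chart R k) l)); first by rewrite /vec_of /set_val /=.
by rewrite insert1_col'// mxE mulVf.
Qed.

(** The linear part of the affine map [insert1 k] on the second block: the constant 1 at place [k]
    becomes 0. *)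
Definition insL (w : 'rV[C]_(n + n.-1)) : 'rV[C]_n :=
  \row_j (if unlift k j is Some i then rsubmx w 0 i else 0).

Lemma insL_diff x : differentiable (fun z : 'rV[C]_(n + n.-1) => insert1 k (rsubmx z)) x /\
  'd (fun z : 'rV[C]_(n + n.-1) => insert1 k (rsubmx z)) x = insL :> (_ -> _).
Proof.
apply: affine_diff.
  move=> c u v; apply/rowP => j; rewrite !mxE; case: unliftP => [i _|_]; rewrite ?mxE //.
  by rewrite mulr0 addr0.
by move=> z h; apply/rowP => j; rewrite !mxE; case: unliftP => [i _|_]; rewrite ?mxE // addr0.
Qed.

Lemma lsub_diff m (x : 'rV[C]_(n + m)) : differentiable (fun z : 'rV[C]_(n + m) => lsubmx z) x /\
  'd (fun z : 'rV[C]_(n + m) => lsubmx z) x = lsubmx :> (_ -> _).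
Proof. by apply: affine_diff => [c u v|u v]; rewrite ?linearP ?linearD. Qed.

Lemma insL_inj w : lsubmx w = 0 -> insL w = 0 -> w = 0.
Proof.
move=> l0 i0; rewrite -[w]hsubmxK l0; apply/rowP => j; rewrite !mxE.
case: fintype.split => i; first by rewrite mxE.
by have /rowP/(_ (lift k i)) := i0; rewrite !mxE liftK mxE.
Qed.

End aff.
End Proj.

(** * The blow-down map *)

(* [pi] is the blow-down map; [Om k] is the part y_k <> 0 of the blow-up of the domain of [phi],
   and [sg k] is the vector (y_j / y_k)_j. *)
Record blowdown (R : realType) n (X Y : topologicalType) (A : set (chart R n X)) (P : X)
    (phi : chart R n X) (B : set (chart R n Y)) (pi : Y -> X) (Om : 'I_n -> set Y)
    (sg : 'I_n -> Y -> 'rV[R[i]]_n) : Prop := Blowdown {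
  bd_cont : continuous pi;
  bd_holo : forall psi eta y, B psi -> A eta -> cdom psi y -> cdom eta (pi y) ->
    differentiable (cmap eta \o pi \o cinv psi) (cmap psi y);
  bd_inj : forall psi eta y, B psi -> A eta -> cdom psi y -> cdom eta (pi y) -> pi y <> P ->
    forall v, 'd (cmap eta \o pi \o cinv psi) (cmap psi y) v = 0 -> v = 0;
  bd_open : forall k, open (Om k);
  bd_exc : forall y, pi y = P -> exists k, Om k y;
  bd_chart : forall k y, Om k y ->
    [/\ cdom phi (pi y), sg k y 0 k = 1 & cmap phi (pi y) = cmap phi (pi y) 0 k *: sg k y];
  bd_sg : forall j k y, Om j y -> Om k y -> sg k y = sg k y 0 j *: sg j y;
  bd_sg_holo : forall psi k y, B psi -> cdom psi y -> Om k y ->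
    differentiable (sg k \o cinv psi) (cmap psi y);
  bd_sg_inj : forall psi eta k y, B psi -> A eta -> cdom psi y -> cdom eta (pi y) -> Om k y ->
    forall v, 'd (cmap eta \o pi \o cinv psi) (cmap psi y) v = 0 ->
      'd (sg k \o cinv psi) (cmap psi y) v = 0 -> v = 0 }.

(** * From the gluing to the blow-down map *)

Section Blowup.
Variable R : realType.
Local Notation C := R[i].
Variables (n : nat) (X Y : topologicalType) (A : set (chart R n X)) (P : X) (B : set (chart R n Y)).
Hypotheses (hX : complex_manifold A) (hY : complex_manifold B).

Lemma near_pull (psi : chart R n Y) y (Q : set Y) : is_chart psi -> cdom psi y -> nbhs y Q ->
  \forall z \near cmap psi y, Q (cinv psi z) /\ cmap psi (cinv psi z) = z.
Proof.
move=> cp Dy; rewrite nbhsE => -[V [oV Vy] sV].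
by apply: filterS (near_cimg cp oV Dy Vy) => z /(cimgP cp)[_ /sV h1 h2].
Qed.

Lemma diff_left_inv m p (f : 'rV[C]_m -> 'rV[C]_p) (g : 'rV[C]_p -> 'rV[C]_m) (x v : 'rV[C]_m) :
  (\forall y \near x, g (f y) = y) -> differentiable f x -> differentiable g (f x) ->
  'd f x v = 0 -> v = 0.
Proof.
move=> gf df dg dv0; have [_ /(_ v)] := diff_compV gf df dg.
rewrite dv0 (clin0 (clin_d _ _)) => <-.
by have [h1 h2] := @affine_diff R m m (fun y => y) (fun y => y) (fun c u w => erefl _) (fun x h => erefl _) x; rewrite h2.
Qed.

Lemma prod_cancel (eta : chart R n X) k (p : X * projspace R n) : is_chart eta -> cdom eta p.1 ->
  hcoord p.2 0 k != 0 ->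
  cinv (prod_chart eta (affine_chart R k)) (cmap (prod_chart eta (affine_chart R k)) p) = p.
Proof.
case: p => p l ceta /= D1 hk; rewrite row_mxKl row_mxKr (chart_cancel ceta D1).
by congr (_, _); exact: (affine_cancel hk).
Qed.

Section embedding.
Variables (m : nat) (Z : topologicalType) (A' : set (chart R m Z)) (S : set Z) (f : S -> Y).
Hypothesis hf : open_holo_embedding A' B f.

Lemma ohe_rep s : exists G : Y -> Z, [/\ {for f s, continuous G}, holo_at B A' G (f s),
  G (f s) = set_val s & \forall y \near f s, exists2 t, f t = y & G y = set_val t].
Proof.
have [W [G [oW Ws hG GE]]] := ohe_holo_inv hf s.
exists G; split; [by have [] := hG _ Ws|exact: hG|exact: GE|].
have : open_nbhs (f s) (W `&` range f) by split; [exact: openI oW (ohe_open hf)|split => //; exists s].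
by move=> /open_nbhs_nbhs; apply: filterS => y [Wy [t _ tE]]; exists t => //; rewrite -tE GE// tE.
Qed.

(** The local extension [F] of [f] is a left inverse of [G] near [f s]. Only injectivity of the
    differential can be expected: [Z] may have a larger dimension than [Y], as for the product with
    the projective space. *)
Lemma ohe_diff s (G : Y -> Z) psi zeta : {for f s, continuous G} -> holo_at B A' G (f s) ->
  G (f s) = set_val s -> (\forall y \near f s, exists2 t, f t = y & G y = set_val t) ->
  B psi -> A' zeta -> cdom psi (f s) -> cdom zeta (set_val s) ->
  (\forall y \near f s, cinv zeta (cmap zeta (G y)) = G y) ->
  differentiable (cmap zeta \o G \o cinv psi) (cmap psi (f s)) /\
  forall v, 'd (cmap zeta \o G \o cinv psi) (cmap psi (f s)) v = 0 -> v = 0.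
Proof.
move=> cG hG Gs nG Bpsi Az D1 D2 nz; have cpsi := cm_chart hY Bpsi.
have [W [F [oW Ws hF FE]]] := ohe_holo hf s.
have Dz : cdom zeta (G (f s)) by rewrite Gs.
have dG := hG.2 psi zeta Bpsi Az D1 Dz; split; first exact: dG.
have DF : cdom psi (F (G (f s))) by rewrite Gs FE.
have [_ dF] : holo_at A' B F (G (f s)) by rewrite Gs; exact: hF.
have {dF} := dF zeta psi Az Bpsi Dz DF.
have E0 : (cmap zeta \o G \o cinv psi) (cmap psi (f s)) = cmap zeta (G (f s)).
  by rewrite /= (chart_cancel cpsi).
rewrite -E0 => dF v; apply: (diff_left_inv _ dG dF).
have nW : nbhs (f s) (G @^-1` W) by apply: cG; rewrite Gs; exact: open_nbhs_nbhs (conj oW Ws).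
apply: filterS (near_pull cpsi D1 (filterI nG (filterI nz nW))) => z [[[t tE Gt] [E1 Wz]] Ez].
transitivity (cmap psi (F (G (cinv psi z)))); first exact: (congr1 (fun p => cmap psi (F p)) E1).
transitivity (cmap psi (cinv psi z)); last exact: Ez.
congr (cmap psi _); rewrite Gt FE; first exact: tE.
by rewrite -Gt; exact: Wz.
Qed.

End embedding.

Variable phi : chart R n X.
Variables (a : blowup_local phi -> Y) (b : ~` [set P] -> Y).
Hypotheses (ha : open_holo_embedding (prod_atlas A (@proj_atlas R n)) B a)
  (hb : open_holo_embedding A B b)
  (cov : range a `|` range b = setT)
  (glue : forall u q, a u = b q <-> (set_val u).1 = set_val q).
Variables (pi : Y -> X) (hc : Y -> 'rV[C]_n).
Hypotheses (pi_a : forall u, pi (a u) = (set_val u).1) (pi_b : forall q, pi (b q) = set_val q)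
  (hc_a : forall u, hc (a u) = hcoord (set_val u).2).

Lemma cov_cases y : (exists u, a u = y) \/ (exists q, b q = y).
Proof.
by have : [set: Y] y by []; rewrite -cov => - [[u _ <-]|[q _ <-]]; [left; exists u|right; exists q].
Qed.

Lemma cont_near (T : topologicalType) (f g : Y -> T) y : (\forall z \near y, f z = g z) ->
  {for y, continuous f} -> {for y, continuous g}.
Proof.
move=> fg cf N; rewrite -(nbhs_singleton fg) => /cf h.
by apply: filterS2 fg h => z fgz; rewrite /= fgz.
Qed.

Lemma pi_cont : continuous pi.
Proof.
move=> y; have [[u <-]|[q <-]] := cov_cases y.
  have [G [cG _ _ nG]] := ohe_rep ha u.
  apply: (cont_near (f := fst \o G)); first by apply: filterS nG => z [t <- /= ->].
  apply: continuous_comp; first exact: cG.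
  exact: cvg_fst.
have [G [cG _ _ nG]] := ohe_rep hb q.
by apply: (cont_near (f := G)) => //; apply: filterS nG => z [t <- ->].
Qed.

Definition Om k : set Y := [set y | range a y /\ hc y 0 k != 0].
Definition sg k y := (hc y 0 k)^-1 *: hc y.

Lemma Om_open k : open (Om k).
Proof.
rewrite openE => _ [[u _ <-] hk]; rewrite /interior.
have [G [cG _ Gu nG]] := ohe_rep ha u.
have : nbhs (a u) (G @^-1` [set p | hcoord p.2 0 k != 0]).
  apply: cG; have : nbhs (G (a u)).2 [set l : projspace R n | hcoord l 0 k != 0].
    by apply: open_nbhs_nbhs; split; [exact: hcoord_open|rewrite /= Gu -hc_a].
  exact: cvg_snd.
apply: filterS2 nG => y [t <- Gt] /=; rewrite Gt -hc_a => h.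
by split => //; exists t.
Qed.

(** In a product chart the inverse of [a] has the two blocks [pi] and [sg k] without its k-th entry;
    injectivity of its differential says that those of [pi] and [sg k] have no common kernel. *)
Lemma local_a psi eta k u : B psi -> A eta -> cdom psi (a u) -> cdom eta (pi (a u)) -> hc (a u) 0 k != 0 ->
  exists f : 'rV[C]_n -> 'rV[C]_(n + n.-1), [/\ differentiable f (cmap psi (a u)),
   \forall z \near cmap psi (a u), lsubmx (f z) = (cmap eta \o pi \o cinv psi) z,
   \forall z \near cmap psi (a u), insert1 k (rsubmx (f z)) = (sg k \o cinv psi) z &
   forall v, 'd f (cmap psi (a u)) v = 0 -> v = 0].
Proof.
move=> Bpsi Aeta D1 D2 hk.
have cpsi := cm_chart hY Bpsi; have ceta := cm_chart hX Aeta.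
have [G [cG hG Gu nG]] := ohe_rep ha u.
pose zeta := prod_chart eta (affine_chart R k).
have Az : prod_atlas A (@proj_atlas R n) zeta by exists eta => //; exists (affine_chart R k) => //; exists k.
have Dz : cdom zeta (set_val u) by split; rewrite /= -?pi_a -?hc_a.
have nD : nbhs (a u) (pi @^-1` cdom eta).
  by apply: pi_cont; exact: open_nbhs_nbhs (conj (chart_open_dom ceta) D2).
have nO : nbhs (a u) (Om k) by apply: open_nbhs_nbhs; split; [exact: Om_open|split => //; exists u].
have nE : \forall y \near a u, (G y).1 = pi y /\ hcoord (G y).2 = hc y.
  by apply: filterS nG => y [t <- ->]; rewrite pi_a hc_a.
have nz : \forall y \near a u, cinv zeta (cmap zeta (G y)) = G y.
  apply: filterS (filterI nE (filterI nD nO)) => y [[E1 E2] [Dy [_ Oy]]].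
  by apply: prod_cancel; [exact: ceta|rewrite E1; exact: Dy|rewrite E2; exact: Oy].
have [dG inj] := ohe_diff ha cG hG Gu nG Bpsi Az D1 Dz nz.
exists (cmap zeta \o G \o cinv psi); split; [exact: dG| | |exact: inj].
- by apply: filterS (near_pull cpsi D1 nE) => z [[E _] _]; rewrite /= row_mxKl E.
- apply: filterS (near_pull cpsi D1 (filterI nE nO)) => z [[[_ E] [_ Oz]] _].
  by rewrite /= row_mxKr E insert1_col'// mxE mulVf.
Qed.

Lemma local_b psi eta q : B psi -> A eta -> cdom psi (b q) -> cdom eta (pi (b q)) ->
  differentiable (cmap eta \o pi \o cinv psi) (cmap psi (b q)) /\
  forall v, 'd (cmap eta \o pi \o cinv psi) (cmap psi (b q)) v = 0 -> v = 0.
Proof.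
move=> Bpsi Aeta D1 D2.
have cpsi := cm_chart hY Bpsi; have ceta := cm_chart hX Aeta.
have [G [cG hG Gq nG]] := ohe_rep hb q.
have nE : \forall y \near b q, G y = pi y by apply: filterS nG => y [t <- ->].
have nD : nbhs (b q) (pi @^-1` cdom eta).
  by apply: pi_cont; exact: open_nbhs_nbhs (conj (chart_open_dom ceta) D2).
have nz : \forall y \near b q, cinv eta (cmap eta (G y)) = G y.
  by apply: filterS2 nE nD => y E Dy; apply: (chart_cancel ceta); rewrite E.
have Dz : cdom eta (set_val q) by rewrite -pi_b.
have [dG inj] := ohe_diff hb cG hG Gq nG Bpsi Aeta D1 Dz nz.
have EG : \forall z \near cmap psi (b q), (cmap eta \o G \o cinv psi) z = (cmap eta \o pi \o cinv psi) z.
  by apply: filterS (near_pull cpsi D1 nE) => z [E _]; rewrite /= E.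
have [d1 d2] := diff_near_eq EG dG; split; first exact: d1.
by move=> v; rewrite d2; exact: inj.
Qed.

Lemma pi_a_diff psi eta k y : B psi -> A eta -> cdom psi y -> cdom eta (pi y) -> Om k y ->
  [/\ differentiable (cmap eta \o pi \o cinv psi) (cmap psi y),
    differentiable (sg k \o cinv psi) (cmap psi y) &
    forall v, 'd (cmap eta \o pi \o cinv psi) (cmap psi y) v = 0 ->
      'd (sg k \o cinv psi) (cmap psi y) v = 0 -> v = 0].
Proof.
move=> Bpsi Aeta D1 D2 [[u _ uE] hk]; rewrite -uE in D1 D2 hk *.
have [f [df E1 E2 inj]] := local_a Bpsi Aeta D1 D2 hk.
have [l1 l2] := lsub_diff (f (cmap psi (a u))).
have [i1 i2] := insL_diff k (f (cmap psi (a u))).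
have [d1 d1E] := diff_compV E1 df l1.
have [d2 d2E] := diff_compV (g := fun z => insert1 k (rsubmx z)) E2 df i1.
split; [exact: d1|exact: d2|] => v h1 h2; apply: inj.
set w := 'd f _ v.
apply: (@insL_inj _ n k).
  exact: (etrans (esym (etrans (d1E v) (congr1 (fun g => g w) l2))) h1).
exact: (etrans (esym (etrans (d2E v) (congr1 (fun g => g w) i2))) h2).
Qed.

Lemma adapted y : pi y = P -> range a y.
Proof.
have [[u <-] _|[q <-]] := cov_cases y; first by exists u.
by rewrite pi_b => qP; case: (set_valP q qP).
Qed.

Hypothesis phiP : cmap phi P = 0.

Lemma blowdown_ab : blowdown A P phi B pi Om sg.
Proof.
have hc0 u : exists k, hc (a u) 0 k != 0.
  rewrite hc_a; have : hcoord (set_val u).2 != 0 by exact: (set_valP (repr ((set_val u).2 : {eq_quot _}%qT))).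
  by move=> /rV0Pn.
(* The equations are given for [i < j]; symmetry and the trivial case yield all pairs. *)
have prop u i j : cmap phi (pi (a u)) 0 i * hc (a u) 0 j = cmap phi (pi (a u)) 0 j * hc (a u) 0 i.
  rewrite pi_a hc_a; have [_ H] := set_valP u.
  have [ij|ji|ij] := ltngtP (nat_of_ord i) j; [exact: H|exact/esym/H|by rewrite (val_inj ij)].
(* A point of the first piece off the exceptional divisor also belongs to the second one, by the
   gluing condition. *)
have notP y : pi y <> P -> exists q, b q = y.
  have [[u <-]|//] := cov_cases y; rewrite pi_a => uP.
  have qP : (set_val u).1 \in ~` [set P] by apply/mem_set.
  exists (exist _ (set_val u).1 qP); exact/esym/glue.
split.
- exact: pi_cont.
- move=> psi eta y Bpsi Aeta D1 D2; have [[u uE]|[q qE]] := cov_cases y.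
    have [k hk] := hc0 u; have [|//] := @pi_a_diff psi eta k y Bpsi Aeta D1 D2.
    by rewrite -uE; split => //; exists u.
  by rewrite -qE in D1 D2 *; have [] := local_b Bpsi Aeta D1 D2.
- move=> psi eta y Bpsi Aeta D1 D2 /notP[q qE].
  by rewrite -qE in D1 D2 *; have [] := local_b Bpsi Aeta D1 D2.
- exact: Om_open.
- by move=> y /adapted[u _ <-]; have [k hk] := hc0 u; exists k; split => //; exists u.
- move=> k _ [[u _ <-] hk]; split.
  + by rewrite pi_a; have [] := set_valP u.
  + by rewrite mxE mulVf.
  + by apply/rowP => j; rewrite !mxE mulrCA -prop mulrC mulfK// mulrC.
- move=> j k y [_ hj] [_ hk]; apply/rowP => i; rewrite !mxE; field.
  by rewrite hj hk.
- move=> psi k y Bpsi D1 Ok; have [eta Aeta D2] := cm_cover hX (pi y).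
  by have [] := pi_a_diff Bpsi Aeta D1 D2 Ok.
- move=> psi eta k y Bpsi Aeta D1 D2 Ok.
  by have [] := pi_a_diff Bpsi Aeta D1 D2 Ok.
Qed.

End Blowup.

Lemma blowdownP (R : realType) n (X Y : topologicalType) (A : set (chart R n X)) (P : X)
    (B : set (chart R n Y)) : complex_manifold A -> complex_manifold B -> is_blowup A P B ->
  exists phi pi Om sg, [/\ holo_coordinates A phi, cdom phi P, cmap phi P = 0 &
    blowdown A P phi B pi Om sg].
Proof.
move=> hX hY [phi [[hphi DP phi0] [a [b [ha hb cov glue]]]]].
have /choice[pi Hpi] : forall y, exists x, (exists2 u, a u = y & (set_val u).1 = x) \/ (exists2 q, b q = y & set_val q = x).
  move=> y; have [[u <-]|[q <-]] := cov_cases cov y; first by exists (set_val u).1; left; exists u.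
  by exists (set_val q); right; exists q.
(* The value 0 off the range of [a] is arbitrary: [Om] lies inside this range. Injectivity of [a]
   makes the value on the range well defined. *)
have /choice[hc Hhc] : forall y, exists s : 'rV[R[i]]_n, forall u, a u = y -> s = hcoord (set_val u).2.
  move=> y; have [[u uE]|h] := pselect (exists u, a u = y); last by exists 0 => u uE; case: h; exists u.
  by exists (hcoord (set_val u).2) => u'; rewrite -uE => /(ohe_inj ha) ->.
have pi_a u : pi (a u) = (set_val u).1.
  by have [[u' /(ohe_inj ha) ->]|[q /esym/glue -> ->]] := Hpi (a u).
have pi_b q : pi (b q) = set_val q.
  by have [[u /glue -> ->]|[q' /(ohe_inj hb) -> ->]] := Hpi (b q).
exists phi, pi, (Om a hc), (sg hc); split => //.
apply: (blowdown_ab hX hY ha hb cov glue pi_a pi_b) => u; exact/Hhc.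
Qed.

(** * The metric on the blow-up *)

Section Compactness.
Variable R : realType.
Local Notation C := R[i].

Lemma nq_continuous n : continuous (@nq R n).
Proof. by move=> x; exact: (CK_cont (CK_nq (@openT _) 0) (x := x) I). Qed.

Lemma nq_lt_open n (r : R) : open [set z : 'rV[C]_n | nq z < r].
Proof. by apply: (open_comp _ (@open_lt R r)) => x _; exact: nq_continuous. Qed.

Lemma nq_gt_open n (r : R) : open [set z : 'rV[C]_n | r < nq z].
Proof. by apply: (open_comp _ (@open_gt R r)) => x _; exact: nq_continuous. Qed.

Lemma nq_le_closed n (r : R) : closed [set z : 'rV[C]_n | nq z <= r].
Proof.
have -> : [set z : 'rV[C]_n | nq z <= r] = ~` [set z | r < nq z].
  by apply/seteqP; split => z /=; [move=> h; apply/negP; rewrite -leNgt|move=> /negP; rewrite -leNgt].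
apply: open_closedC; exact: nq_gt_open.
Qed.

Lemma complex_continuous : continuous (fun p : R * R => (p.1 +i* p.2)%C).
Proof.
move=> [a b] N /nbhs_n1[d d0 Hd].
have d2 : 0 < d / 2 by rewrite divr_gt0.
exists (ball a (d / 2), ball b (d / 2)); first by split; exact: nbhsx_ballx.
move=> [a' b'] [/= ha hb]; apply: Hd; rewrite /n1 ReD ReN ImD ImN /=.
move: ha hb; rewrite -ball_normE /= !(distrC _ a') !(distrC _ b') => ha hb; lra.
Qed.

Lemma nq_compact n (r : R) : compact [set z : 'rV[C]_n | nq z <= r].
Proof.
pose K := r + 1.
have cB : compact ((fun p : R * R => (p.1 +i* p.2)%C) @` (`[- K, K]%classic `*` `[- K, K]%classic)).
  apply: continuous_compact; first by apply: continuous_subspaceT; exact: complex_continuous.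
  by apply: compact_setX; exact: segment_compact.
have cb := rV_compact (fun _ : 'I_n => cB).
apply: (subclosed_compact _ cb); first exact: nq_le_closed.
move=> z /= hz j.
have hr c : - K <= rc c z <= K.
  rewrite -ler_norml; have h1 := le_trans (nq_rc z c) hz.
  have := sqr_ge0 (`|rc c z| - 1); rewrite sqrrB1 real_normK ?num_real// => h2.
  have := normr_ge0 (rc c z); rewrite /K; move: h1 h2; set q := rc c z ^+ 2; lra.
exists (rc (j, true) z, rc (j, false) z); last by rewrite /rc /=; case: (z _ _).
by split => /=; rewrite in_itv /=.
Qed.

(** Compactness of the unit sphere, on which the inverse of [Q w w] is continuous and hence
    bounded. *)
Lemma quad_lower n (Q : 'rV[C]_n -> 'rV[C]_n -> R) : bilin Q -> (forall w, w != 0 -> 0 < Q w w) ->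
  exists2 c : R, 0 < c & forall w, c * nq w <= Q w w.
Proof.
move=> hQ pQ.
pose S := [set w : 'rV[C]_n | nq w <= 1] `&` ~` [set w | nq w < 1].
have cS : compact S.
  by apply: compact_closedI; [exact: nq_compact|apply: open_closedC; exact: nq_lt_open].
have SP w : S w -> nq w = 1.
  by move=> [/= h1 /negP]; rewrite -leNgt => h2; apply/eqP; rewrite eq_le h1.
have cQ : continuous (fun w => Q w w).
  move=> x; have H : CK 0 setT (fun w => \sum_c \sum_d rc c w * rc d w * Q (rb R c) (rb R d)).
    apply: CK_sum; first exact: openT.
    move=> c; apply: CK_sum; first exact: openT.
    move=> d; apply: CK_mul; first exact: openT.
      by apply: CK_mul; [exact: openT|exact: (CK_rc openT)|exact: (CK_rc openT)].
    by apply: CK_cst; exact: openT.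
  have := CK_cont H (x := x) I.
  by rewrite (_ : (fun w => _) = (fun w => Q w w))//; apply/funext => w; rewrite -bilE.
have cV : {within S, continuous (fun w => (Q w w)^-1)}.
  apply: continuous_in_subspaceT => w /set_mem /SP w1; apply: (@continuous_comp _ _ _ (fun w => Q w w) (fun t : R => t^-1)); first exact: cQ.
  apply: inv_continuous.
  rewrite gt_eqF// pQ//; apply: contra_eq_neq w1 => ->; rewrite nq0 eq_sym; exact: oner_neq0.
have [M [_ HM]] := compact_bounded (continuous_compact cV cS).
have {HM} HM := HM (`|M| + 1) (ltr_pwDr ltr01 (ler_norm M)).
exists (`|M| + 1)^-1; first by rewrite invr_gt0 ltr_wpDl.
have M1 : 0 < `|M| + 1 by rewrite ltr_wpDl.
move=> w; have [->|w0] := eqVneq w 0; first by rewrite nq0 mulr0 (bil0l hQ).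
have q0 := nq_gt0 w0; pose s := Num.sqrt (nq w).
have s0 : 0 < s by rewrite sqrtr_gt0.
have ss : s ^+ 2 = nq w by rewrite sqr_sqrtr ?ltW.
pose u := (s^-1)%:C%C *: w.
have nu : nq u = 1 by rewrite /nq rdotZl rdotZr -/(nq w) -ss; field; rewrite gt_eqF.
have wE : w = s%:C%C *: u by rewrite scalerA -rmorphM mulfV ?gt_eqF// scale1r.
have Su : S u by split => /=; rewrite nu ?ltxx.
have Qu : 0 < Q u u by apply: pQ; apply: contra_eq_neq nu => ->; rewrite nq0 eq_sym; exact: oner_neq0.
have : `|(Q u u)^-1| <= `|M| + 1 := HM _ (ex_intro2 _ _ u Su erefl).
rewrite (@ger0_norm _ (Q u u)^-1) ?invr_ge0 ?(ltW Qu)// => h.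
rewrite wE (bilZl hQ) (bilZr hQ) mulrA -expr2 /nq rdotZl rdotZr -/(nq u) nu mulr1 -expr2 mulrC.
rewrite ler_pM2l ?exprn_gt0//.
by rewrite -[leRHS]invrK lef_pV2 ?posrE ?invr_gt0.
Qed.

Lemma bil_small n (Q : 'rV[C]_n -> 'rV[C]_n -> R) (e : R) : bilin Q ->
  (forall c d, `|Q (rb R c) (rb R d)| <= e) ->
  forall w, `|Q w w| <= e * (#|{: 'I_n * bool}|%:R ^+ 2) * nq w.
Proof.
move=> hQ Qe w; rewrite (bilE hQ) (le_trans (ler_norm_sum _ _ _))//.
have -> : e * (#|{: 'I_n * bool}|%:R ^+ 2) * nq w = \sum_(c : 'I_n * bool) \sum_(d : 'I_n * bool) e * nq w.
  by rewrite !sumr_const -[RHS]mulr_natl -[X in _ = _ * X]mulr_natl; ring.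
apply: ler_sum => c _; rewrite (le_trans (ler_norm_sum _ _ _))//; apply: ler_sum => d _.
rewrite !normrM mulrC; apply: ler_pM => //.
have h1 := nq_rc w c; have h2 := nq_rc w d.
have := sqr_ge0 (`|rc c w| - `|rc d w|); rewrite sqrrB !real_normK ?num_real// => h3.
by move: h1 h2 h3; set p := _ ^+ 2; set q := _ ^+ 2; rewrite mulr2n; lra.
Qed.

(** [T z] has finitely many coefficients, continuous in [z], so half of the constant at [z0]
    survives nearby, uniformly in [w]. *)
Lemma model_lower n (V : set 'rV[C]_n) (T : 'rV[C]_n -> 'rV[C]_n -> 'rV[C]_n -> R) z0 :
  model V T -> open V -> V z0 -> (forall w, w != 0 -> 0 < T z0 w w) ->
  exists2 c : R, 0 < c & \forall z \near z0, forall w, c * nq w <= T z w w.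
Proof.
move=> mT oV Vz pT; have [c c0 Hc] := quad_lower (model_bilin mT Vz) pT.
pose K : R := #|{: 'I_n * bool}|%:R ^+ 2.
have K0 : 0 <= K by exact: sqr_ge0.
exists (c / 2); first exact: divr_gt0.
pose e := c / 2 / (K + 1).
have e0 : 0 < e by rewrite /e !divr_gt0// ltr_wpDl.
have eK : e * K <= c / 2.
  by rewrite /e -mulrA ler_piMr// ?divr_ge0 ?ltW// mulrC ltr_pdivrMr ?ltr_wpDl// mul1r ltrDl.
have H : \forall z \near z0, forall p : ('I_n * bool) * ('I_n * bool),
    `|T z (rb R p.1) (rb R p.2) - T z0 (rb R p.1) (rb R p.2)| <= e.
  apply: (@filter_forall _ _ (fun p z => `|T z (rb R p.1) (rb R p.2) - T z0 (rb R p.1) (rb R p.2)| <= e) (nbhs z0) (nbhs_filter z0)) => p.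
  have /contR_eps /(_ e e0)[d d0 Hd] := CK_cont (ml_smooth mT 0 (rb R p.1) (rb R p.2)) Vz.
  by apply/nbhs_N1; exists d => // w /Hd /ltW.
apply: filterS2 H (open_nbhs_nbhs (conj oV Vz)) => z Hz Vz' w.
pose Q v w := T z v w - T z0 v w.
have [a1 a2] := model_bilin mT Vz'; have [b1 b2] := model_bilin mT Vz.
have hQ : bilin Q.
  by split => a p q r; rewrite /Q ?(a1, b1) ?(a2, b2); ring.
have := bil_small hQ (fun c d => Hz (c, d)) w; rewrite -/K ler_norml => /andP[h1 _].
have h2 := Hc w; have := ler_wpM2r (nq_ge0 w) eK => h3.
by move: h1; rewrite /Q; move: h2 h3; set q := nq w; move: (T z w w) (T z0 w w) (e * K) => t t0 s; lra.
Qed.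

(** The image of a compact ball in a Hausdorff space. It makes the complement of the support of k
    open, so that k extends by zero beyond the coordinate ball. *)
Lemma chart_ball_closed n (X : topologicalType) (phi : chart R n X) (r : R) :
  hausdorff_space X -> is_chart phi -> [set z | nq z <= r] `<=` cimg phi setT ->
  closed [set p | cdom phi p /\ nq (cmap phi p) <= r].
Proof.
move=> hX cphi sub.
have -> : [set p | cdom phi p /\ nq (cmap phi p) <= r] = cinv phi @` [set z | nq z <= r].
  apply/seteqP; split => [p [Dp hp]|_ [z hz <-]]; first by exists (cmap phi p); rewrite ?(chart_cancel cphi).
  by have [h1 _ h3] := cimgP cphi (sub z hz); split => //; rewrite h3.
apply: compact_closed => //; apply: continuous_compact; last exact: nq_compact.
apply: continuous_in_subspaceT => z /set_mem/sub/(cimgP cphi)[h1 _ <-].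
exact: chart_cont_inv.
Qed.

End Compactness.

(** * Operations on local tensors, and the Fubini-Study tensor *)

Section Local.
Variable R : realType.
Local Notation C := R[i].

Section N.
Variables (n : nat) (V : set 'rV[C]_n).
Hypothesis oV : open V.
Implicit Types T : 'rV[C]_n -> 'rV[C]_n -> 'rV[C]_n -> R.

Lemma model_eq T T' : (forall z, V z -> forall v w, T z v w = T' z v w) -> model V T -> model V T'.
Proof.
move=> E h; split.
- by move=> z Vz a u v w; rewrite -!E// (ml_lin h).
- by move=> z Vz v w; rewrite -!E// (ml_sym h).
- by move=> z Vz v w; rewrite -!E// (ml_J h).
- by move=> k v w; apply: (CK_eq oV) (ml_smooth h k v w) => z Vz; exact: E.
Qed.

Lemma closedT_eq T T' : (forall z, V z -> forall v w, T z v w = T' z v w) -> model V T ->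
  closedT V T -> closedT V T'.
Proof.
move=> E h cT z Vz u v w.
have H a b c : rderive (fun y => T' y b c) a z = rderive (fun y => T y b c) a z.
  apply: (@rderive_near _ _ (fun y => T y b c) (fun y => T' y b c) V a z oV Vz _ _).2.
    by move=> y Vy; exact: E.
  exact: ((ml_smooth h 1 b c).2 a).1.
by rewrite !H; exact: cT.
Qed.

Lemma model0 : model V (fun _ _ _ => 0).
Proof.
split => //; first by move=> z _ a u v w; rewrite mulr0 addr0.
by move=> k v w; apply: CK_cst.
Qed.

Lemma closedT0 : closedT V (fun _ _ _ => 0).
Proof.
move=> z Vz u v w; have E a : rderive (fun _ : 'rV[C]_n => 0 : R) a z = 0.
  by have [] := (rderiveP (fun=> 0 : R) a z 0).1 (is_derive_cst _ _ _).
by rewrite !E !addr0.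
Qed.

Lemma model_add T T' : model V T -> model V T' -> model V (fun z v w => T z v w + T' z v w).
Proof.
move=> h h'; split.
- by move=> z Vz a u v w; rewrite (ml_lin h)// (ml_lin h')//; ring.
- by move=> z Vz v w; rewrite (ml_sym h)// (ml_sym h').
- by move=> z Vz v w; rewrite (ml_J h)// (ml_J h').
- by move=> k v w; apply: CK_add => //; [exact: ml_smooth h k v w|exact: ml_smooth h' k v w].
Qed.

Lemma model_mul (f : 'rV[C]_n -> R) T : (forall k, CK k V f) -> model V T ->
  model V (fun z v w => f z * T z v w).
Proof.
move=> hf h; split.
- by move=> z Vz a u v w; rewrite (ml_lin h)//; ring.
- by move=> z Vz v w; rewrite (ml_sym h).
- by move=> z Vz v w; rewrite (ml_J h).
- by move=> k v w; apply: CK_mul => //; exact: ml_smooth h k v w.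
Qed.

Lemma closedT_add (c : R) T T' : model V T -> model V T' -> closedT V T -> closedT V T' ->
  closedT V (fun z v w => T z v w + c * T' z v w).
Proof.
move=> h h' cT cT' z Vz u v w.
have E a b d : rderive (fun y => T y b d + c * T' y b d) a z =
    rderive (fun y => T y b d) a z + c * rderive (fun y => T' y b d) a z.
  apply: (proj2 ((rderiveP (fun y => T y b d + c * T' y b d) a z _).1 _)).
  apply: is_derive_eq1 (is_deriveD (CK_S (ml_smooth h 1 b d) a Vz)
    (is_deriveM (is_derive_cst _ _ _) (CK_S (ml_smooth h' 1 b d) a Vz))) _.
  by rewrite scaler0 addr0.
rewrite !E; have := cT z Vz u v w; have := cT' z Vz u v w.
set a1 := rderive _ _ _; set a2 := rderive _ _ _; set a3 := rderive _ _ _.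
set b1 := rderive _ _ _; set b2 := rderive _ _ _; set b3 := rderive _ _ _ => ha hb.
transitivity ((b1 + b2 + b3) + c * (a1 + a2 + a3)); first by ring.
by rewrite ha hb mulr0 addr0.
Qed.

End N.

Lemma model_subset n (U V : set 'rV[C]_n) T : V `<=` U -> model U T -> model V T.
Proof.
move=> VU h; split.
- by move=> z /VU; exact: ml_lin h z.
- by move=> z /VU; exact: ml_sym h z.
- by move=> z /VU; exact: ml_J h z.
- by move=> k v w; apply: CK_subset VU _; exact: ml_smooth h k v w.
Qed.

Lemma is_derive_near0 (f g : R -> R) (a b d : R) : 0 < d -> (forall t, `|t| < d -> f t = g t) ->
  is_derive (0 : R) 1 f a -> is_derive (0 : R) 1 g b -> a = b.
Proof.
move=> d0 fg; apply: (@is_derive_unique R f g 0 a b `]- d, d[%classic).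
- exact: interval_open.
- by rewrite /= in_itv /= oppr_lt0 d0.
- by move=> y; rewrite /= in_itv /= -ltr_norml; exact: fg.
Qed.

Section smul.
Variables (n p N : nat) (l : 'rV[C]_n -> 'rV[C]_p) (s m : 'rV[C]_n -> 'rV[C]_N) (j : 'I_p).
Variables (U : set 'rV[C]_n) (x : 'rV[C]_n).
Hypotheses (oU : open U) (Ux : U x) (mE : forall z, U z -> m z = l z 0 j *: s z).
Hypotheses (dl : differentiable l x) (ds : differentiable s x) (dm : differentiable m x).

(** The product rule with a complex scalar factor, read off real and imaginary parts along the real
    line of direction [v]. *)
Lemma diff_smul v : 'd m x v = l x 0 j *: 'd s x v + 'd l x v 0 j *: s x.
Proof.
have [d d0 Hd] := open_N1 oU Ux.
have hU : exists2 e : R, 0 < e & forall t : R, `|t| < e -> U (x + t%:C%C *: v).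
  have v1 : 0 < N1 v + 1 by rewrite ltr_wpDl// N1_ge0.
  exists (d / (N1 v + 1)); first exact: divr_gt0.
  move=> t ht; apply: Hd; rewrite addrC addKr N1Z.
  move: ht; rewrite ltr_pdivlMr// mulrDr mulr1 => ht.
  by apply: le_lt_trans ht; rewrite lerDl.
have [e e0 He] := hU.
have x0 : x + (0 : R)%:C%C *: v = x by rewrite scale0r addr0.
pose Dl c := rc_diff_line v c dl; pose Ds c := rc_diff_line v c ds; pose Dm c := rc_diff_line v c dm.
apply: rc_inj => -[i []].
- have D2 : is_derive (0 : R) 1 (fun t : R =>
      rc (j, true) (l (x + t%:C%C *: v)) * rc (i, true) (s (x + t%:C%C *: v)) -
      rc (j, false) (l (x + t%:C%C *: v)) * rc (i, false) (s (x + t%:C%C *: v)))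
      (rc (i, true) (l x 0 j *: 'd s x v + 'd l x v 0 j *: s x)).
    apply: is_derive_eq1 (is_deriveB (is_deriveM (Dl (j, true)) (Ds (i, true)))
      (is_deriveM (Dl (j, false)) (Ds (i, false)))) _.
    by rewrite x0 /rc /= !mxE ReD !ReM /GRing.scale /=; ring.
  apply: (is_derive_near0 e0 _ (Dm (i, true)) D2) => t ht.
  by rewrite /rc /= (mE (He t ht)) mxE ReM.
- have D2 : is_derive (0 : R) 1 (fun t : R =>
      rc (j, true) (l (x + t%:C%C *: v)) * rc (i, false) (s (x + t%:C%C *: v)) +
      rc (j, false) (l (x + t%:C%C *: v)) * rc (i, true) (s (x + t%:C%C *: v)))
      (rc (i, false) (l x 0 j *: 'd s x v + 'd l x v 0 j *: s x)).
    apply: is_derive_eq1 (is_deriveD (is_deriveM (Dl (j, true)) (Ds (i, false)))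
      (is_deriveM (Dl (j, false)) (Ds (i, true)))) _.
    by rewrite x0 /rc /= !mxE ImD !ImM /GRing.scale /=; ring.
  apply: (is_derive_near0 e0 _ (Dm (i, false)) D2) => t ht.
  by rewrite /rc /= (mE (He t ht)) mxE ImM.
Qed.

(* The Fubini-Study tensor of the projective space, pulled back to C^q \ 0. *)
Definition K0 (q : nat) : 'rV[C]_q -> 'rV[C]_q -> 'rV[C]_q -> R := KT (fun t => t^-1) (fun t => - (t^-1 ^+ 2)).

Lemma K0_gram q (z v w : 'rV[C]_q) : z != 0 -> K0 z v w = gram z v w / nq z ^+ 2.
Proof.
move=> /nq_gt0 z0; have q0 : nq z != 0 by rewrite gt_eqF.
rewrite /K0 (@KT_gram _ _ _ _ z v w 1 0)//; last by rewrite mul0r sub0r mul1r exprVn.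
  by rewrite mul0r mul0r addr0 mul1r mulrC.
by rewrite mul1r.
Qed.

Lemma nq_scale q (c : C) (z : 'rV[C]_q) : nq (c *: z) = Re (c * c^*%C) * nq z.
Proof.
have E (a : C) (b : R) : Re (a * b%:C%C) = Re a * b by rewrite ReM /= mulr0 subr0.
have := hd_nq (c *: z); rewrite hdZ hdZr hd_nq mulrA => /(congr1 (fun u : C => Re u)).
by rewrite E => h; exact: esym h.
Qed.

Lemma K0_scale q (c mu nu : C) (z v w : 'rV[C]_q) : z != 0 -> c != 0 ->
  K0 (c *: z) (c *: v + mu *: z) (c *: w + nu *: z) = K0 z v w.
Proof.
move=> z0 c0; have cz : c *: z != 0 by rewrite scaler_eq0 negb_or c0.
rewrite !K0_gram// gram_scale nq_scale.
have r0 : Re (c * c^*%C) != 0.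
  by apply: contra_neq cz => r0; apply: nq_eq0; rewrite nq_scale r0 mul0r.
have := nq_gt0 z0 => h; field.
by rewrite r0 gt_eqF.
Qed.

(** [m] and [s] span the same complex line, hence define the same map to the projective space;
    [diff_smul] brings the differential of [m] to the form that [K0_scale] absorbs. *)
Lemma K0_smul v w : s x != 0 -> l x 0 j != 0 -> pull m (@K0 N) x v w = pull s (@K0 N) x v w.
Proof.
move=> s0 l0.
exact: (etrans (f_equal3 (@K0 N) (mE Ux) (diff_smul v) (diff_smul w)) (K0_scale _ _ _ _ s0 l0)).
Qed.

End smul.

End Local.

(** * Lower bounds for the radial tensors *)

Section KTbounds.
Variables (R : realType) (n : nat).
Implicit Types z v : 'rV[R[i]]_n.

Lemma gram_ge0 z v : z != 0 -> 0 <= gram z v v.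
Proof. by move=> /nq_gt0 z0; rewrite -(pmulr_rge0 _ z0) gram_psd nq_ge0. Qed.

(** The Gram part is nonnegative. In the other part Cauchy-Schwarz gives a factor [nq z] that
    cancels the denominator, so the bound does not degenerate as [z] tends to 0. *)
Lemma KT_ge (al be : R -> R) z v (a b M : R) : z != 0 -> al (nq z) = a / nq z ->
  be (nq z) = b / nq z - a / nq z ^+ 2 -> 0 <= a -> `|b| <= M -> - (M * nq v) <= KT al be z v v.
Proof.
move=> z0 ha hb a0 bM; have q0 := nq_gt0 z0.
rewrite (KT_gram v v _ ha hb) ?gt_eqF// -!expr2.
have h1 : 0 <= a / nq z ^+ 2 * gram z v v.
  by rewrite mulr_ge0 ?gram_ge0// divr_ge0// exprn_ge0// ltW.
have := hd_le z v; set r := _ + _ => h2.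
have r0 : 0 <= r by rewrite /r addr_ge0// sqr_ge0.
have M0 : 0 <= M := le_trans (normr_ge0 b) bM.
have h3 : `|b / nq z * r| <= M * nq v.
  rewrite -mulrA normrM ler_pM// ger0_norm ?mulr_ge0 ?invr_ge0 ?(ltW q0)//.
  by rewrite mulrC ler_pdivrMr.
by move: h3; rewrite ler_norml => /andP[h3 _]; lra.
Qed.

Lemma K0_ge z v : z != 0 -> 0 <= @K0 R n z v v.
Proof.
by move=> z0; rewrite K0_gram// divr_ge0 ?gram_ge0// exprn_ge0// nq_ge0.
Qed.

(** The kernel of the Gram form is the complex line of [z]; the normalisations [z 0 k = 1] and
    [v 0 k = 0] leave only 0 in it. *)
Lemma K0_eq0 z v (k : 'I_n) : z != 0 -> z 0 k = 1 -> v 0 k = 0 -> @K0 R n z v v = 0 -> v = 0.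
Proof.
move=> z0 zk vk; have q0 := nq_gt0 z0; rewrite K0_gram// => /eqP.
rewrite mulf_eq0 invr_eq0 expf_eq0 /= (gt_eqF q0) orbF => /eqP g0.
have := gram_psd z v; rewrite g0 mulr0 => /esym h.
have {}h : (nq z)%:C%C *: v - hd v z *: z = 0 by apply: nq_eq0; rewrite h.
have hk := congr1 (fun u : 'rV[R[i]]_n => u 0 k) h; rewrite !mxE vk zk mulr0 mulr1 sub0r in hk.
move: h; rewrite (_ : hd v z = 0); last by apply/eqP; rewrite -oppr_eq0 hk.
rewrite scale0r subr0 => /eqP; rewrite scaler_eq0 => /orP[/eqP h|/eqP//].
by have /= h0 := congr1 (fun u : R[i] => Re u) h; rewrite h0 ltxx in q0.
Qed.

End KTbounds.

(** * The correction tensor near the exceptional divisor *)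

Section Kappa.
Variable R : realType.
Local Notation C := R[i].
Variables (n : nat) (X Y : topologicalType) (A : set (chart R n X)) (P : X) (B : set (chart R n Y)).
Hypotheses (hX : complex_manifold A) (hY : complex_manifold B).
Variables (phi : chart R n X) (pi : Y -> X) (Om : 'I_n -> set Y) (sg : 'I_n -> Y -> 'rV[C]_n).
Hypotheses (hphi : holo_coordinates A phi) (DP : cdom phi P) (phiP : cmap phi P = 0).
Hypothesis hbd : blowdown A P phi B pi Om sg.

Local Notation xi := (cmap phi \o pi).

(** [phi] need not belong to [A], so the differentiability of [xi] is carried over from an atlas
    chart by a transition map. *)
Lemma xi_diff psi y : B psi -> cdom psi y -> cdom phi (pi y) ->
  differentiable (xi \o cinv psi) (cmap psi y) /\
  forall eta, A eta -> cdom eta (pi y) -> 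
    forall v, 'd (cmap eta \o pi \o cinv psi) (cmap psi y) v =
      'd (transition phi eta) (cmap phi (pi y)) ('d (xi \o cinv psi) (cmap psi y) v).
Proof.
move=> Bpsi D1 D2; have cpsi := cm_chart hY Bpsi.
have dxi : differentiable (xi \o cinv psi) (cmap psi y).
  have [eta Aeta D3] := cm_cover hX (pi y); have ceta := cm_chart hX Aeta.
  exact: (diff_post cpsi ceta hphi.1 (hphi.2 _ Aeta).2 (bd_cont hbd (x := y)) D1 D3 D2 (bd_holo hbd Bpsi Aeta D1 D3)).1.
split; first exact: dxi.
move=> eta Aeta D3; have ceta := cm_chart hX Aeta.
exact: (diff_post cpsi hphi.1 ceta (hphi.2 _ Aeta).1 (bd_cont hbd (x := y)) D1 D2 D3 dxi).2.
Qed.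

Lemma xi_inj psi y v : B psi -> cdom psi y -> cdom phi (pi y) ->
  'd (xi \o cinv psi) (cmap psi y) v = 0 ->
  forall eta, A eta -> cdom eta (pi y) -> 'd (cmap eta \o pi \o cinv psi) (cmap psi y) v = 0.
Proof.
move=> Bpsi D1 D2 dv0 eta Aeta D3; have [_ H] := xi_diff Bpsi D1 D2.
have c0 := clin0 (clin_d (transition phi eta) (cmap phi (pi y))).
exact: (etrans (H eta Aeta D3 v) (etrans (f_equal _ dv0) c0)).
Qed.

Lemma xi_eq0 y : cdom phi (pi y) -> xi y = 0 -> pi y = P.
Proof. by move=> D1 /= x0; rewrite -(chart_cancel hphi.1 D1) x0 -phiP (chart_cancel hphi.1 DP). Qed.

Lemma open_pi (Q : set X) : open Q -> open (pi @^-1` Q).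
Proof. by move=> oQ; apply: open_comp => // y _; exact: (bd_cont hbd). Qed.

Lemma open_chart (Q : set X) (Z : set 'rV[C]_n) : open Q -> Q `<=` cdom phi -> open Z ->
  open [set p | Q p /\ Z (cmap phi p)].
Proof.
move=> oQ QD oZ; rewrite openE => p [Qp Zp]; rewrite /interior.
have h : nbhs p (cmap phi @^-1` Z).
  by apply: (chart_cont hphi.1 (QD _ Qp)); exact: open_nbhs_nbhs.
by apply: filterS2 (open_nbhs_nbhs (conj oQ Qp)) h => q.
Qed.

(** [D] is the coordinate ball on which the tensor has a formula and [K] a smaller closed ball
    containing its support; [D] and the complement of [K] cover [X]. *)
Variables (D K : set X) (al be : R -> R) (d0 : R).
Hypotheses (oD : open D) (DD : D `<=` cdom phi) (cK : closed K) (KD : K `<=` D) (KP : K P).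
Hypotheses (sal : smooth1 [set t | 0 < t] al) (sbe : smooth1 [set t | 0 < t] be).
Hypothesis dal : forall t : R, 0 < t -> is_derive t 1 al (be t).
Hypothesis d00 : 0 < d0.
Hypothesis al0 : forall t, 0 < t -> t < d0 -> al t = t^-1.
Hypothesis be0 : forall t, 0 < t -> t < d0 -> be t = - (t^-1 ^+ 2).
Hypothesis alK : forall p, D p -> ~ K p -> al (nq (cmap phi p)) = 0.
Hypothesis beK : forall p, D p -> ~ K p -> be (nq (cmap phi p)) = 0.

Variable sel : Y -> Y -> 'rV[C]_n.
Hypothesis selP : forall y, pi y = P -> exists2 k, Om k y & sel y = sg k.

(* Near the exceptional divisor this is the Fubini-Study tensor of P^(n-1), pulled back by
   [sg k] on the divisor and by [xi] off it; it vanishes off [pi @^-1` K]. *)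
Definition kap : tensor2 R n Y := fun psi y v w =>
  if `[< D (pi y) >] then
    if xi y != 0 then pull (xi \o cinv psi) (KT al be) (cmap psi y) v w
    else pull (sel y \o cinv psi) (@K0 R n) (cmap psi y) v w
  else 0.

Lemma kap_in psi y v w : D (pi y) -> xi y != 0 ->
  kap psi y v w = pull (xi \o cinv psi) (KT al be) (cmap psi y) v w.
Proof. by move=> Dy x0; rewrite /kap asboolT// x0. Qed.

Lemma kap_exc psi y v w : D (pi y) -> xi y = 0 ->
  kap psi y v w = pull (sel y \o cinv psi) (@K0 R n) (cmap psi y) v w.
Proof. by move=> Dy x0; rewrite /kap asboolT// x0 eqxx. Qed.

Lemma kap_out psi y v w : is_chart psi -> cdom psi y -> ~ K (pi y) -> kap psi y v w = 0.
Proof.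
move=> cpsi D1 nK; have [Dy|nD] := pselect (D (pi y)); last by rewrite /kap asboolF.
have [x0|x0] := eqVneq (xi y) 0; first by case: nK; rewrite (xi_eq0 (DD Dy) x0).
rewrite kap_in// /pull /KT /= (chart_cancel cpsi D1).
by rewrite (alK Dy nK) (beK Dy nK) !mul0r addr0.
Qed.

Definition locmod (psi : chart R n Y) (y : Y) (tau : tensor2 R n Y) := exists V T,
  [/\ open V, V (cmap psi y), model V T, closedT V T &
      forall z, V z -> forall v w, tau psi (cinv psi z) v w = T z v w].

Lemma K0_model : model [set z : 'rV[C]_n | 0 < nq z] (@K0 R n) /\
  closedT [set z : 'rV[C]_n | 0 < nq z] (@K0 R n).
Proof.
have oV := @nq_gt_open R n 0.
have ne : forall t : R, 0 < t -> t != 0 by move=> t /gt_eqF ->.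
have e1 : elem [set t : R | 0 < t] (fun t => t^-1) by apply: elem_inv (elem_id _) _ => t; exact: ne.
have e2 : elem [set t : R | 0 < t] (fun t => - (t^-1 ^+ 2)).
  rewrite (_ : (fun t => _) = fun t => (-1) * (t^-1 * t^-1)).
    by apply: elem_mul; [exact: elem_cst|exact: elem_mul].
  by apply/funext => t; rewrite mulN1r expr2.
have [F F0 HF] := elem_smooth1 e2.
have d1 (t : R) : 0 < t -> is_derive t 1 (fun t : R => t^-1) (- (t^-1 ^+ 2)).
  move=> t0; apply: is_derive_eq1 (is_deriveV (ne _ t0) (is_derive_id t 1)) _.
  by rewrite /GRing.scale /= mulr1 exprVn.
split; first exact: (KT_model oV (fun z h => h) (elem_smooth1 e1) (elem_smooth1 e2)).
apply: (KT_closed (D := [set t | 0 < t]) (ga := F 1%N)) => // t t0.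
by have := HF 0%N t t0; rewrite F0.
Qed.

Lemma KT_mod : model [set z : 'rV[C]_n | 0 < nq z] (KT al be) /\
  closedT [set z : 'rV[C]_n | 0 < nq z] (KT al be).
Proof.
have oV := @nq_gt_open R n 0.
split; first exact: (KT_model oV (fun z h => h) sal sbe).
have [F F0 HF] := sbe.
apply: (KT_closed (D := [set t | 0 < t]) (ga := F 1%N)) => // t t0.
by have := HF 0%N t t0; rewrite F0.
Qed.

Lemma sg_neq0 k y : Om k y -> sg k y != 0.
Proof.
move=> Oy; have [_ h _] := bd_chart hbd Oy; apply: contra_eq_neq h => ->.
by rewrite mxE eq_sym oner_neq0.
Qed.

Lemma sg_K0 psi k k' y v w : B psi -> cdom psi y -> Om k y -> Om k' y ->
  pull (sg k' \o cinv psi) (@K0 R n) (cmap psi y) v w =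
  pull (sg k \o cinv psi) (@K0 R n) (cmap psi y) v w.
Proof.
move=> Bpsi D1 Oy Oy'; have cpsi := cm_chart hY Bpsi.
have oU : open (cimg psi (Om k `&` Om k')).
  by apply: cimg_open => //; apply: openI; exact: bd_open hbd _.
have Ux : cimg psi (Om k `&` Om k') (cmap psi y) by apply: cimg_in.
have ds := bd_sg_holo hbd Bpsi D1 Oy; have ds' := bd_sg_holo hbd Bpsi D1 Oy'.
apply: (K0_smul oU Ux (l := sg k' \o cinv psi) (j := k) _ ds' ds ds') => /=.
- by move=> z /(cimgP cpsi)[_ [h1 h2] _]; apply: (bd_sg hbd h1 h2).
- by rewrite (chart_cancel cpsi D1) sg_neq0.
- rewrite (chart_cancel cpsi D1); apply: contra_neq (sg_neq0 Oy') => h.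
  by rewrite (bd_sg hbd Oy Oy') h scale0r.
Qed.

Lemma xi_K0 psi k y v w : B psi -> cdom psi y -> Om k y -> xi y != 0 ->
  pull (xi \o cinv psi) (@K0 R n) (cmap psi y) v w =
  pull (sg k \o cinv psi) (@K0 R n) (cmap psi y) v w.
Proof.
move=> Bpsi D1 Oy x0; have cpsi := cm_chart hY Bpsi.
have oU : open (cimg psi (Om k)) by apply: cimg_open => //; exact: bd_open hbd _.
have Ux : cimg psi (Om k) (cmap psi y) by apply: cimg_in.
have [D2 _ xE] := bd_chart hbd Oy.
have ds := bd_sg_holo hbd Bpsi D1 Oy; have [dx _] := xi_diff Bpsi D1 D2.
apply: (K0_smul oU Ux (l := xi \o cinv psi) (j := k) _ dx ds dx) => /=.
- by move=> z /(cimgP cpsi)[_ h1 _]; have [] := bd_chart hbd h1.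
- by rewrite (chart_cancel cpsi D1) sg_neq0.
- rewrite (chart_cancel cpsi D1); apply: contra_neq x0 => h.
  by rewrite /= xE h scale0r.
Qed.

(** Below [d0] the profile is 1/t, so the tensor is the Fubini-Study one, and [xi] and every [sg k]
    are proportional. Hence the two cases of [kap] and all choices of [k] agree there, and the
    tensor is smooth across the divisor. *)
Lemma kap_near psi k y v w : B psi -> cdom psi y -> Om k y -> D (pi y) -> nq (xi y) < d0 ->
  kap psi y v w = pull (sg k \o cinv psi) (@K0 R n) (cmap psi y) v w.
Proof.
move=> Bpsi D1 Oy Dy xd; have cpsi := cm_chart hY Bpsi.
have [x0|x0] := eqVneq (xi y) 0.
  rewrite kap_exc//; have [k' Oy' ->] := selP (xi_eq0 (DD Dy) x0).
  exact: sg_K0.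
rewrite kap_in// -(xi_K0 _ _ Bpsi D1 Oy x0).
have q0 := nq_gt0 x0.
by rewrite /pull /K0 /KT /= (chart_cancel cpsi D1) (al0 q0 xd) (be0 q0 xd).
Qed.

(** The local model is 0 off [K], the pull-back by a fixed [sg k] around a point of the divisor, and
    the pull-back by [xi] elsewhere. *)
Lemma kap_loc psi y : B psi -> cdom psi y -> locmod psi y kap.
Proof.
move=> Bpsi D1; have cpsi := cm_chart hY Bpsi.
have [Ky|nK] := pselect (K (pi y)); last first.
  have oK : open (pi @^-1` (~` K)) by apply: open_pi; rewrite openC.
  have oV := cimg_open cpsi oK.
  exists (cimg psi (pi @^-1` (~` K))), (fun _ _ _ => 0); split => //.
  - exact: cimg_in.
  - exact: model0.
  - exact: closedT0.
  - by move=> z /(cimgP cpsi)[h1 h2 _] v w; exact: kap_out.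
have Dy := KD Ky.
have [x0|x0] := eqVneq (xi y) 0.
  have [k Oy _] := selP (xi_eq0 (DD Dy) x0).
  pose U := Om k `&` (pi @^-1` [set p | D p /\ [set z | nq z < d0] (cmap phi p)]).
  have oU : open U.
    apply: openI; first exact: bd_open hbd _.
    by apply: open_pi; apply: open_chart => //; exact: nq_lt_open.
  have oV := cimg_open cpsi oU.
  have dV z : cimg psi U z -> differentiable (sg k \o cinv psi) z.
    by move=> /(cimgP cpsi)[h1 [h2 _] <-]; exact: (bd_sg_holo hbd Bpsi h1 h2).
  have mV z : cimg psi U z -> [set z | 0 < nq z] ((sg k \o cinv psi) z).
    by move=> /(cimgP cpsi)[h1 [h2 _] _]; apply: nq_gt0; exact: sg_neq0.
  have [m0 c0] := K0_model.
  exists (cimg psi U), (pull (sg k \o cinv psi) (@K0 R n)); split.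
  - exact: oV.
  - apply: cimg_in => //; split => //; split => //=.
    by move: x0 => /= ->; rewrite nq0.
  - exact: (pull_model oV (@nq_gt_open R n 0) dV mV m0).
  - exact: (pull_closed oV (@nq_gt_open R n 0) dV mV m0 c0).
  - move=> z /(cimgP cpsi)[h1 [h2 [h3 h4]] h5] v w; rewrite -[in RHS]h5.
    exact: kap_near.
pose U := pi @^-1` [set p | D p /\ [set z | 0 < nq z] (cmap phi p)].
have oU : open U by apply: open_pi; apply: open_chart => //; exact: nq_gt_open.
have oV := cimg_open cpsi oU.
have dV z : cimg psi U z -> differentiable (xi \o cinv psi) z.
  by move=> /(cimgP cpsi)[h1 [h2 _] <-]; exact: (xi_diff Bpsi h1 (DD h2)).1.
have mV z : cimg psi U z -> [set z | 0 < nq z] ((xi \o cinv psi) z).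
  by move=> /(cimgP cpsi)[h1 [h2 h3] _].
have [m0 c0] := KT_mod.
exists (cimg psi U), (pull (xi \o cinv psi) (KT al be)); split.
- exact: oV.
- by apply: cimg_in => //; split => //; exact: nq_gt0.
- exact: (pull_model oV (@nq_gt_open R n 0) dV mV m0).
- exact: (pull_closed oV (@nq_gt_open R n 0) dV mV m0 c0).
- move=> z /(cimgP cpsi)[h1 [h2 h3] h5] v w; rewrite -[in RHS]h5.
  apply: kap_in => //; apply/eqP => x1; move: h3; rewrite /= in x1 *; rewrite x1 nq0 ltxx//.
Qed.

(** [sel y] depends on the point and not on the chart, so both sides pull back along the same map
    and the chain rule suffices. *)
Lemma kap_tensor psi psi' y v w : B psi -> B psi' -> cdom psi y -> cdom psi' y ->
  kap psi y v w = kap psi' y ('d (transition psi psi') (cmap psi y) v)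
                             ('d (transition psi psi') (cmap psi y) w).
Proof.
move=> Bpsi Bpsi' D1 D2; have c1 := cm_chart hY Bpsi; have c2 := cm_chart hY Bpsi'.
have ht := cm_compat hY Bpsi Bpsi'.
have PT (F : Y -> 'rV[C]_n) T : differentiable (F \o cinv psi') (cmap psi' y) ->
    pull (F \o cinv psi) T (cmap psi y) v w = pull (F \o cinv psi') T (cmap psi' y)
      ('d (transition psi psi') (cmap psi y) v) ('d (transition psi psi') (cmap psi y) w).
  move=> dF; have [_ E] := diff_change c1 c2 ht D1 D2 dF.
  have E0 : (F \o cinv psi) (cmap psi y) = (F \o cinv psi') (cmap psi' y).
    by rewrite /= (chart_cancel c1 D1) (chart_cancel c2 D2).
  exact: (f_equal3 T E0 (E v) (E w)).
have [Dy|nD] := pselect (D (pi y)); last by rewrite /kap !asboolF.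
have [x0|x0] := eqVneq (xi y) 0.
  have [k Oy selE] := selP (xi_eq0 (DD Dy) x0).
  have ds : differentiable (sel y \o cinv psi') (cmap psi' y).
    by rewrite selE; exact: (bd_sg_holo hbd Bpsi' D2 Oy).
  exact: (etrans (kap_exc psi v w Dy x0) (etrans (PT _ _ ds) (esym (kap_exc psi' _ _ Dy x0)))).
have dx := (xi_diff Bpsi' D2 (DD Dy)).1.
exact: (etrans (kap_in psi v w Dy x0) (etrans (PT _ _ dx) (esym (kap_in psi' _ _ Dy x0)))).
Qed.

Lemma kap_ge psi y v (a b M : R) : is_chart psi -> cdom psi y -> D (pi y) -> xi y != 0 ->
  al (nq (xi y)) = a / nq (xi y) -> be (nq (xi y)) = b / nq (xi y) - a / nq (xi y) ^+ 2 ->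
  0 <= a -> `|b| <= M -> - (M * nq ('d (xi \o cinv psi) (cmap psi y) v)) <= kap psi y v v.
Proof.
move=> cpsi D1 Dy x0 ha hb a0 bM; rewrite (kap_in psi v v Dy x0) /pull.
move: ('d _ _ v) => w; rewrite [(_ \o _) (cmap psi y)]/= (chart_cancel cpsi D1).
exact: (KT_ge w x0 ha hb a0 bM).
Qed.

(** On the divisor the tensor must be positive exactly where the pull-back of [g] degenerates; there
    the differential of [sg k] is injective, and it avoids the kernel of the Fubini-Study tensor. *)
Lemma kap_exc_ge psi y v : B psi -> cdom psi y -> pi y = P ->
  0 <= kap psi y v v /\
  ('d (xi \o cinv psi) (cmap psi y) v = 0 -> v != 0 -> 0 < kap psi y v v).
Proof.
move=> Bpsi D1 yP; have cpsi := cm_chart hY Bpsi.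
have Dy : D (pi y) by rewrite yP; exact: KD.
have x0 : xi y = 0 by rewrite /= yP.
have [k Oy selE] := selP yP.
have kE : kap psi y v v = @K0 R n (sg k y) ('d (sg k \o cinv psi) (cmap psi y) v) ('d (sg k \o cinv psi) (cmap psi y) v).
  by rewrite (kap_exc psi v v Dy x0) selE /pull [(_ \o _) (cmap psi y)]/= (chart_cancel cpsi D1).
have s0 := sg_neq0 Oy; have [_ s1 _] := bd_chart hbd Oy.
have ds := bd_sg_holo hbd Bpsi D1 Oy.
have oU : open (cimg psi (Om k)) by apply: cimg_open => //; exact: bd_open hbd _.
have Ux : cimg psi (Om k) (cmap psi y) by apply: cimg_in.
(* The k-th entry of [sg k] is constantly 1. The product rule applied to [sg k] as its own k-th
   entry times itself leaves the derivative of that entry times [sg k] equal to 0. *)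
have wk : 'd (sg k \o cinv psi) (cmap psi y) v 0 k = 0.
  have mE z : cimg psi (Om k) z -> (sg k \o cinv psi) z = (sg k \o cinv psi) z 0 k *: (sg k \o cinv psi) z.
    by move=> /(cimgP cpsi)[_ h1 _]; exact: (bd_sg hbd h1 h1).
  have := @diff_smul _ _ _ _ (sg k \o cinv psi) (sg k \o cinv psi) (sg k \o cinv psi) k _ _ oU Ux mE ds ds ds v.
  move: ('d _ _ v) => w; rewrite [(_ \o _) (cmap psi y)]/= (chart_cancel cpsi D1) s1 scale1r.
  move=> /(congr1 (fun u => u - w)); rewrite subrr addrAC subrr add0r => /esym/eqP.
  by rewrite scaler_eq0 (negbTE s0) orbF => /eqP.
have inj : 'd (xi \o cinv psi) (cmap psi y) v = 0 -> 'd (sg k \o cinv psi) (cmap psi y) v = 0 -> v = 0.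
  move=> dx0 dw0; have [eta Aeta D3] := cm_cover hX (pi y).
  exact: (bd_sg_inj hbd Bpsi Aeta D1 D3 Oy (xi_inj Bpsi D1 (DD Dy) dx0 Aeta D3) dw0).
have k_ge : 0 <= kap psi y v v by rewrite kE; exact: (K0_ge _ s0).
split; first exact: k_ge.
move=> u0 v0; rewrite lt_neqAle k_ge andbT eq_sym.
apply/eqP => k0; case/eqP: v0; apply: (inj u0).
exact: (K0_eq0 s0 s1 wk (etrans (esym kE) k0)).
Qed.

End Kappa.

(** * Hermitian metrics from local models *)

Section Metric.
Variable R : realType.
Local Notation C := R[i].
Variables (n : nat) (Y : topologicalType) (B : set (chart R n Y)).
Hypothesis hY : complex_manifold B.

Lemma hm_intro (tau : tensor2 R n Y) :
  (forall psi y, B psi -> cdom psi y -> exists V T, [/\ open V, V (cmap psi y), model V T &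
     forall z, V z -> forall v w, T z v w = tau psi (cinv psi z) v w]) ->
  (forall psi y v, B psi -> cdom psi y -> v != 0 -> 0 < tau psi y v v) ->
  (forall psi psi' y v w, B psi -> B psi' -> cdom psi y -> cdom psi' y ->
    tau psi y v w = tau psi' y ('d (transition psi psi') (cmap psi y) v)
                               ('d (transition psi psi') (cmap psi y) w)) ->
  hermitian_metric_on B setT tau.
Proof.
move=> loc pos tens.
have M psi y : B psi -> cdom psi y -> exists V, [/\ open V, V (cmap psi y) & model V (fun z => tau psi (cinv psi z))].
  move=> Bpsi D1; have [V [T [oV Vy mT E]]] := loc psi y Bpsi D1.
  by exists V; split => //; exact: (@model_eq R n V oV T (fun z => tau psi (cinv psi z)) E mT).
have K psi y : B psi -> cdom psi y -> cinv psi (cmap psi y) = y.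
  by move=> Bpsi D1; exact: (chart_cancel (cm_chart hY Bpsi) D1).
split.
- move=> psi y Bpsi D1 _ a u v w; have [V [oV Vy mT]] := M _ _ Bpsi D1.
  by have := ml_lin mT Vy a u v w; rewrite K.
- move=> psi y Bpsi D1 _ v w; have [V [oV Vy mT]] := M _ _ Bpsi D1.
  by have := ml_sym mT Vy v w; rewrite K.
- by move=> psi y Bpsi D1 _ v; exact: pos.
- move=> psi y Bpsi D1 _ v w; have [V [oV Vy mT]] := M _ _ Bpsi D1.
  by have := ml_J mT Vy v w; rewrite K.
- by move=> psi psi' y Bpsi Bpsi' D1 D2 _ v w; exact: tens.
- move=> psi Bpsi v w; apply: (smooth_onP (cimg psi setT) _).2 => k.
  apply: CK_local => x [y [D1 _] <-]; have [V [oV Vy mT]] := M _ _ Bpsi D1.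
  by exists V => //; exact: (ml_smooth mT k v w).
Qed.

Lemma smooth1_expR : smooth1 setT (@expR R).
Proof. by exists (fun _ => @expR R) => // k x _; exact: is_derive_expR. Qed.

Lemma hm_conformal (W : set Y) (F : Y -> R) (tau : tensor2 R n Y) : open W ->
  hermitian_metric_on B setT tau -> smooth_function_on B W F -> hermitian_metric_on B W (conformal F tau).
Proof.
move=> oW h sF; split.
- move=> psi y Bpsi D1 _ a u v w.
  by rewrite /conformal (hm_linear h Bpsi D1)//; ring.
- by move=> psi y Bpsi D1 _ v w; rewrite /conformal (hm_sym h Bpsi D1).
- by move=> psi y Bpsi D1 _ v v0; rewrite /conformal mulr_gt0 ?expR_gt0// (hm_pos h Bpsi D1).
- by move=> psi y Bpsi D1 _ v w; rewrite /conformal (hm_J h Bpsi D1).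
- move=> psi psi' y Bpsi Bpsi' D1 D2 _ v w; congr (_ * _); exact: (hm_tensor h Bpsi Bpsi' D1 D2 I).
- move=> psi Bpsi v w; have cpsi := cm_chart hY Bpsi; have oV := cimg_open cpsi oW.
  apply: (smooth_onP (cimg psi W) _).2 => k.
  have sF' := (smooth_onP (cimg psi W) _).1 (sF psi Bpsi).
  apply: (CK_mul oV (f := fun x => expR (- F (cinv psi x)))).
    apply: (CK_comp1 k oV (D := setT) (phi := @expR R) (f := fun x => - F (cinv psi x))) => //.
      exact: smooth1_expR.
    by move=> j; exact: (CK_opp oV (sF' j)).
  apply: (CK_subset (U := cimg psi setT)); first by move=> _ [q [h1 _] <-]; exists q.
  exact: ((smooth_onP (cimg psi setT) _).1 (hm_smooth h Bpsi v w) k).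
Qed.

Lemma closedT_local (W : set 'rV[C]_n) T : 
  (forall z, W z -> exists V T', [/\ open V, V z, model V T', closedT V T' &
     forall z', V z' -> forall v w, T' z' v w = T z' v w]) -> closedT W T.
Proof.
move=> H z Wz u v w; have [V [T' [oV Vz mT cT E]]] := H z Wz.
exact: (closedT_eq oV E mT cT Vz).
Qed.

Lemma nbhs0_nq (Q : set 'rV[C]_n) : nbhs (0 : 'rV[C]_n) Q ->
  exists2 r : R, 0 < r & forall z, nq z < r -> Q z.
Proof.
move=> /nbhs_N1[d d0 Hd]; pose M : R := #|{: 'I_n * bool}|%:R.
have M1 : 0 < M + 1 by rewrite ltr_wpDl.
exists ((d / (M + 1)) ^+ 2); first by rewrite exprn_gt0// divr_gt0.
move=> z hz; apply: Hd; rewrite subr0.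
have d1 : 0 < d / (M + 1) by rewrite divr_gt0.
have H c : `|rc c z| <= d / (M + 1).
  rewrite -(@ler_pXn2r _ 2) ?nnegrE ?(ltW d1)// real_normK ?num_real//.
  by rewrite (le_trans (nq_rc z c))// ltW.
apply: (@le_lt_trans _ _ (M * (d / (M + 1)))).
  by rewrite /N1 (le_trans (ler_sum _ (fun c _ => H c)))// sumr_const -[leLHS]mulr_natl.
rewrite mulrCA gtr_pMr// ltr_pdivrMr// mul1r; lra.
Qed.

End Metric.

(** * Pull-back of the metric by the blow-down map *)

Section Pullback.
Variable R : realType.
Local Notation C := R[i].
Variables (n : nat) (X Y : topologicalType) (A : set (chart R n X)) (P : X) (B : set (chart R n Y)).
Hypotheses (hX : complex_manifold A) (hY : complex_manifold B).
Variables (phi : chart R n X) (pi : Y -> X) (Om : 'I_n -> set Y) (sg : 'I_n -> Y -> 'rV[C]_n).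
Hypothesis hbd : blowdown A P phi B pi Om sg.
Variable g : tensor2 R n X.
Hypothesis hg : hermitian_metric_on A setT g.
Variable ec : X -> chart R n X.
Hypothesis ecP : forall x, A (ec x) /\ cdom (ec x) x.

(** [ec] selects an atlas chart at each point of [X]; the transformation rule of [g] makes the
    choice immaterial, as [pg_chart] shows. *)
Definition pg : tensor2 R n Y := fun psi y v w =>
  g (ec (pi y)) (pi y) ('d (cmap (ec (pi y)) \o pi \o cinv psi) (cmap psi y) v)
                       ('d (cmap (ec (pi y)) \o pi \o cinv psi) (cmap psi y) w).

Lemma pg_chart psi eta y v w : B psi -> A eta -> cdom psi y -> cdom eta (pi y) ->
  pg psi y v w = g eta (pi y) ('d (cmap eta \o pi \o cinv psi) (cmap psi y) v)
                              ('d (cmap eta \o pi \o cinv psi) (cmap psi y) w).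
Proof.
move=> Bpsi Aeta D1 D2; have [A3 D3] := ecP (pi y).
have [_ E] := diff_post (cm_chart hY Bpsi) (cm_chart hX Aeta) (cm_chart hX A3) (cm_compat hX Aeta A3)
  (bd_cont hbd (x := y)) D1 D2 D3 (bd_holo hbd Bpsi Aeta D1 D2).
have H := hm_tensor hg Aeta A3 D2 D3 I ('d (cmap eta \o pi \o cinv psi) (cmap psi y) v)
  ('d (cmap eta \o pi \o cinv psi) (cmap psi y) w).
exact: (etrans (f_equal2 (g (ec (pi y)) (pi y)) (E v) (E w)) (esym H)).
Qed.

Section local.
Variables (psi : chart R n Y) (eta : chart R n X) (Q : set X).
Hypotheses (Bpsi : B psi) (Aeta : A eta) (oQ : open Q).
Let cpsi := cm_chart hY Bpsi.
Let ceta := cm_chart hX Aeta.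

(** The region of [psi] in which the blow-down map is expressed through [eta] and lands in [Q],
    where a given property of the metric holds. *)
Definition dome : set 'rV[C]_n := cimg psi (pi @^-1` (cdom eta `&` Q)).
Local Notation m := (cmap eta \o pi \o cinv psi).

Lemma dome_open : open dome.
Proof.
apply: (cimg_open cpsi); apply: open_comp => [y _|]; first exact: (bd_cont hbd).
by apply: openI => //; exact: (chart_open_dom ceta).
Qed.

Lemma dome_diff z : dome z -> differentiable m z.
Proof. by move=> /(cimgP cpsi)[h1 [h2 _] <-]; exact: (bd_holo hbd Bpsi Aeta h1 h2). Qed.

Lemma dome_img z : dome z -> cimg eta Q (m z).
Proof. by move=> /(cimgP cpsi)[h1 [h2 h3] _]; exact: (cimg_in h2 h3). Qed.

Lemma dome_in y : cdom psi y -> cdom eta (pi y) -> Q (pi y) -> dome (cmap psi y).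
Proof. by move=> D1 D2 Qy; apply: cimg_in. Qed.

Lemma dome_CK (F : X -> R) k : smooth_function_on A Q F -> CK k dome (F \o pi \o cinv psi).
Proof.
move=> sF.
apply: (CK_eq dome_open (f := fun x => (F \o cinv eta) (m x))).
  by move=> z /(cimgP cpsi)[h1 [h2 h3] _]; rewrite /= (chart_cancel ceta h2).
apply: (CK_comp dome_open (cimg_open ceta oQ) dome_img).
  exact: ((smooth_onP (cimg eta Q) _).1 (sF eta Aeta) k).
by move=> j c; exact: (CK_holo j dome_open dome_diff c).
Qed.

Lemma dome_pg z v w : dome z -> pull m (fun x => g eta (cinv eta x)) z v w = pg psi (cinv psi z) v w.
Proof.
move=> /(cimgP cpsi)[h1 [h2 _] E]; rewrite (pg_chart v w Bpsi Aeta h1 h2) E.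
by rewrite /pull [(_ \o _) z]/= (chart_cancel ceta h2).
Qed.

Lemma dome_model : model dome (fun z => pg psi (cinv psi z)).
Proof.
apply: (@model_eq R n _ dome_open (pull m (fun x => g eta (cinv eta x)))).
  by move=> z Vz v w; exact: dome_pg.
apply: (pull_model dome_open (cimg_open ceta oQ) dome_diff dome_img).
apply: (model_subset _ (hm_model ceta hg Aeta)).
by move=> _ [q [h1 _] <-]; exists q.
Qed.

Lemma dome_kahler (F : X -> R) : kahler_metric_on A Q (conformal F g) ->
  let T z v w := expR (- F (pi (cinv psi z))) * pg psi (cinv psi z) v w in
  model dome T /\ closedT dome T.
Proof.
move=> [h1 h2] T.
have mQ := hm_model ceta h1 Aeta.
have mP := pull_model dome_open (cimg_open ceta oQ) dome_diff dome_img mQ.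
have cP := pull_closed dome_open (cimg_open ceta oQ) dome_diff dome_img mQ (h2 eta Aeta).
have E z : dome z -> forall v w, pull m (fun x => conformal F g eta (cinv eta x)) z v w = T z v w.
  move=> Vz v w; rewrite /T -(dome_pg v w Vz).
  have [k1 [k2 _] _] := cimgP cpsi Vz.
  by rewrite /pull /conformal [(_ \o _) z]/= (chart_cancel ceta k2).
split; [exact: (@model_eq R n _ dome_open _ _ E mP)|exact: (closedT_eq dome_open E mP cP)].
Qed.

End local.

Lemma pg_tensor psi psi' y v w : B psi -> B psi' -> cdom psi y -> cdom psi' y ->
  pg psi y v w = pg psi' y ('d (transition psi psi') (cmap psi y) v)
                           ('d (transition psi psi') (cmap psi y) w).
Proof.
move=> B1 B2 D1 D2; have [A3 D3] := ecP (pi y).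
have [_ E] := diff_change (F := cmap (ec (pi y)) \o pi) (cm_chart hY B1) (cm_chart hY B2)
  (cm_compat hY B1 B2) D1 D2 (bd_holo hbd B2 A3 D2 D3).
exact: (f_equal2 (g (ec (pi y)) (pi y)) (E v) (E w)).
Qed.

Lemma pg_ge0 psi y v : B psi -> cdom psi y -> 0 <= pg psi y v v.
Proof.
move=> Bpsi D1; have [A3 D3] := ecP (pi y); rewrite /pg.
set w := 'd _ _ v; have [w0|w0] := eqVneq w 0; last exact: ltW (hm_pos hg A3 D3 I w0).
rewrite w0; have := hm_linear hg A3 D3 I (-1) 0 0 0.
by rewrite scaler0 addr0 mulN1r addNr => ->.
Qed.

Lemma pg_gt0 psi y v : B psi -> cdom psi y -> pi y <> P -> v != 0 -> 0 < pg psi y v v.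
Proof.
move=> Bpsi D1 nP v0; have [A3 D3] := ecP (pi y); apply: (hm_pos hg A3 D3 I).
apply/eqP => dv0; case/eqP: v0; exact: (bd_inj hbd Bpsi A3 D1 D3 nP dv0).
Qed.

End Pullback.

(** * Constants near the blown-up point and the final metric *)

Section Final.
Variable R : realType.
Local Notation C := R[i].
Variables (n : nat) (X : topologicalType) (A : set (chart R n X)) (P : X).
Hypothesis hX : complex_manifold A.
Variable phi : chart R n X.
Hypotheses (hphi : holo_coordinates A phi) (DP : cdom phi P) (phiP : cmap phi P = 0).
Variable g : tensor2 R n X.
Hypothesis hg : hermitian_metric_on A setT g.

(** [c] compares [g] with the flat metric of the coordinates [phi] and [M0] bounds the conformal
    factor, both by continuity at [P]. The metric is read in [eta] and moved to [phi] by the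
    transition, whose differential at [P] is injective. *)
Lemma metric_near (eta : chart R n X) (Q : set X) (F : X -> R) : A eta -> cdom eta P ->
  open Q -> Q P -> smooth_function_on A Q F ->
  exists r c M0 : R, [/\ 0 < r, 0 < c, 0 < M0 & forall p, cdom phi p -> nq (cmap phi p) < r ->
    [/\ cdom eta p, Q p, expR (F p) <= M0 &
      forall w, c * nq w <= g eta p ('d (transition phi eta) (cmap phi p) w)
                                    ('d (transition phi eta) (cmap phi p) w)]] /\
    [set z | nq z < r] `<=` cimg phi setT.
Proof.
move=> Aeta D1 oQ QP sF; have ceta := cm_chart hX Aeta; have cphi := hphi.1.
pose t := transition phi eta.
have oV : open (cimg phi (cdom eta `&` Q)).
  by apply: (cimg_open cphi); apply: openI => //; exact: (chart_open_dom ceta).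
set V := cimg _ _ in oV.
have V0 : V 0 by exists P.
have dt z : V z -> differentiable t z.
  by move=> /(cimgP cphi)[h1 [h2 _] <-]; exact: ((hphi.2 _ Aeta).1 _ h1 h2).
have tV z : V z -> cimg eta Q (t z).
  by move=> /(cimgP cphi)[h1 [h2 h3] _]; exact: (cimg_in h2 h3).
have oW := cimg_open ceta oQ.
have sQ : cimg eta Q `<=` cimg eta setT by move=> _ [q [h1 _] <-]; exists q.
have mT := pull_model oV oW dt tV (model_subset sQ (hm_model ceta hg Aeta)).
have tE z : V z -> cinv eta (t z) = cinv phi z.
  by move=> /(cimgP cphi)[h1 [h2 _] _]; rewrite /t /transition /= (chart_cancel ceta h2).
have c0P : cinv phi 0 = P by rewrite -phiP (chart_cancel cphi DP).
have t0 : t 0 = cmap eta P by rewrite /t /transition /= c0P.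
have pos w : w != 0 -> 0 < pull t (fun x => g eta (cinv eta x)) 0 w w.
  move=> w0; rewrite /pull tE// c0P; apply: (hm_pos hg Aeta D1 I).
  apply/eqP => dw0; case/eqP: w0.
  have ds : differentiable (transition eta phi) (t 0).
    by rewrite t0; exact: ((hphi.2 _ Aeta).2 _ D1 DP).
  apply: (diff_left_inv _ (dt _ V0) ds dw0).
  apply: filterS (open_nbhs_nbhs (conj oV V0)) => z Vz.
  by rewrite /transition /= (tE _ Vz); have [] := cimgP cphi Vz.
have [c c0 nT] := model_lower mT oV V0 pos.
have cF : CK 0 V (F \o cinv phi).
  apply: (CK_eq oV (f := fun x => (F \o cinv eta) (t x))).
    by move=> z Vz; rewrite /= tE.
  apply: (CK_comp oV oW tV).
    exact: ((smooth_onP (cimg eta Q) _).1 (sF eta Aeta) 0%N).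
  by move=> j e; exact: (CK_holo j oV dt e).
have /contR_eps /(_ 1 ltr01) nF := CK_cont cF V0.
have {}nF : nbhs (0 : 'rV[C]_n) [set z | `|F (cinv phi z) - F (cinv phi 0)| < 1].
  by apply/nbhs_N1; have [d d0 Hd] := nF; exists d.
have [r r0 Hr] := nbhs0_nq (filterI (open_nbhs_nbhs (conj oV V0)) (filterI nT nF)).
exists r, c, (expR (F P + 1)); split; last first.
  by move=> z /Hr[[q [Dq _] qE] _]; exists q.
split => //; first exact: expR_gt0.
move=> p Dp hp; have [Vz [Tz Fz]] := Hr _ hp.
have [_ [D2 Qp] _] := cimgP cphi Vz; rewrite (chart_cancel cphi Dp) in D2 Qp.
split => //.
  rewrite ler_expR; move: Fz; rewrite /= c0P (chart_cancel cphi Dp) ltr_norml => /andP[_]; lra.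
move=> w; have := Tz w; rewrite {1}/pull (tE _ Vz) (chart_cancel cphi Dp).
exact.
Qed.

End Final.

(** [al] is u' and [be] is u''. The formula for [be] is in the shape of [KT_gram], with rho' as the
    coefficient that carries the sign. *)
Lemma cutoff_profile (R : realType) (d0 d1 : R) : 0 < d0 -> d0 < d1 ->
  exists rho drho al be : R -> R, exists M : R,
  [/\ smooth1 [set t | 0 < t] al, smooth1 [set t | 0 < t] be,
      forall t : R, 0 < t -> is_derive t 1 al (be t),
      forall t, al t = rho t / t &
      [/\ forall t, t != 0 -> be t = drho t / t - rho t / t ^+ 2, forall t, 0 <= rho t, forall t, `|drho t| <= M,
       forall t, 0 < t -> t < d0 -> al t = t^-1 /\ be t = - (t^-1 ^+ 2) &
       forall t, d1 < t -> al t = 0 /\ be t = 0]].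
Proof.
move=> d00 d01; have [rho [drho [[e1 e2 dr] [[r0 r1 r2] [dr0 dr1 [M HM]]]]]] := cutoff d00 d01.
pose al t := rho t * t^-1; pose be t := drho t * t^-1 + (-1) * (rho t * (t^-1 * t^-1)).
have ne : forall t : R, 0 < t -> t != 0 by move=> t /gt_eqF ->.
have sub f : elem setT f -> elem [set t : R | 0 < t] f.
  by move=> h; apply: (elem_comp h (elem_id _)).
have ei : elem [set t : R | 0 < t] (fun t => t^-1) by apply: elem_inv (elem_id _) _ => t; exact: ne.
have be0 t : t != 0 -> be t = drho t / t - rho t / t ^+ 2 by move=> t0; rewrite /be; field.
exists rho, drho, al, be, M; split.
- by apply: elem_smooth1; apply: elem_mul => //; exact: sub.
- apply: elem_smooth1; apply: elem_add; first by apply: elem_mul => //; exact: sub.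
  apply: elem_mul; first exact: elem_cst.
  by apply: elem_mul; [exact: sub|exact: elem_mul].
- move=> t t0; apply: is_derive_eq1 (is_deriveM (dr t) (is_deriveV (ne _ t0) (is_derive_id t 1))) _.
  by rewrite be0 ?ne// /GRing.scale /=; field; exact: ne.
- by [].
- split => //.
  + move=> t t0 td; rewrite be0 ?ne// /al (r1 t (ltW td)) (dr0 t td); split; first by rewrite mul1r.
    by rewrite mul0r sub0r mul1r exprVn.
  + by move=> t td; rewrite /al /be (r2 t (ltW td)) (dr1 t td) !mul0r mulr0 addr0.
Qed.

Lemma blowdown_lck (R : realType) n (X Y : topologicalType) (A : set (chart R n X)) (P : X)
    (B : set (chart R n Y)) (phi : chart R n X) pi Om (sg : 'I_n -> Y -> 'rV[R[i]]_n) :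
  complex_manifold A -> complex_manifold B -> holo_coordinates A phi -> cdom phi P ->
  cmap phi P = 0 -> blowdown A P phi B pi Om sg -> has_lck_metric A -> has_lck_metric B.
Proof.
move=> hX hY hphi DP phiP hbd [g [hg [I [U [f [oU cU sF hK]]]]]].
have cphi := hphi.1.
have [i0 U0P] : exists i, U i P.
  by have : [set: X] P by []; rewrite -cU => -[i _ h]; exists i.
have /choice[ec ecP] : forall x, exists eta, A eta /\ cdom eta x.
  by move=> x; have [eta h1 h2] := cm_cover hX x; exists eta.
have [A0 D0] := ecP P; set eta0 := ec P in A0 D0.
have [r [c [M0 [[r0 c0 M00 near] sub]]]] :=
  metric_near hX hphi DP phiP hg A0 D0 (oU i0) U0P (sF i0).
(* Levels of |x|^2: the profile is 1/t below [r / 3] and 0 beyond [r / 2]; [K] is the closed ball at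
   level [r / 2], [D] the open ball at level [r]. *)
have [r30 r32 r2] : [/\ 0 < r / 3, r / 3 < r / 2 & r / 2 < r] by split; lra.
have [rho [drho [al [be [M [sal sbe dal alE [beE rho0 drhoM nearE far]]]]]]] := cutoff_profile r30 r32.
have M_ge0 : 0 <= M := le_trans (normr_ge0 _) (drhoM 0).
pose D : set X := [set p | cdom phi p /\ [set z | nq z < r] (cmap phi p)].
pose K : set X := [set p | cdom phi p /\ nq (cmap phi p) <= r / 2].
have oD : open D.
  by apply: (open_chart hphi (chart_open_dom cphi)) => //; exact: nq_lt_open.
have cK : closed K.
  apply: (chart_ball_closed (cm_hausdorff hX) cphi) => z /= hz; apply: sub => /=.
  exact: (le_lt_trans hz r2).
have DD : D `<=` cdom phi by move=> p [].
have KD : K `<=` D by move=> p [h1 h2]; split => //=; exact: (le_lt_trans h2 r2).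
have KP : K P by split => //; rewrite phiP nq0; lra.
have far' p : D p -> ~ K p -> r / 2 < nq (cmap phi p).
  by move=> [h1 _] nK; rewrite ltNge; apply/negP => h; apply: nK.
have alK p : D p -> ~ K p -> al (nq (cmap phi p)) = 0 by move=> h1 h2; exact: (far _ (far' p h1 h2)).1.
have beK p : D p -> ~ K p -> be (nq (cmap phi p)) = 0 by move=> h1 h2; exact: (far _ (far' p h1 h2)).2.
have al0 t : 0 < t -> t < r / 3 -> al t = t^-1 by move=> h1 h2; exact: (nearE t h1 h2).1.
have be0 t : 0 < t -> t < r / 3 -> be t = - (t^-1 ^+ 2) by move=> h1 h2; exact: (nearE t h1 h2).2.
have /choice[sel selP] : forall y, exists s : Y -> 'rV[R[i]]_n, pi y = P -> exists2 k, Om k y & s = sg k.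
  move=> y; have [h|h] := pselect (pi y = P); last by exists (fun=> 0).
  by have [k Oy] := bd_exc hbd h; exists (sg k) => _; exists k.
pose kp := @kap R n X Y phi pi D al be sel.
pose p_g := @pg R n X Y pi g ec.
have tens_k := kap_tensor hX hY hphi DP phiP hbd al be DD selP.
have loc_k psi y : B psi -> cdom psi y -> locmod psi y kp.
  exact: (kap_loc hX hY hphi DP phiP hbd oD DD cK KD KP sal sbe dal r30 al0 be0 alK beK selP).
have out_k psi y v w : is_chart psi -> cdom psi y -> ~ K (pi y) -> kp psi y v w = 0.
  exact: (kap_out hphi DP phiP DD KP alK beK).
pose F := f i0.
(* The possible loss [e * M0 * M] times the squared norm stays strictly below the gain [c] times the
   same quantity. *)
pose e := c / (2 * M0 * (M + 1)).
have e0 : 0 < e by rewrite divr_gt0// !mulr_gt0// ltr_wpDl.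
have eM : e * (M0 * M) < c.
  have M1 : 0 < M + 1 by rewrite ltr_wpDl.
  have -> : e * (M0 * M) = c * (M / (2 * (M + 1))) by rewrite /e; field; rewrite !gt_eqF.
  rewrite gtr_pMr// ltr_pdivrMr ?mulr_gt0//; lra.
pose h : tensor2 R n Y := fun psi y v w => p_g psi y v w + e * (expR (F (pi y)) * kp psi y v w).
have Din p : D p -> [/\ cdom eta0 p, U i0 p, expR (F p) <= M0 &
      forall w, c * nq w <= g eta0 p ('d (transition phi eta0) (cmap phi p) w)
                                     ('d (transition phi eta0) (cmap phi p) w)].
  by move=> [h1 h2]; exact: near.
have oKc : open (~` K) by rewrite openC.
have hh : hermitian_metric_on B setT h.
  apply: (hm_intro hY).
  - move=> psi y Bpsi D1; have cpsi := cm_chart hY Bpsi; have [Ae De] := ecP (pi y).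
    have [Ky|nK] := pselect (K (pi y)); last first.
      exists (dome pi psi (ec (pi y)) (~` K)), (fun z => p_g psi (cinv psi z)); split.
      + exact: (dome_open hX hY hbd Bpsi Ae oKc).
      + exact: (dome_in D1 De nK).
      + exact: (dome_model hX hY hbd hg ecP Bpsi Ae oKc).
      + move=> z /(cimgP cpsi)[h1 [_ h2] _] v w.
        by rewrite /h (out_k _ _ v w cpsi h1 h2) !mulr0 addr0.
    have [_ U0 _ _] := Din _ (KD _ Ky).
    have [V1 [T1 [oV1 V1y m1 _ E1]]] := loc_k psi y Bpsi D1.
    have oV := dome_open hX hY hbd Bpsi Ae (oU i0).
    exists (dome pi psi (ec (pi y)) (U i0) `&` V1),
      (fun z v w => p_g psi (cinv psi z) v w + (e * expR (F (pi (cinv psi z)))) * T1 z v w); split.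
    + exact: openI oV oV1.
    + by split => //; exact: (dome_in D1 De U0).
    + have oI := openI oV oV1.
      apply: (model_add oI).
        exact: (model_subset (@subIsetl _ _ _) (dome_model hX hY hbd hg ecP Bpsi Ae (oU i0))).
      apply: (model_mul oI _ (model_subset (@subIsetr _ _ _) m1)) => k.
      apply: (CK_mul oI (CK_cst oI _ _)).
      apply: (CK_comp1 k oI (D := setT) (phi := @expR R) (f := F \o pi \o cinv psi)) => //.
        exact: smooth1_expR.
      move=> j; apply: (CK_subset (@subIsetl _ _ _)).
      exact: (dome_CK hX hY hbd Bpsi Ae (oU i0) j (sF i0)).
    + by move=> z [_ V1z] v w; rewrite /h (E1 z V1z) mulrA.
  - move=> psi y v Bpsi D1 v0; have cpsi := cm_chart hY Bpsi.
    have [Ky|nK] := pselect (K (pi y)); last first.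
      rewrite /h (out_k _ _ v v cpsi D1 nK) !mulr0 addr0.
      by apply: (pg_gt0 hbd hg ecP Bpsi D1 _ v0) => yP; apply: nK; rewrite yP.
    have Dy := KD _ Ky; have [D2 _ FM low] := Din _ Dy.
    have [dx dxE] := xi_diff hX hY hphi hbd Bpsi D1 (DD _ Dy).
    pose w := 'd (cmap phi \o pi \o cinv psi) (cmap psi y) v.
    have pgl : c * nq w <= p_g psi y v v.
      have E := dxE eta0 A0 D2 v.
      apply: (le_trans (low w)).
      rewrite /p_g (pg_chart hX hY hbd hg ecP v v Bpsi A0 D1 D2).
      by rewrite (f_equal2 (g eta0 (pi y)) E E).
    have inj : w = 0 -> pi y <> P -> v = 0.
      move=> dw0 nP; have [Ae De] := ecP (pi y).
      exact: (bd_inj hbd Bpsi Ae D1 De nP (xi_inj hX hY hphi hbd Bpsi D1 (DD _ Dy) dw0 Ae De)).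
    have eF : 0 < e * expR (F (pi y)) by rewrite mulr_gt0// expR_gt0.
    rewrite /h mulrA.
    (* On the divisor both terms are nonnegative, and one is positive: the correction if the
       differential kills [v], the pull-back of [g] otherwise. Off the divisor the loss in the
       correction is outweighed by the choice of [e]. *)
    have [x0|x0] := eqVneq (cmap phi (pi y)) 0.
      have yP : pi y = P := xi_eq0 hphi DP phiP (DD _ Dy) x0.
      have [k0 kpos] := kap_exc_ge hX hY hphi phiP hbd al be DD KD KP selP v Bpsi D1 yP.
      have [w0|w0] := eqVneq w 0.
        apply: ltr_wpDl; first exact: (pg_ge0 pi hg ecP v Bpsi D1).
        by apply: (mulr_gt0 eF); exact: (kpos w0 v0).
      apply: ltr_pwDl; last by apply: (mulr_ge0 (ltW eF)); exact: k0.
      by apply: lt_le_trans pgl; rewrite mulr_gt0// nq_gt0.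
    have w0 : w != 0.
      apply/eqP => w0; case/eqP: v0; apply: (inj w0) => yP.
      by move: x0; rewrite yP phiP eqxx.
    have q0 := nq_gt0 w0; have qx := nq_gt0 x0.
    have kl : - (M * nq w) <= kp psi y v v.
      exact: (kap_ge sel v cpsi D1 Dy x0 (alE _) (beE _ (lt0r_neq0 qx)) (rho0 _) (drhoM _)).
    have h1 : e * expR (F (pi y)) * (M * nq w) <= e * (M0 * M) * nq w.
      by rewrite !mulrA ler_pM2r// ler_wpM2r// ler_pM2l.
    have h2 := ler_wpM2l (ltW eF) kl.
    have h3 : e * (M0 * M) * nq w < c * nq w by rewrite ltr_pM2r.
    by move: pgl h1 h2 h3; rewrite mulrN; lra.
  - move=> psi psi' y v w B1 B2 D1 D2; 
    exact: (f_equal2 (fun s t => s + e * (expR (F (pi y)) * t))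
      (pg_tensor hY hbd g ecP v w B1 B2 D1 D2) (tens_k psi psi' y v w B1 B2 D1 D2)).
exists h; split; first exact: hh.
(* [None] stands for the preimage of the ball [D], where [f i0] is the conformal exponent; [Some i]
   covers the rest of the preimage of [U i], where the correction vanishes. *)
pose W (j : option I) : set Y := if j is Some i then pi @^-1` (U i `&` ~` K) else pi @^-1` D.
pose ix (j : option I) : I := if j is Some i then i else i0.
pose G (j : option I) : Y -> R := f (ix j) \o pi.
have oW j : open (W j).
  by case: j => [i|]; apply: (open_pi hbd) => //; apply: openI; [exact: oU|exact: oKc].
have WU j y : W j y -> U (ix j) (pi y).
  by case: j => [i|]; [case|move=> /Din[]].
have sG j : smooth_function_on B (W j) (G j).
  move=> psi Bpsi; have cpsi := cm_chart hY Bpsi.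
  apply: (smooth_onP (cimg psi (W j)) _).2 => k.
  apply: CK_local => _ [y [D1 Wy] <-]; have [Ae De] := ecP (pi y).
  exists (dome pi psi (ec (pi y)) (U (ix j))); first exact: (dome_in D1 De (WU _ _ Wy)).
  exact: (dome_CK hX hY hbd Bpsi Ae (oU (ix j)) k (sF (ix j))).
exists (option I), W, G; split.
- exact: oW.
- apply/seteqP; split => // y _; have [Ky|nK] := pselect (K (pi y)).
    by exists None => //; exact: KD.
  have : [set: X] (pi y) by []; rewrite -cU => -[i _ Ui].
  by exists (Some i).
- exact: sG.
- move=> j; split; first exact: (hm_conformal hY (oW j) hh (sG j)).
  move=> psi Bpsi; have cpsi := cm_chart hY Bpsi.
  apply: (@closedT_local R n (cimg psi (W j)) (fun z v w => conformal (G j) h psi (cinv psi z) v w)).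
  move=> _ [y [D1 Wy] <-]; have [Ae De] := ecP (pi y).
  have oV := dome_open hX hY hbd Bpsi Ae (oU (ix j)).
  have Vy := dome_in D1 De (WU _ _ Wy).
  have [m1 c1] := dome_kahler hX hY hbd hg ecP Bpsi Ae (oU (ix j)) (hK (ix j)).
  case: j Wy oV Vy m1 c1 => [i|] Wy oV Vy m1 c1.
    have oV2 : open (cimg psi (pi @^-1` (~` K))) by apply: (cimg_open cpsi); exact: (open_pi hbd oKc).
    exists (dome pi psi (ec (pi y)) (U i) `&` cimg psi (pi @^-1` (~` K))),
      (fun z v w => expR (- f i (pi (cinv psi z))) * p_g psi (cinv psi z) v w); split.
    + exact: openI oV oV2.
    + by split => //; apply: (cimg_in D1); exact: Wy.2.
    + exact: (model_subset (@subIsetl _ _ _) m1).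
    + by move=> z [/c1].
    + move=> z [_ /(cimgP cpsi)[h1 h2 _]] v w.
      by rewrite /conformal /h (out_k _ _ v w cpsi h1 h2) !mulr0 addr0.
  have [V1 [T1 [oV1 V1y m2 c2 E1]]] := loc_k psi y Bpsi D1.
  exists (dome pi psi (ec (pi y)) (U i0) `&` V1),
    (fun z v w => expR (- F (pi (cinv psi z))) * p_g psi (cinv psi z) v w + e * T1 z v w); split.
  + exact: openI oV oV1.
  + by split.
  + have oI := openI oV oV1.
    apply: (model_add oI); first exact: (model_subset (@subIsetl _ _ _) m1).
    exact: (model_mul oI (fun k => CK_cst oI k e) (model_subset (@subIsetr _ _ _) m2)).
  + apply: (closedT_add e (model_subset (@subIsetl _ _ _) m1) (model_subset (@subIsetr _ _ _) m2)).
      by move=> z [/c1].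
    by move=> z [_ /c2].
  + move=> z [_ V1z] v w; rewrite /conformal /h -(E1 z V1z v w) mulrDr; congr (_ + _).
    (* The conformal factor undoes the exponential inside [h]; the correction becomes the constant
       [e] times a closed tensor, hence remains closed. *)
    have expE (a b : R) : e * b = expR (- a) * (e * (expR a * b)).
      by rewrite expRN; field; rewrite gt_eqF// expR_gt0.
    exact: expE.
Qed.

Theorem theorem1 (R : realType) (n : nat)
  (X : topologicalType) (A : set (chart R n X))
  (hX : complex_manifold A) (hlck : has_lck_metric A)
  (P : X)
  (Y : topologicalType) (B : set (chart R n Y))
  (hY : complex_manifold B) (hblow : is_blowup A P B) :
  has_lck_metric B.
Proof.
have [phi [pi [Om [sg [hphi DP phiP hbd]]]]] := blowdownP hX hY hblow.
exact: (blowdown_lck hX hY hphi DP phiP hbd hlck).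
Qed.
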